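(* Let $a\in\mathbb{Z}$, $a\neq-1$. For the resolved conifold with one outer brane in framing $a$, the all-genera one-point function is $$\Psi^{(a)}_{1}(\lambda;t;x)=\sum_{n=1}^\infty\frac{x^n}{n i}\sum_{j=0}^n\frac{\prod_{k=1}^{n-1}[an+j+k]}{[j]!\,[n-j]!}\,Q^j .$$
   Context: Notation: $i=\sqrt{-1}$, $q=e^{i\lambda}$, $q^{1/2}=e^{i\lambda/2}$, $[m]=q^{m/2}-q^{-m/2}$, $[m]!=\prod_{k=1}^m[k]$ with $[0]!=1$, $Q=-e^{-t}$. $\mathbf p=(p_1,p_2,\dots)$ are commuting formal variables and $p_\eta=\prod_j p_{\eta_j}$. For a partition $\mu$: $|\mu|$ is its size, $l(\mu)$ its length, $\mu^t$ its transpose, $\kappa_\mu=\sum_j\mu_j(\mu_j-2j+1)$, $z_\mu=\prod_{j}j^{m_j(\mu)}m_j(\mu)!$ with $m_j(\mu)$ the multiplicity of $j$ in $\mu$; $\chi_\mu(\eta)$ is the value of the irreducible character of $S_{|\mu|}$ indexed by $\mu$ on the class of cycle type $\eta$ (taken to be $0$ if $|\mu|\ne|\eta|$). $W_{\mu,\nu}(q)$ is the rational function of $q^{1/2}$ given by $W_{\mu,\nu}(q)=s_\mu(q^{\rho})\,s_\nu(q^{\mu+\rho})$, where $s$ denotes Schur functions, $q^\rho=(q^{-1/2},q^{-3/2},\dots)$ and $q^{\mu+\rho}=(q^{\mu_j-j+1/2})_{j\ge1}$ (sums convergent for $|q|>1$), and $W_\nu(q)=s_\nu(q^\rho)$. The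 open string amplitude of the resolved conifold with one outer brane and framing $a$ is $$Z^{(a)}(\lambda;t;\mathbf p)=\sum_{\mu,\nu,\eta}q^{a\kappa_\mu/2}W_{\mu,\nu}(q)\,Q^{|\nu|}\,W_{\nu^t}(q)\,\frac{\chi_\mu(\eta)}{z_\eta\, i^{\,l(\eta)}}\,p_\eta$$ (sum over all partitions, a formal power series in $Q$ and the $p_n$). Put $\hat Z^{(a)}(\lambda;t;\mathbf p)=Z^{(a)}(\lambda;t;\mathbf p)/Z^{(a)}(\lambda;t;0)$ and $F^{(a)}=\log\hat Z^{(a)}$. The one-point function $F^{(a)}_n(\lambda;t)$ is the coefficient of the linear monomial $p_n$ in $F^{(a)}$, and $\Psi^{(a)}_1(\lambda;t;x)=\sum_{n\ge1}F^{(a)}_n(\lambda;t)\,x^n$. Empty products equal $1$. *)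

(* Defs.v *)
From HB Require Import structures.
From mathcomp Require Import all_boot all_order all_fingroup all_algebra.
From mathcomp Require Import all_solvable all_field all_character.
From mathcomp Require Import complex.

Set Implicit Arguments.
Unset Strict Implicit.
Unset Printing Implicit Defensive.

Import Order.TTheory GRing.Theory Num.Theory.

Local Open Scope ring_scope.

Definition is_intpart (s : seq nat) : bool := sorted geq s && (0%N \notin s).

Record intpart : Type := IntPart {
  intpart_val :> seq nat;
  _ : is_intpart intpart_val }.

HB.instance Definition _ := [isSub for intpart_val].
HB.instance Definition _ := [Choice of intpart by <:].

Definition part0 : intpart := @IntPart [::] isT.

(* The one-part partition (n); only meaningful for n > 0. *)
Definition part1 (n : nat) : intpart := insubd part0 [:: n].

Definition psize (mu : intpart) : nat := sumn mu.

Definition conj_seq (s : seq nat) : seq nat :=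
  mkseq (fun j => count (fun m => (j < m)%N) s) (head 0%N s).

Lemma is_intpart_conj (s : seq nat) : is_intpart (conj_seq s).
Proof.
apply/andP; split.
  rewrite /conj_seq /mkseq; apply: (@homo_sorted _ _ _ ltn).
    by move=> x y xy /=; apply: sub_count => m /=; apply: ltn_trans.
  exact: iota_ltn_sorted.
apply/mapP => -[j]; rewrite mem_iota /=; case: s => [|m s] //= jm.
by rewrite add0n in jm; rewrite jm.
Qed.

Definition pconj (mu : intpart) : intpart := IntPart (is_intpart_conj mu).

(* Parts are indexed from 0, hence the shift mu_j - 2 (j + 1) + 1. *)
Definition kappa (mu : intpart) : int :=
  \sum_(j < size mu)
    (nth 0%N mu j)%:Z * ((nth 0%N mu j)%:Z - 2 * (j.+1)%:Z + 1).

Definition zpart (eta : intpart) : nat :=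
  (\prod_(1 <= j < (psize eta).+1)
     (j ^ count_mem j eta * (count_mem j eta)`!))%N.

(* The Young subgroup S_mu of 'S_n: the permutations preserving the blocks of
   consecutive integers of sizes mu_1, mu_2, ... *)
Definition young_set (n : nat) (mu : seq nat) : {set 'S_n} :=
  [set s : 'S_n | [forall i, reshape_index mu (s i) == reshape_index mu i]]%SET.

Lemma young_group_set (n : nat) (mu : seq nat) : group_set (young_set n mu).
Proof.
apply/group_setP; split.
  by rewrite inE; apply/forallP => i; rewrite perm1.
move=> s t; rewrite !inE => /forallP hs /forallP ht; apply/forallP => i.
by rewrite permM (eqP (ht _)) (eqP (hs _)).
Qed.

Definition young (n : nat) (mu : seq nat) : {group 'S_n} :=
  Group (young_group_set n mu).

Lemma sgn_class_fun (n : nat) :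
  is_class_fun <<[set: 'S_n]>>%g [ffun s : 'S_n => (-1) ^+ odd_perm s].
Proof.
apply: intro_class_fun => [s t _ _|s]; last by rewrite mem_gen ?inE.
by rewrite odd_permJ.
Qed.

Definition sgn_char (n : nat) : 'CF([set: 'S_n]) := Cfun 0 (sgn_class_fun n).

(* The irreducible character labelled by mu is the unique common irreducible
   constituent of the character induced from the trivial character of S_mu and
   of the character induced from the sign character of S_(mu^t), so that the
   partition (n) labels the trivial character. *)
Definition irr_label (mu : intpart) : option (Iirr [set: 'S_(psize mu)]) :=
  [pick i : Iirr [set: 'S_(psize mu)] |
    (i \in irr_constt ('Ind[[set: 'S_(psize mu)], young (psize mu) mu] 1))
    && (i \in irr_constt
          ('Ind[[set: 'S_(psize mu)], young (psize mu) (pconj mu)]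
             ('Res[young (psize mu) (pconj mu)] (sgn_char (psize mu)))))].

Definition cycle_type (n : nat) (s : 'S_n) : seq nat :=
  [seq #|c| | c : {set 'I_n} <- enum (porbits s)].

(* Characters of symmetric groups take integer values, so Num.floor only
   changes the type from algC to int. If |mu| <> |eta| there is no permutation
   s as below, and the value is 0. *)
Definition chi (mu eta : intpart) : int :=
  match irr_label mu,
        [pick s : 'S_(psize mu) | perm_eq (cycle_type s) eta] with
  | Some i, Some s => Num.floor ('chi_i s)
  | _, _ => 0
  end.

From mathcomp Require Import all_classical all_reals all_analysis.

Import numFieldNormedType.Exports.

Local Open Scope classical_set_scope.
Local Open Scope ring_scope.

Section Schur.
Variable C : numFieldType.

(* Schur polynomial in x_0, ..., x_(N-1) as the quotient of alternants
   det (x_i ^ (nu_j + N - 1 - j)) / det (x_i ^ (N - 1 - j)), which is the value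
   of the polynomial at points with pairwise distinct coordinates, the only
   ones used below. *)
Definition schur_pol (nu : intpart) (N : nat) (x : nat -> C) : C :=
  if (size nu <= N)%N then
    \det (\matrix_(i < N, j < N) x i ^+ (nth 0%N nu j + (N.-1 - j)))
    / \det (\matrix_(i < N, j < N) x i ^+ (N.-1 - j))
  else 0.

Definition schur (nu : intpart) (x : nat -> C) : C :=
  lim (schur_pol nu N x @[N --> \oo]).

(* q^(mu + rho) as a function of s = q^(1/2): with parts indexed from 0 the
   exponent of q is mu_j - (j + 1) + 1/2; for |s| > 1 these values are
   pairwise distinct. *)
Definition qmurho (mu : intpart) (s : C) (j : nat) : C :=
  s ^ (2 * (nth 0%N mu j)%:Z - 2 * (j.+1)%:Z + 1).

End Schur.

Section Amplitude.
Variable R : realType.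

Definition Kq : fieldType := {fraction {poly R[i]}}.

Definition Kconst (c : R[i]) : Kq := tofrac c%:P.

(* q^(1/2), as an indeterminate over the complex numbers. *)
Definition qhalf : Kq := tofrac 'X.

Definition iK : Kq := Kconst 'i%C.

Definition qbr (m : int) : Kq := qhalf ^ m - qhalf ^ (- m).

Definition qfact (m : nat) : Kq := \prod_(1 <= k < m.+1) qbr k%:Z.

(* The rational function whose value at s = q^(1/2) is f s for all complex s
   with |s| > 1, i.e. |q| > 1. *)
Definition ratfun (f : R[i] -> R[i]) : Kq :=
  xget 0 [set r : Kq | exists u v : {poly R[i]},
    r = tofrac u / tofrac v /\
    forall s : R[i], 1 < `|s| -> v.[s] != 0 /\ f s = u.[s] / v.[s]].

Definition W2 (mu nu : intpart) : Kq :=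
  ratfun (fun s => schur mu (qmurho part0 s) * schur nu (qmurho mu s)).

Definition W1 (nu : intpart) : Kq :=
  ratfun (fun s => schur nu (qmurho part0 s)).

(* f d eta is the coefficient of Q^d p_eta. *)
Definition series : Type := nat -> intpart -> Kq.

Definition series1 : series := fun d eta => ((d == 0%N) && (eta == part0))%:R.

Definition series_mul (f g : series) : series := fun d eta =>
  \sum_(k < d.+1)
    \sum_(u \in [set u : intpart * intpart | perm_eq (u.1 ++ u.2) eta])
      f k u.1 * g (d - k)%N u.2.

Definition series_exp (f : series) (n : nat) : series :=
  iter n (series_mul f) series1.

(* 1 / f = \sum_k c^-(k+1) (c - f)^k with c the constant term of f, assumed
   nonzero; (c - f)^k only has terms of total degree at least k. *)
Definition series_inv (f : series) : series := fun d eta =>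
  let c := f 0%N part0 in
  \sum_(k < (d + size eta).+1)
    c ^- k.+1 * series_exp (fun e th => c * series1 e th - f e th) k d eta.

(* log f = \sum_(k >= 1) (-1)^(k-1) (f - 1)^k / k for f with constant term 1,
   truncated for the same reason. *)
Definition series_log (f : series) : series := fun d eta =>
  \sum_(1 <= k < (d + size eta).+1)
    (-1) ^+ k.-1 / k%:R *
      series_exp (fun e th => f e th - series1 e th) k d eta.

Definition series_p0 (f : series) : series := fun d eta =>
  if eta == part0 then f d eta else 0.

(* q^(a kappa_mu / 2) is (q^(1/2))^(a kappa_mu). The character vanishes unless
   |mu| = |eta|, so the sum over all mu is finite. *)
Definition Zamp (a : int) : series := fun d eta =>
  \sum_(u \in [set u : intpart * intpart | psize u.2 = d])
    qhalf ^ (a * kappa u.1) * W2 u.1 u.2 * W1 (pconj u.2)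
    * ((chi u.1 eta)%:~R / ((zpart eta)%:R * iK ^+ size eta)).

Definition Zhat (a : int) : series :=
  series_mul (Zamp a) (series_inv (series_p0 (Zamp a))).

Definition Famp (a : int) : series := series_log (Zhat a).

(* The coefficient of p_n in Famp, a formal power series in Q; n > 0. *)
Definition F1 (a : int) (n : nat) : nat -> Kq := fun d => Famp a d (part1 n).

(* Psi1 a n d is the coefficient of x^n Q^d in the one-point function. *)
Definition Psi1 (a : int) (n d : nat) : Kq :=
  if n is 0 then 0 else F1 a n d.

End Amplitude.

(* Main.v *)
(* Only the coefficient of p_n in Z/Z(0) contributes to F_n, and the n-cycle has
   non-zero character only on hooks.  The latter is seen on the exterior powers
   theta_s of the permutation representation: Mackey's formula for induced linear
   characters gives theta_s = chi_(s-1) + chi_s with chi_s irreducible, theta_s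
   vanishes at an n-cycle for 0 < s < n, so chi_s takes the value (-1)^s there, and
   column orthogonality with a centralizer of order n leaves nothing for the other
   irreducible characters.  By the dual Cauchy identity, the sum over the internal
   partition divided by its value at mu = 0 telescopes to the product of
   1 + Q q^c over the contents c of mu; it is proved for finitely many variables by
   Laplace expansion of a Vandermonde determinant and passed to the limit, the
   Jacobi-Trudi formula providing convergence and rationality in q^(1/2).  For the
   hook (A | B) of size n, s_mu(q^rho) = q^(kappa/4) / ([n] [A]! [B]!), and two
   applications of the q-binomial theorem, one in Q and one for the alternating sum
   over hooks, give the product formula. *)
Require Import Defs.
From HB Require Import structures.
From mathcomp Require Import all_boot all_order all_fingroup all_algebra.
From mathcomp Require Import all_solvable all_field all_character.
From mathcomp Require Import complex zify ring.

Set Implicit Arguments.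
Unset Strict Implicit.
Unset Printing Implicit Defensive.

Import Order.TTheory GRing.Theory Num.Theory.
Local Open Scope ring_scope.

(** * Induced linear characters *)

(** The definitions give no direct hold on values: [chi] evaluates whichever common constituent of
    two induced characters [pick] returns, and [W2] is whichever rational function [xget] returns
    for a family of limits. For characters, inner products with the theta_s bound the label: if
    chi_s is a common constituent, then mu has more than s parts and its first part is at least n -
    s, so mu_1 + l(mu) > |mu|, which happens only for hooks. For the amplitude, rational functions
    that agree for |s| > 1 are equal, so identities are proved at each such complex s and
    transferred. The infinite Cauchy product is never divided by: in N variables the product for mu
    times a finite correction equals the content polynomial times the product for the empty
    partition, and the correction tends to 1. The final collapse rests on kappa = n (A - B) for the
    hook (A | B) of size n: the framing factor q^(a kappa / 2) and the factor q^(j (A - B) / 2) from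
    the content polynomial merge into the single parameter a n + j, which is the shift inside the
    brackets. *)

Section LinearInduction.
Variables (gT : finGroupType) (G H K : {group gT}).
Hypotheses (sHG : H \subset G) (sKG : K \subset G).
Variables (phi : 'CF(H)) (psi : 'CF(K)).
Hypotheses (lphi : phi \is a linear_char) (lpsi : psi \is a linear_char).

(** Mackey's condition: [h ^ y] is y^-1 h y, so [phi] and the conjugate of [psi] by y are compared
    on the intersection of H with y K y^-1. *)
Definition intertwined (y : gT) : bool :=
  [forall h in H, ((h ^ y)%g \in K) ==> (phi h == psi (h ^ y)%g)].

Lemma intertwinedP y :
  reflect {in H, forall h, (h ^ y)%g \in K -> phi h = psi (h ^ y)%g}
          (intertwined y).
Proof.
apply: (iffP forallP) => [gy h Hh Kh | gy h].
  by apply/eqP; have:= gy h; rewrite Hh Kh.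
by apply/implyP => Hh; apply/implyP => Kh; apply/eqP/gy.
Qed.

(** Orthogonality of two linear characters of the intersection D: if they differ at some h0 in D,
    translating the sum by h0 multiplies it by a factor other than 1, so it vanishes. *)
Lemma sum_intertwined y :
  \sum_(h in H) phi h * (psi (h ^ y)%g)^* =
  (intertwined y)%:R * #|H :&: (K :^ y^-1)%g|%:R.
Proof.
pose D := (H :&: (K :^ y^-1)%g)%G.
have inD h : (h \in D) = (h \in H) && ((h ^ y)%g \in K).
  by rewrite inE mem_conjg invgK.
have -> : \sum_(h in H) phi h * (psi (h ^ y)%g)^* =
          \sum_(h in D) phi h * (psi (h ^ y)%g)^*.
  rewrite [LHS](bigID (mem K \o (fun h => (h ^ y)%g))) /= addrC big1 ?add0r.
    by apply: eq_bigl => h; rewrite inD.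
  by move=> h /andP[_ nK]; rewrite (cfun0 psi nK) conjC0 mulr0.
have psi1 h : h \in D -> psi (h ^ y)%g * (psi (h ^ y)%g)^* = 1.
  rewrite inD => /andP[_ Kh].
  by rewrite -normCK (normC_lin_char lpsi Kh) expr1n.
have [gy|] := boolP (intertwined y); last first.
  rewrite mul0r negb_forall => /existsP[h0].
  rewrite negb_imply negb_imply => /and3P[Hh0 Kh0 neq].
  have Dh0 : h0 \in D by rewrite inD Hh0 Kh0.
  set S := \sum_(h in D) _.
  have eS : S = phi h0 * (psi (h0 ^ y)%g)^* * S.
    rewrite {1}/S (reindex_inj (mulgI h0)) /= mulr_sumr.
    apply: eq_big => [h|h]; first by rewrite groupMl.
    rewrite groupMl // inD => /andP[Hh Kh].
    rewrite conjMg (lin_charM lphi) // (lin_charM lpsi) // rmorphM /=.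
    by rewrite mulrACA.
  have: (1 - phi h0 * (psi (h0 ^ y)%g)^*) * S = 0.
    by rewrite mulrBl mul1r -eS subrr.
  move/eqP; rewrite mulf_eq0 => /orP[|/eqP//]; rewrite subr_eq0 => /eqP e1.
  case/negP: neq; apply/eqP; rewrite -[RHS]mul1r e1 -mulrA.
  by rewrite [X in _ * X]mulrC psi1 ?mulr1.
rewrite mul1r -sum1_card natr_sum; apply: eq_bigr => h Dh.
have:= Dh; rewrite inD => /andP[Hh Kh].
by rewrite (intertwinedP _ gy) // psi1.
Qed.

(** Mackey's formula summed over all y rather than over double coset representatives; by
    [card_double_coset_conj] the weights of one double coset add up to |H| |K|, which the prefactor
    cancels. *)
Lemma cfdot_Ind_lin :
  '['Ind[G] phi, 'Ind[G] psi] =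
  (#|H|%:R * #|K|%:R)^-1 *
  \sum_(y in G | intertwined y) #|H :&: (K :^ y^-1)%g|%:R.
Proof.
rewrite -Frobenius_reciprocity cfdotE invfM -mulrA; congr (_ * _).
rewrite big_mkcondr /= mulr_sumr.
transitivity (\sum_(h in H) #|K|%:R^-1 *
   \sum_(y in G) phi h * (psi (h ^ y)%g)^*).
  apply: eq_bigr => h Hh; rewrite cfResE // cfIndE // rmorphM /= fmorphV.
  rewrite rmorph_nat rmorph_sum /= mulrCA; congr (_ * _).
  by rewrite mulr_sumr.
rewrite -mulr_sumr exchange_big /= mulr_sumr; apply: eq_bigr => y Gy.
by rewrite sum_intertwined; case: (intertwined y); rewrite ?mul1r ?mul0r ?mulr0.
Qed.

Lemma cfdot_Ind_lin_eq0 :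
  {in G, forall y, ~~ intertwined y} -> '['Ind[G] phi, 'Ind[G] psi] = 0.
Proof.
move=> ny; rewrite cfdot_Ind_lin big1 ?mulr0 // => y /andP[Gy].
by rewrite (negPf (ny y Gy)).
Qed.

Lemma cfdot_Ind_lin_neq0 y :
  y \in G -> intertwined y -> '['Ind[G] phi, 'Ind[G] psi] != 0.
Proof.
move=> Gy gy; rewrite cfdot_Ind_lin mulf_neq0 //.
  by rewrite invr_eq0 mulf_neq0 // pnatr_eq0 -lt0n cardG_gt0.
rewrite (bigD1 y) /=; last by rewrite Gy.
rewrite -natr_sum -natrD pnatr_eq0 addn_eq0 negb_and -lt0n.
by rewrite (cardG_gt0 (H :&: (K :^ y^-1)%g)%G).
Qed.

(** The summand is constant on HzK, and HzK is a right translate of the product of H and the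
    conjugate of K by z^-1, whose size is given by the product formula. *)
Lemma card_double_coset_conj z :
  (\sum_(y in (H :* z * K)%g) #|H :&: (K :^ y^-1)%g| = #|H| * #|K|)%N.
Proof.
transitivity (\sum_(y in (H :* z * K)%g) #|H :&: (K :^ z^-1)%g|)%N.
  apply: eq_bigr => y /mulsgP[hz k /rcosetP[h Hh ->] Kk ->].
  rewrite !invMg !conjsgM conjGid ?groupV //.
  by rewrite -[in LHS](conjGid (groupVr Hh)) -conjIg cardJg.
rewrite sum_nat_const -[RHS]/(#|H| * #|K|)%N.
have -> : #|(H :* z * K)%g| = #|(H * K :^ z^-1)%g|.
  rewrite -[RHS](card_rcoset _ z); congr #|pred_of_set _|.
  by rewrite conjsgE invgK -!mulgA mulg_set1 mulVg mulg1.
by rewrite -(mul_cardG H (K :^ z^-1)%G) /= cardJg.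
Qed.

(** Each double coset contributes at most 1. As this is only an upper bound, [Z] may list the same
    double coset several times. *)
Lemma cfdot_Ind_lin_le (Z : seq gT) :
  {in G, forall y, intertwined y -> has (fun z => y \in (H :* z * K)%g) Z} ->
  '['Ind[G] phi, 'Ind[G] psi] <= (size Z)%:R.
Proof.
move=> hZ; rewrite cfdot_Ind_lin mulrC ler_pdivrMr; last first.
  by rewrite -natrM ltr0n muln_gt0 !cardG_gt0.
rewrite -natr_sum -!natrM ler_nat.
apply: (@leq_trans (\sum_(z <- Z) \sum_(y in (H :* z * K)%g)
                      #|H :&: (K :^ y^-1)%g|)%N); last first.
  rewrite (eq_bigr (fun=> #|H| * #|K|)%N); last first.
    by move=> z _; rewrite card_double_coset_conj.
  by rewrite big_const_seq count_predT iter_addn_0 mulnC.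
under [leqRHS]eq_bigr do rewrite big_mkcond.
rewrite exchange_big /= big_mkcond; apply: leq_sum => y _.
case: ifP => // /andP[Gy gy].
have /hasP[z Zz yz] := hZ y Gy gy.
by rewrite (big_rem z Zz) /= yz leq_addr.
Qed.

End LinearInduction.

(** * Exterior powers of the permutation character *)

Section SignCharacter.
Variables (gT : finGroupType) (G : {group gT}) (e : gT -> bool).
Hypothesis eM : {in G &, {morph e : x y / (x * y)%g >-> x (+) y}}.

Lemma sign_repr : mx_repr G (fun x => ((-1) ^+ e x)%:M : 'M[algC]_1).
Proof.
split=> [|x y Gx Gy]; last by rewrite eM // signr_addb scalar_mxM.
by have := eM (group1 G) (group1 G); rewrite mulg1 addbb => ->.
Qed.

Definition sign_cfun : 'CF(G) := cfRepr (MxRepresentation sign_repr).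

Lemma sign_cfunE x : x \in G -> sign_cfun x = (-1) ^+ e x.
Proof. by move=> Gx; rewrite cfunE Gx mulr1n /= mxtrace_scalar. Qed.

Lemma sign_cfun_lin : sign_cfun \is a linear_char.
Proof. by rewrite qualifE /= cfRepr_char cfRepr1 eqxx. Qed.

End SignCharacter.

Section Wedge.
Variable T : finType.
Implicit Types (S U : {set T}) (s y h : {perm T}) (b : T -> nat).

Lemma restr_perm_sgnM S :
  {in 'N(S | 'P)%g &, {morph (fun s => odd_perm (restr_perm S s)) :
     x y / (x * y)%g >-> x (+) y}}.
Proof. by move=> x y Nx Ny; rewrite morphM // odd_permM. Qed.

(** The stabilizer of S is Sym(S) x Sym(~: S); this is the sign of the first factor. *)
Definition stab_sgn S : 'CF('N(S | 'P)%G) := sign_cfun (@restr_perm_sgnM S).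

(* The character of the exterior power of degree #|S| of the permutation
   representation. *)
Definition wedge S : 'CF([set: {perm T}]) := 'Ind[[set: {perm T}]] (stab_sgn S).

Lemma stab_sgn_lin S : stab_sgn S \is a linear_char.
Proof. exact: sign_cfun_lin. Qed.

Lemma wedge_char S : wedge S \is a character.
Proof. by apply: cfInd_char; apply: lin_charW; apply: stab_sgn_lin. Qed.

Lemma stab_sgnE S s : s \in 'N(S | 'P)%g ->
  stab_sgn S s = (-1) ^+ odd_perm (restr_perm S s).
Proof. exact: sign_cfunE. Qed.

Lemma in_stab S s : (s \in 'N(S | 'P)%g) = [forall x, (s x \in S) == (x \in S)].
Proof. by apply/astabsP/forallP => [h x|h x]; [apply/eqP/h | apply/eqP/h]. Qed.

Lemma restr_perm_eq S s u : s \in 'N(S | 'P)%g ->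
  perm_on S u -> {in S, s =1 u} -> restr_perm S s = u.
Proof.
move=> Ns Su eq_su; apply/permP => x; have [Sx|nSx] := boolP (x \in S).
  by rewrite restr_permE // eq_su.
by rewrite (out_perm (restr_perm_on S s)) // (out_perm Su).
Qed.

Lemma tperm_stab_in S x z : x \in S -> z \in S -> tperm x z \in 'N(S | 'P)%g.
Proof.
move=> Sx Sz; apply/astabsP => w /=; rewrite /aperm.
by case: tpermP => [->|->|]; rewrite ?Sx ?Sz.
Qed.

Lemma tperm_stab_out S x z : x \notin S -> z \notin S -> tperm x z \in 'N(S | 'P)%g.
Proof.
move=> Sx Sz; apply/astabsP => w /=; rewrite /aperm.
by case: tpermP => [->|->|]; rewrite ?(negPf Sx) ?(negPf Sz).
Qed.

Lemma stab_sgn_tperm_in S x z : x \in S -> z \in S -> x != z ->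
  stab_sgn S (tperm x z) = -1.
Proof.
move=> Sx Sz xz; rewrite stab_sgnE ?tperm_stab_in //.
rewrite (@restr_perm_eq _ _ (tperm x z)) ?tperm_stab_in ?odd_tperm ?xz ?expr1 //.
rewrite /perm_on; apply/subsetP => w; rewrite inE; apply: contraR => nSw.
by rewrite tpermD //; apply: contraNneq nSw => <-.
Qed.

Lemma stab_sgn_tperm_out S x z : x \notin S -> z \notin S ->
  stab_sgn S (tperm x z) = 1.
Proof.
move=> Sx Sz; rewrite stab_sgnE ?tperm_stab_out //.
rewrite (@restr_perm_eq _ _ 1%g) ?tperm_stab_out ?odd_perm1 ?expr0 //.
  exact: perm_on1.
move=> w Sw; rewrite perm1 tpermD //.
  by apply: contraNneq Sx => ->.
by apply: contraNneq Sz => ->.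
Qed.

Lemma stab_conj S h y :
  ((h ^ y)%g \in 'N(S | 'P)%g) = (h \in 'N(y @^-1: S | 'P)%g).
Proof.
rewrite !in_stab; apply/forallP/forallP => hs x.
  by have:= hs (y x); rewrite permJ !inE.
by have:= hs (y^-1%g x); rewrite !inE permKV -permJ permKV.
Qed.

Lemma stab_sgn_conj S h y : h \in 'N(y @^-1: S | 'P)%g ->
  stab_sgn S (h ^ y)%g = stab_sgn (y @^-1: S) h.
Proof.
move=> Nh; rewrite !stab_sgnE ?stab_conj //; congr (_ ^+ nat_of_bool _).
rewrite -(odd_permJ (restr_perm (y @^-1: S) h) y); congr odd_perm.
apply: restr_perm_eq; first by rewrite stab_conj.
  rewrite /perm_on; apply/subsetP => x; rewrite inE; apply: contraR => nSx.
  rewrite -(permKV y x) in nSx *; rewrite permJ (out_perm (restr_perm_on _ _)) //.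
  by rewrite inE.
move=> x Sx; rewrite -[x](permKV y) !permJ restr_permE // inE.
by rewrite permKV.
Qed.

(** A permutation preserving both sets preserves both differences, hence fixes their at most one
    element, and the two restrictions coincide. *)
Lemma stab_sgn_eq S U h : (#|S :\: U| <= 1)%N -> (#|U :\: S| <= 1)%N ->
  h \in 'N(S | 'P)%g -> h \in 'N(U | 'P)%g -> stab_sgn S h = stab_sgn U h.
Proof.
move=> SU US NS NU; rewrite !stab_sgnE //; congr (_ ^+ nat_of_bool (odd_perm _)).
have hS x : (h x \in S) = (x \in S) by have/astabsP := NS; apply.
have hU x : (h x \in U) = (x \in U) by have/astabsP := NU; apply.
have fixed (A B : {set T}) x : (#|A :\: B| <= 1)%N -> (forall x, (h x \in A) = (x \in A)) ->
    (forall x, (h x \in B) = (x \in B)) -> x \in A -> x \notin B -> h x = x.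
  move=> /card_le1P AB hA hB Ax nBx.
  have xAB : x \in A :\: B by rewrite inE Ax nBx.
  have : h x \in A :\: B by rewrite inE hA hB Ax nBx.
  by rewrite (AB _ xAB) => /eqP.
apply/permP => x; have [Sx|nSx] := boolP (x \in S).
  have [Ux|nUx] := boolP (x \in U); first by rewrite !restr_permE.
  rewrite restr_permE //= (out_perm (restr_perm_on _ _)) //.
  exact: (fixed S U).
rewrite (out_perm (restr_perm_on _ _)) //.
have [Ux|nUx] := boolP (x \in U); last by rewrite (out_perm (restr_perm_on _ _)).
by rewrite restr_permE // (fixed U S).
Qed.

(** If one difference has two elements, their transposition stabilizes both sets, with sign -1 on
    the set containing them and 1 on the other; the converse is [stab_sgn_eq]. *)
Lemma wedge_intertwined S U y :
  intertwined (stab_sgn S) (stab_sgn U) y =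
  (#|S :\: y @^-1: U| <= 1)%N && (#|y @^-1: U :\: S| <= 1)%N.
Proof.
apply/intertwinedP/andP => [gy | [h1 h2] h Nh Nhy]; last first.
  rewrite stab_conj in Nhy.
  by rewrite stab_sgn_conj // (stab_sgn_eq h1 h2).
have neg1 : 1 != -1 :> algC.
  by rewrite eq_sym -subr_eq0 -opprD oppr_eq0 (pnatr_eq0 _ 2).
split; rewrite leqNgt; apply/card_gt1P => -[x [z [/setDP[Ax nx] /setDP[Az nz] xz]]].
  case/eqP: neg1; rewrite -(stab_sgn_tperm_in Ax Az xz).
  rewrite gy ?tperm_stab_in ?stab_conj ?tperm_stab_out //.
  by rewrite stab_sgn_conj ?tperm_stab_out ?stab_sgn_tperm_out.
case/eqP: neg1; rewrite -{1}(stab_sgn_tperm_out nx nz).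
rewrite gy ?tperm_stab_out ?stab_conj ?tperm_stab_in //.
by rewrite stab_sgn_conj ?tperm_stab_in ?stab_sgn_tperm_in.
Qed.

Lemma wedge_ortho S U : (#|S|.+1 < #|U|)%N -> '[wedge S, wedge U] = 0.
Proof.
move=> SU; apply: cfdot_Ind_lin_eq0; rewrite ?subsetT ?stab_sgn_lin //.
move=> y _; rewrite wedge_intertwined negb_and -!ltnNge; apply/orP; right.
have e : #|y @^-1: U| = #|U| by rewrite card_preimset //; apply: perm_inj.
have := cardsID S (y @^-1: U); have := subset_leq_card (subsetIr (y @^-1: U) S).
rewrite e; lia.
Qed.

Lemma wedge_neq0 S U : S \subset U -> #|U| = #|S|.+1 -> '[wedge S, wedge U] != 0.
Proof.
move=> SU cU; apply: (@cfdot_Ind_lin_neq0 _ _ _ _ _ _ _ _ _ _ 1%g);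
  rewrite ?subsetT ?stab_sgn_lin ?inE //.
have e1 : (1%g : {perm T}) @^-1: U = U by apply/setP => x; rewrite inE perm1.
rewrite wedge_intertwined e1 cardsD (setIidPl SU) subnn /=.
by rewrite cardsD (setIidPr SU) cU subSn // subnn.
Qed.

Lemma in_double_coset (H K : {group {perm T}}) z y h :
  h \in H -> (z^-1 * h^-1 * y)%g \in K -> y \in (H :* z * K)%g.
Proof.
move=> Hh Kk; apply/mulsgP; exists (h * z)%g (z^-1 * h^-1 * y)%g => //.
  by apply/rcosetP; exists h.
by rewrite !mulgA mulgK mulgV mul1g.
Qed.

Lemma wedge_norm1 S : (S == set0) || (S == setT) -> '[wedge S] <= 1.
Proof.
move=> S0; have := @cfdot_Ind_lin_le _ [set: {perm T}]%G _ _ (subsetT _) (subsetT _) _ _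
  (stab_sgn_lin S) (stab_sgn_lin S) [:: 1%g]; apply.
move=> y _ _ /=; rewrite orbF; apply: (@in_double_coset _ _ _ _ 1%g); rewrite ?group1 //.
rewrite in_stab; apply/forallP => x.
by case/orP: S0 => /eqP ->; rewrite !inE.
Qed.

(** By [wedge_intertwined] the preimage of S under y is either S or S with one element x exchanged
    for an outside element z; these two cases are the double cosets of 1 and of a fixed
    transposition across S. *)
Lemma wedge_norm2 S : '[wedge S] <= 2%:R.
Proof.
have [S0|] := boolP ((S == set0) || (S == setT)).
  by apply: (le_trans (wedge_norm1 S0)); rewrite ler1n.
rewrite negb_or -subTset => /andP[/set0Pn[x0 Sx0] /subsetPn[z0 _ nSz0]].
have := @cfdot_Ind_lin_le _ [set: {perm T}]%G _ _ (subsetT _) (subsetT _) _ _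
  (stab_sgn_lin S) (stab_sgn_lin S) [:: 1%g; tperm x0 z0]; apply.
move=> y _; rewrite wedge_intertwined => /andP[h1 h2] /=; rewrite orbF; apply/orP.
have e : #|y @^-1: S| = #|S| by rewrite card_preimset //; apply: perm_inj.
have c1 := cardsID S (y @^-1: S); have c2 := cardsID (y @^-1: S) S.
rewrite setIC in c1; have c3 : #|S :\: y @^-1: S| = #|y @^-1: S :\: S| by lia.
have [eS|neS] := eqVneq (y @^-1: S) S.
  left; apply: (@in_double_coset _ _ _ _ 1%g); rewrite ?group1 // invg1 !mul1g.
  rewrite in_stab; apply/forallP => x.
  by have := congr1 (fun A : {set T} => x \in A) eS; rewrite inE => ->.
right.
have /card_gt0P[x] : (0 < #|S :\: y @^-1: S|)%N.
  rewrite lt0n; apply: contraNneq neS => c0; rewrite eqEsubset.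
  by rewrite -!setD_eq0 -!cards_eq0 -c3 c0.
have /card_gt0P[z] : (0 < #|y @^-1: S :\: S|)%N.
  rewrite -c3 lt0n; apply: contraNneq neS => c0; rewrite eqEsubset.
  by rewrite -!setD_eq0 -!cards_eq0 -c3 c0.
move: h1 h2 => /card_le1P h1 /card_le1P h2 zS xS.
have {h1} h1 := h1 _ xS; have {h2} h2 := h2 _ zS.
move: zS xS => /setDP[Syz nSz] /setDP[Sx nSyx]; rewrite !inE in Syz nSyx.
(* This element of the stabilizer matches the exchanged pair (x, z) with the reference pair (x0,
   z0). *)
apply: (@in_double_coset _ _ _ _ (tperm x0 x * tperm z0 z)%g).
  by apply: groupM; [apply: tperm_stab_in | apply: tperm_stab_out].
rewrite invMg !tpermV; apply/astabsP => w /=; rewrite /aperm !permM.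
(* The preimage of S under y is S without x and with z. *)
have key v : (y v \in S) = (v == z) || ((v != x) && (v \in S)).
  have [->|vz] /= := eqVneq v z; first by rewrite Syz.
  have [->|vx] /= := eqVneq v x; first by rewrite (negPf nSyx).
  have := h1 v; have := h2 v; rewrite !inE (negPf vz) (negPf vx).
  by case: (v \in S); case: (y v \in S).
rewrite key.
have xz : x != z by apply: contraNneq nSz => <-.
have xz0 : x != z0 by apply: contraNneq nSz0 => <-.
have x0z0 : x0 != z0 by apply: contraNneq nSz0 => <-.
have x0z : x0 != z by apply: contraNneq nSz => <-.
case: (tpermP x0 z0 w) => [->|->|/eqP wx0 /eqP wz0].
- rewrite (tpermL z0 z) (tpermD x0z xz) eqxx.
  by rewrite Sx0.
  rewrite (@tpermD _ z0 z x0) ?(eq_sym _ x0) // (tpermL x0 x) (negPf xz) eqxx /=.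
  by rewrite (negPf nSz0).
case: (tpermP z0 z w) => [ew|ew|/eqP wz' /eqP wz].
- by rewrite ew eqxx in wz0.
- rewrite ew in wz0 *.
  by rewrite (tpermD x0z0 xz0) (negPf nSz0) (negPf nSz) eq_sym (negPf wz0) andbF.
case: (tpermP x0 x w) => [ew|ew|/eqP wz'' /eqP wx].
- by rewrite ew eqxx in wx0.
- by rewrite ew in wx0 *; rewrite (negPf x0z) Sx Sx0 andbT /= eq_sym wx0.
by rewrite (negPf wz) wx.
Qed.

End Wedge.

(** * Pairing Young subgroup characters with exterior powers *)

Section YoungWedge.
Variables (T : finType) (b : T -> nat) (Y : {group {perm T}}).
Hypothesis inY : forall s, (s \in Y) = [forall x, b (s x) == b x].
Implicit Types (S : {set T}).

Lemma tperm_Young x z : b x = b z -> tperm x z \in Y.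
Proof.
move=> bxz; rewrite inY; apply/forallP => w.
by case: tpermP => [->|->|//]; rewrite bxz.
Qed.

Lemma Young_fix S s : s \in Y -> s \in 'N(S | 'P)%g -> {in S &, injective b} ->
  {in S, forall x, s x = x}.
Proof.
rewrite inY in_stab => /forallP bs /forallP sS injb x Sx.
by apply: injb; rewrite ?(eqP (sS x)) //; apply/eqP.
Qed.

(** Two points of the preimage of S in one block would give a transposition in [Y] on which the
    trivial character is 1 and the sign is -1. The consequence used later is that |S| is at most the
    number of blocks. *)
Lemma Ind_one_wedge S : '['Ind[[set: {perm T}], Y] 1, wedge S] != 0 ->
  exists2 U : {set T}, #|U| = #|S| & {in U &, injective b}.
Proof.
move=> neq0.
have /existsP[y gy] : [exists y, intertwined (1 : 'CF(Y)) (stab_sgn S) y].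
  apply: contraR neq0 => /existsPn ny; apply/eqP.
  apply: cfdot_Ind_lin_eq0; rewrite ?subsetT ?cfun1_lin_char ?stab_sgn_lin //.
exists (y @^-1: S); first by rewrite card_preimset //; apply: perm_inj.
move=> x z Ux Uz bxz; apply/eqP/negPn/negP => xz.
have Yt := tperm_Young bxz.
have := intertwinedP _ _ _ gy _ Yt; rewrite stab_conj tperm_stab_in // => /(_ isT).
rewrite cfun1E Yt stab_sgn_conj ?tperm_stab_in // stab_sgn_tperm_in // => /eqP.
by rewrite -subr_eq0 opprK (pnatr_eq0 _ 2).
Qed.

(** An element of [Y] preserving a set that meets each block at most once fixes it pointwise, so
    both characters are 1 there. *)
Lemma Ind_one_wedge_neq0 S (y : {perm T}) : {in y @^-1: S &, injective b} ->
  '['Ind[[set: {perm T}], Y] 1, wedge S] != 0.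
Proof.
move=> injb; apply: (@cfdot_Ind_lin_neq0 _ _ _ _ _ _ _ _ _ _ y);
  rewrite ?subsetT ?stab_sgn_lin ?cfun1_lin_char ?inE //.
apply/intertwinedP => h Yh; rewrite stab_conj => Nh.
rewrite cfun1E Yh stab_sgn_conj // stab_sgnE //.
rewrite (@restr_perm_eq _ _ _ 1%g) ?odd_perm1 ?perm_on1 //.
by move=> x Sx; rewrite perm1 (Young_fix Yh Nh).
Qed.

Variable psi : 'CF(Y).
Hypothesis psiE : {in Y, forall s, psi s = (-1) ^+ odd_perm s}.
Hypothesis lpsi : psi \is a linear_char.

(** With the sign character of [Y] the obstruction moves to the complement: a transposition outside
    the preimage of S has sign -1 in [Y] but acts trivially on that preimage. *)
Lemma Ind_sgn_wedge S : '['Ind[[set: {perm T}], Y] psi, wedge S] != 0 ->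
  exists2 U : {set T}, #|U| = #|S| & {in ~: U &, injective b}.
Proof.
move=> neq0.
have /existsP[y gy] : [exists y, intertwined psi (stab_sgn S) y].
  apply: contraR neq0 => /existsPn ny; apply/eqP.
  apply: cfdot_Ind_lin_eq0; rewrite ?subsetT ?lpsi ?stab_sgn_lin //.
exists (y @^-1: S); first by rewrite card_preimset //; apply: perm_inj.
move=> x z /setCP/negP Ux /setCP/negP Uz bxz; apply/eqP/negPn/negP => xz.
have Yt := tperm_Young bxz.
have := intertwinedP _ _ _ gy _ Yt; rewrite stab_conj tperm_stab_out // => /(_ isT).
rewrite psiE // odd_tperm xz expr1 stab_sgn_conj ?tperm_stab_out //.
rewrite stab_sgn_tperm_out // => /eqP.
by rewrite eq_sym -subr_eq0 opprK (pnatr_eq0 _ 2).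
Qed.

Lemma Ind_sgn_wedge_neq0 S : {in ~: S &, injective b} ->
  '['Ind[[set: {perm T}], Y] psi, wedge S] != 0.
Proof.
move=> injb; apply: (@cfdot_Ind_lin_neq0 _ _ _ _ _ _ _ _ _ _ 1%g);
  rewrite ?subsetT ?stab_sgn_lin ?lpsi ?inE //.
apply/intertwinedP => h Yh; rewrite conjg1 => Nh.
have Nh' : h \in 'N(~: S | 'P)%g by rewrite astabsC.
rewrite psiE // stab_sgnE // (@restr_perm_eq _ _ _ h) //.
rewrite /perm_on; apply/subsetP => x; rewrite inE; apply: contraR => nSx.
by rewrite (Young_fix Yh Nh') // inE.
Qed.

End YoungWedge.

(** Two injections of [D] into [S] differ by a permutation of [S], built one point at a time by
    transpositions. It serves to put two intertwining elements into one double coset. *)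
Lemma perm_on_extension (T : finType) (S : {set T}) (f g : {perm T}) (D : seq T) :
  {in D, forall x, f x \in S} -> {in D, forall x, g x \in S} ->
  exists2 a : {perm T}, perm_on S a & {in D, forall x, a (f x) = g x}.
Proof.
elim: D => [|x D IH] fS gS; first by exists 1%g; rewrite ?perm_on1.
have xD z : z \in D -> z \in x :: D by rewrite inE => ->; rewrite orbT.
have [||a Sa ag] := IH; [by move=> z /xD/fS | by move=> z /xD/gS |].
have afx : a (f x) \in S by rewrite perm_closed // fS ?mem_head.
have gx : g x \in S by rewrite gS ?mem_head.
exists (a * tperm (a (f x)) (g x))%g.
  apply: perm_onM => //; rewrite /perm_on; apply/subsetP => w; rewrite inE.
  by apply: contraR => nSw; rewrite tpermD //; apply: contraNneq nSw => <-.
move=> z; rewrite inE permM => /predU1P[->|zD]; first by rewrite tpermL.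
have [->|zx] := eqVneq z x; first by rewrite tpermL.
rewrite -(ag z zD) tpermD //; last by rewrite ag // (inj_eq perm_inj) eq_sym.
by rewrite !(inj_eq perm_inj) eq_sym.
Qed.

Section HookMultiplicity.
Variables (T : finType) (A B : {set T}) (H K : {group {perm T}}).
Hypothesis inH : forall s, (s \in H) = perm_on A s.
Hypothesis inK : forall s, (s \in K) = perm_on B s.
Hypothesis cAB : (#|A| + #|B| = #|T|.+1)%N.
Variable psi : 'CF(K).
Hypothesis psiE : {in K, forall s, psi s = (-1) ^+ odd_perm s}.
Hypothesis lpsi : psi \is a linear_char.

Lemma tperm_perm_on (S : {set T}) x z : x \in S -> z \in S -> perm_on S (tperm x z).
Proof.
move=> Sx Sz; rewrite /perm_on; apply/subsetP => w; rewrite inE.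
by apply: contraR => nSw; rewrite tpermD //; apply: contraNneq nSw => <-.
Qed.

(** Two common points of [A] and the preimage of [B] would give a transposition with values 1 and
    -1; so they share at most one point, and since |A| + |B| = |T| + 1 they cover everything. *)
Lemma intertwined_hook y : intertwined (1 : 'CF(H)) psi y -> ~: (y @^-1: B) \subset A.
Proof.
move=> gy; have eB : #|y @^-1: B| = #|B| by rewrite card_preimset //; apply: perm_inj.
have le1 : (#|A :&: y @^-1: B| <= 1)%N.
  rewrite leqNgt; apply/card_gt1P => -[x [z [/setIP[Ax Bx] /setIP[Az Bz] xz]]].
  rewrite !inE in Bx Bz.
  have Ht : tperm x z \in H by rewrite inH tperm_perm_on.
  have Kt : (tperm x z ^ y)%g \in K by rewrite tpermJ inK tperm_perm_on.
  have := intertwinedP _ _ _ gy _ Ht Kt.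
  rewrite cfun1E Ht psiE // odd_permJ odd_tperm xz expr1 => /eqP.
  by rewrite -subr_eq0 opprK (pnatr_eq0 _ 2).
have e1 := cardsUI A (y @^-1: B); rewrite eB cAB in e1.
have : #|A :|: y @^-1: B| = #|T| 
  by apply/eqP; rewrite eqn_leq max_card -ltnS -e1 -addn1 leq_add2l.
move=> cU; have /eqP eU : A :|: y @^-1: B == setT by rewrite eqEcard subsetT cardsT cU /=.
apply/subsetP => x; rewrite inE => nBx.
by have := in_setT x; rewrite -eU inE (negPf nBx) orbF.
Qed.

(** Every intertwining y has an inverse that maps the complement of [B] into [A]; two such maps
    differ by an element of Sym(A), and what is left lies in Sym(B), so there is a single double
    coset. *)
Lemma hook_multiplicity :
  '['Ind[[set: {perm T}], H] 1, 'Ind[[set: {perm T}], K] psi] <= 1.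
Proof.
have [|] := boolP [exists y, intertwined (1 : 'CF(H)) psi y]; last first.
  move=> /existsPn ny; rewrite cfdot_Ind_lin_eq0 ?ler01 ?subsetT ?cfun1_lin_char //.
case/existsP => z gz.
have := @cfdot_Ind_lin_le _ [set: {perm T}]%G H K (subsetT _) (subsetT _) _ _
  (cfun1_lin_char H) lpsi [:: z]; apply.
move=> y _ gy /=; rewrite orbF.
have fy : {in enum (~: B), forall x, y^-1%g x \in A}.
  move=> x; rewrite mem_enum inE => nBx; apply: (subsetP (intertwined_hook gy)).
  by rewrite !inE permKV.
have fz : {in enum (~: B), forall x, z^-1%g x \in A}.
  move=> x; rewrite mem_enum inE => nBx; apply: (subsetP (intertwined_hook gz)).
  by rewrite !inE permKV.
have [a Aa ag] := perm_on_extension fz fy.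
apply: (@in_double_coset _ _ _ _ _ a^-1%g); first by rewrite groupV inH.
rewrite invgK inK /perm_on; apply/subsetP => x; rewrite inE; apply: contraR => nBx.
by rewrite !permM ag ?permKV // mem_enum inE.
Qed.

End HookMultiplicity.

(** * Common irreducible constituents *)

Section CommonConstituents.
Variables (gT : finGroupType) (G : {group gT}).
Implicit Types phi psi : 'CF(G).

Lemma cfdot_char_irr_ge1 phi i : phi \is a character -> i \in irr_constt phi ->
  1 <= '[phi, 'chi_i].
Proof.
move=> Nphi; rewrite irr_consttE.
have /natrP[m ->] := Cnat_cfdot_char_irr i Nphi.
by rewrite pnatr_eq0 ler1n lt0n.
Qed.

Lemma cfdot_char_irr_ge0 phi i : phi \is a character -> 0 <= '[phi, 'chi_i].
Proof. by move=> Nphi; have /natrP[m ->] := Cnat_cfdot_char_irr i Nphi. Qed.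

Lemma cfdot_char_irrC phi i : phi \is a character -> '['chi_i, phi] = '[phi, 'chi_i].
Proof.
by move=> Nphi; rewrite cfdotC; have /natrP[m ->] := Cnat_cfdot_char_irr i Nphi;
  rewrite conjC_nat.
Qed.

Lemma cfdot_char_sum phi psi : psi \is a character ->
  '[phi, psi] = \sum_i '[phi, 'chi_i] * '[psi, 'chi_i].
Proof.
move=> Npsi; rewrite cfdot_sum_irr; apply: eq_bigr => i _.
by have /natrP[m ->] := Cnat_cfdot_char_irr i Npsi; rewrite conjC_nat.
Qed.

Lemma common_constt phi psi : phi \is a character -> psi \is a character ->
  '[phi, psi] != 0 -> exists i, (i \in irr_constt phi) && (i \in irr_constt psi).
Proof.
move=> Nphi Npsi; rewrite cfdot_char_sum // => neq0.
apply/existsP; apply: contraR neq0 => /existsPn ni; apply/eqP/big1 => i _.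
have := ni i; rewrite !irr_consttE negb_and !negbK.
by case/orP => /eqP ->; rewrite ?mulr0 ?mul0r.
Qed.

Lemma common_constt_neq0 phi psi i : phi \is a character -> psi \is a character ->
  i \in irr_constt phi -> i \in irr_constt psi -> '[phi, psi] != 0.
Proof.
move=> Nphi Npsi ci di; rewrite cfdot_char_sum //.
rewrite (bigD1 i) //= gt_eqF //; apply: ltr_wpDr.
  by apply: sumr_ge0 => j _; rewrite mulr_ge0 ?cfdot_char_irr_ge0.
by rewrite mulr_gt0 // (lt_le_trans ltr01) ?cfdot_char_irr_ge1.
Qed.

Lemma common_constt_uniq phi psi i j : phi \is a character -> psi \is a character ->
  '[phi, psi] <= 1 -> i \in irr_constt phi -> i \in irr_constt psi ->
  j \in irr_constt phi -> j \in irr_constt psi -> i = j.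
Proof.
move=> Nphi Npsi le1 ci di cj dj; apply/eqP; apply: contraLR le1 => nij.
rewrite -real_ltNge ?real1 ?(natr_real, Rreal_nat) //; last first.
  by have /natrP[m ->] := Cnat_cfdot_char Nphi Npsi; apply: realn.
rewrite cfdot_char_sum // (bigD1 i) //= (bigD1 j) 1?eq_sym //= addrA.
apply: (@lt_le_trans _ _ (1 + 1)); first by rewrite ltrDl ltr01.
rewrite -[leLHS]addr0; apply: lerD; last first.
  by apply: sumr_ge0 => k _; rewrite mulr_ge0 ?cfdot_char_irr_ge0.
by apply: lerD; rewrite -[1]mulr1 ler_pM ?ler01 ?cfdot_char_irr_ge1.
Qed.

End CommonConstituents.

(* A family with this pattern of inner products behaves like the exterior powers
   of 1 + V: its members are sums of two consecutive irreducible characters. *)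
Section CharacterChain.
Variables (gT : finGroupType) (G : {group gT}) (n : nat) (th : nat -> 'CF(G)).
Hypothesis th_char : forall s, th s \is a character.
Hypothesis th_norm2 : forall s, '[th s] <= 2%:R.
Hypotheses (th_norm0 : '[th 0] <= 1) (th_normn : '[th n] <= 1).
Hypothesis th_near : forall s, (s < n)%N -> '[th s, th s.+1] != 0.
Hypothesis th_far : forall s r, (s.+1 < r)%N -> (r <= n)%N -> '[th s, th r] = 0.

Lemma character_chain : exists e : nat -> Iirr G,
  [/\ forall s r, (s < n)%N -> (r < n)%N -> e s = e r -> s = r,
      (0 < n)%N -> th 0 = 'chi_(e 0),
      forall s, (s.+1 < n)%N -> th s.+1 = 'chi_(e s) + 'chi_(e s.+1) &
      (0 < n)%N -> th n = 'chi_(e n.-1)].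
Proof.
have ex s : exists i, (s < n)%N ==>
    (i \in irr_constt (th s)) && (i \in irr_constt (th s.+1)).
  have [sn|_] := ltnP s n; last by exists 0.
  by have [] := common_constt (th_char s) (th_char s.+1) (th_near sn) => i; exists i.
pose e s := xchoose (ex s).
have e1 s : (s < n)%N -> e s \in irr_constt (th s).
  by move=> sn; have /implyP/(_ sn)/andP[] := xchooseP (ex s).
have e2 s : (s < n)%N -> e s \in irr_constt (th s.+1).
  by move=> sn; have /implyP/(_ sn)/andP[] := xchooseP (ex s).
(* If e s = e r, this character is common to th s and th (r + 1), which are orthogonal. *)
have lt_e s r : (s < r)%N -> (r < n)%N -> e s != e r.
  move=> sr rn; apply/eqP => esr.
  have := common_constt_neq0 (th_char s) (th_char r.+1) (e1 s (ltn_trans sr rn)).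
  by rewrite esr => /(_ (e2 r rn)); rewrite th_far // eqxx.
(* The norm of th s - chi_i is '[th s] - 2 '[th s, chi_i] + 1, which is at most 0. The case of two
   constituents below is the same computation with norm 2. *)
have one s i : '[th s] <= 1 -> i \in irr_constt (th s) -> th s = 'chi_i.
  move=> le1 ci; apply/eqP; rewrite -subr_eq0 -cfnorm_eq0 eq_le cfnorm_ge0 andbT.
  rewrite cfdotBl !cfdotBr cfdot_irr eqxx cfdot_char_irrC //.
  have := cfdot_char_irr_ge1 (th_char s) ci.
  rewrite opprB addrACA -opprD subr_le0 => ge1.
  by apply: le_trans (lerD le1 (lexx 1)) _; apply: lerD.
exists e; split.
- move=> s r sn rn esr; case: (ltngtP s r) => // [sr|rs].
    by have := lt_e s r sr rn; rewrite esr eqxx.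
  by have := lt_e r s rs sn; rewrite esr eqxx.
- by move=> n0; apply: one => //; apply: e1.
- move=> s sn; have sn' := ltnW sn.
  have c1 := cfdot_char_irr_ge1 (th_char _) (e2 _ sn').
  have c2 := cfdot_char_irr_ge1 (th_char _) (e1 _ sn).
  have d : '['chi_(e s), 'chi_(e s.+1)] = 0.
    by rewrite cfdot_irr (negPf (lt_e _ _ _ sn)).
  have d' : '['chi_(e s.+1), 'chi_(e s)] = 0.
    by rewrite cfdot_irr eq_sym (negPf (lt_e _ _ _ sn)).
  apply/eqP; rewrite -subr_eq0 -cfnorm_eq0 eq_le cfnorm_ge0 andbT.
  rewrite cfdotBl !cfdotBr !cfdotDl !cfdotDr d d' !cfdot_irr !eqxx.
  rewrite !cfdot_char_irrC // addr0 add0r.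
  set x := '[_, _] in c1 *; set y := '[_, _] in c2 *.
  rewrite opprB addrACA -opprD subr_le0.
  apply: le_trans (lerD (th_norm2 s.+1) (lexx (1 + 1))) _.
  by rewrite mulr2n; apply: lerD; apply: lerD.
- move=> n0; apply: one => //; have e2' := e2 n.-1; rewrite prednK // in e2'.
  exact: e2'.
Qed.

End CharacterChain.

(** * Irreducible characters at a long cycle *)

Section LongCycle.
Variables (T : finType) (c : {perm T}).
Hypothesis c_trans : forall x z, exists k, z = (c ^+ k)%g x.

(** No conjugate of a transitive cycle stabilizes a proper nonempty subset. *)
Lemma wedge_long_cycle (S : {set T}) : (0 < #|S| < #|T|)%N -> wedge S c = 0.
Proof.
case/andP => S0 ST; rewrite cfIndE ?subsetT // big1 ?mulr0 // => y _.
apply: cfun0; rewrite stab_conj; apply/negP => Nc.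
have /card_gt0P[x Ux] : (0 < #|y @^-1: S|)%N by rewrite card_preimset //; apply: perm_inj.
have : y @^-1: S == setT.
  rewrite -subTset; apply/subsetP => z _; have [k ->] := c_trans x z.
  have /astabsP/(_ x) : (c ^+ k)%g \in 'N(y @^-1: S | 'P)%g by apply: groupX.
  by rewrite /= /aperm Ux => ->.
move=> /eqP eT; move: ST; rewrite -(card_preimset S (@perm_inj _ y)) eT.
by rewrite cardsT ltnn.
Qed.

Lemma wedge_set0 : wedge set0 c = 1.
Proof.
rewrite cfIndE ?subsetT //.
have e : ('N(set0 : {set T} | 'P)%g : {set {perm T}}) = setT.
  by apply/setP => s; rewrite in_stab !inE; apply/forallP => x; rewrite !inE.
rewrite (eq_bigr (fun=> 1)) => [|y _].
  rewrite sumr_const [X in X%:R^-1](_ : _ = #|[set: {perm T}]|) ?mulVf //.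
    by rewrite pnatr_eq0 -lt0n cardG_gt0.
  by rewrite -[in RHS]e.
rewrite stab_sgnE ?e ?inE // (@restr_perm_eq _ _ _ 1%g) ?odd_perm1 ?perm_on1 //.
  by rewrite e inE.
by move=> x; rewrite inE.
Qed.

(** A permutation commuting with a transitive c is determined by the image of one point. *)
Lemma card_cent_long_cycle (x0 : T) : (#|'C_([set: {perm T}])[c]%g| <= #|T|)%N.
Proof.
rewrite -(card_in_imset (f := fun g : {perm T} => g x0)) ?max_card //.
move=> g h /setIP[_ /cent1P cg] /setIP[_ /cent1P ch] /= egh.
apply/permP => z; have [k ->] := c_trans x0 z.
have cgk : commute g (c ^+ k)%g by apply: commuteX; apply/commute_sym.
have chk : commute h (c ^+ k)%g by apply: commuteX; apply/commute_sym.
by rewrite -!permM -cgk -chk !permM egh.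
Qed.

End LongCycle.

Section LongCycleCharacters.
Variables (n : nat) (c : 'S_n).
Hypothesis n0 : (0 < n)%N.
Hypothesis c_trans : forall x z : 'I_n, exists k, z = (c ^+ k)%g x.

Definition initial (s : nat) : {set 'I_n} := [set i : 'I_n | (i < s)%N].

Lemma card_initial s : (s <= n)%N -> #|initial s| = s.
Proof.
move=> sn; rewrite cardsE cardE /enum_mem size_filter /=.
rewrite -(@count_map _ _ (fun i : 'I_n => i : nat) (fun i => (i < s)%N)) -enumT val_enum_ord.
rewrite -size_filter.
have -> : [seq x <- iota 0 n | (x < s)%N] = iota 0 s.
  by have := filter_iota_ltn 0 sn; rewrite add0n => ->.
by rewrite size_iota.
Qed.

Lemma wedge_characters : exists e : nat -> Iirr [set: 'S_n],
  [/\ forall s r, (s < n)%N -> (r < n)%N -> e s = e r -> s = r,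
      wedge (initial 0) = 'chi_(e 0),
      forall s, (s.+1 < n)%N -> wedge (initial s.+1) = 'chi_(e s) + 'chi_(e s.+1) &
      wedge (initial n) = 'chi_(e n.-1)].
Proof.
have i0 : initial 0 = set0 by apply/setP => i; rewrite !inE ltn0.
have iN : initial n = setT by apply/setP => i; rewrite !inE ltn_ord.
have [||||e [e1 e2 e3 e4]] := @character_chain _ _ n (fun s => wedge (initial s))
  (fun s => wedge_char _) (fun s => wedge_norm2 _).
- by apply: wedge_norm1; rewrite i0 eqxx.
- by apply: wedge_norm1; rewrite iN eqxx orbT.
- move=> s sn; apply: wedge_neq0; last by rewrite !card_initial // ltnW.
  by apply/subsetP => i; rewrite !inE => /ltnW.
- by move=> s r sr rn; apply: wedge_ortho; rewrite !card_initial //; lia.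
by exists e; split=> //; [apply: e2 | apply: e4].
Qed.

Lemma wedge_character_values (e : nat -> Iirr [set: 'S_n]) :
  wedge (initial 0) = 'chi_(e 0) ->
  (forall s, (s.+1 < n)%N -> wedge (initial s.+1) = 'chi_(e s) + 'chi_(e s.+1)) ->
  forall s, (s < n)%N -> 'chi_(e s) c = (-1) ^+ s.
Proof.
move=> e0 eS; elim=> [|s IH] sn.
  rewrite -e0 expr0; have -> : initial 0 = set0 by apply/setP => i; rewrite !inE ltn0.
  exact: wedge_set0.
have := congr1 (fun f : 'CF(_) => f c) (eS s sn); rewrite wedge_long_cycle //; last first.
  by rewrite card_initial ?card_ord //; exact: ltnW.
by rewrite cfunE IH ?(ltnW sn) // exprS mulN1r => /esym/eqP; rewrite addrC addr_eq0 => /eqP.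
Qed.

Lemma long_cycle_other (e : nat -> Iirr [set: 'S_n]) :
  (forall s r, (s < n)%N -> (r < n)%N -> e s = e r -> s = r) ->
  (forall s, (s < n)%N -> 'chi_(e s) c = (-1) ^+ s) ->
  forall i, 'chi_i c != 0 -> exists2 s, (s < n)%N & i = e s.
Proof.
move=> e_inj e_val i ci.
pose E := [set e (s : 'I_n) | s in 'I_n].
have [/imsetP[s _ ->]|nEi] := boolP (i \in E); first by exists s.
have x0 : 'I_n by exists 0%N.
have := second_orthogonality_relation c (in_setT c); rewrite class_refl mulr1n => sumC.
have: #|'C_([set: 'S_n])[c]%g|%:R <= n%:R :> algC.
  rewrite ler_nat; have := card_cent_long_cycle c_trans x0; rewrite card_ord.
  by apply: leq_trans; rewrite eq_leq.
rewrite -sumC => {sumC}.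
rewrite (bigID (mem E)) /= big_imset /=; last first.
  by move=> s r _ _ /e_inj h; apply/val_inj/h.
rewrite (eq_bigr (fun=> 1)) => [|s _]; last first.
  by rewrite e_val // rmorphXn rmorphN rmorph1 -exprMn mulrNN mulr1 expr1n.
rewrite sumr_const card_ord gerDl => le0.
have : 0 < \sum_(j | j \notin E) 'chi_j c * ('chi_j c)^* :> algC.
  rewrite (bigD1 i) //=; apply: ltr_wpDr.
    by apply: sumr_ge0 => j _; rewrite mul_conjC_ge0.
  by rewrite mul_conjC_gt0.
by move/lt_le_trans => /(_ _ le0); rewrite ltxx.
Qed.

End LongCycleCharacters.

(** * Hook partitions and the labels of irreducible characters *)

Lemma is_intpart_hook A B : is_intpart (A.+1 :: nseq B 1%N).
Proof.
rewrite /is_intpart inE mem_nseq andbF /= andbT.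
elim: B A => [|B IH] A //=; exact: IH 0%N.
Qed.

(* The hook partition (A | B) in Frobenius notation. *)
Definition hook A B : intpart := IntPart (is_intpart_hook A B).

Lemma psize_hook A B : psize (hook A B) = (A + B).+1.
Proof. by rewrite /psize /= sumn_nseq mul1n. Qed.

Lemma pconj_hook A B : pconj (hook A B) = hook B A.
Proof.
apply/val_inj; rewrite /= /conj_seq /=.
apply: (@eq_from_nth _ 0%N) => [|j]; first by rewrite size_mkseq /= size_nseq.
rewrite size_mkseq => jA; rewrite nth_mkseq //= count_nseq.
case: j jA => [|j] jA /=; first by rewrite mul1n.
by rewrite mul0n addn0 nth_nseq jA -ltnS jA.
Qed.

Lemma head_max (mu : intpart) m : m \in (mu : seq nat) -> (m <= head 0%N mu)%N.
Proof.
case: mu => -[|h s] //= /andP[/= hs _]; rewrite inE => /predU1P[->//|ms].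
have geq_trans : transitive geq by move=> a b c /= ba ac; apply: leq_trans ac ba.
have := order_path_min geq_trans hs.
by move/allP/(_ m ms).
Qed.

Lemma sumn_pconj (mu : intpart) : sumn (pconj mu) = psize mu.
Proof.
rewrite /psize !sumnE /= big_map.
under eq_bigr do rewrite -sumn_count sumnE big_map.
rewrite exchange_big /=; apply: eq_big_seq => m mmu.
have := filter_iota_ltn 0 (head_max mmu); rewrite add0n => e.
by rewrite -[RHS](size_iota 0) -e size_filter -sumn_count sumnE big_map.
Qed.

Lemma reshape_index_nseq1 B i : (i < B)%N -> reshape_index (nseq B 1%N) i = i.
Proof.
rewrite /reshape_index; elim: B i => //= B IH i iB; rewrite subn1 /=.
by case: i iB => //= i iB; rewrite IH.
Qed.

Lemma reshape_index_hook A B i : (i < (A + B).+1)%N ->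
  reshape_index (hook A B) i = (i - A)%N.
Proof.
move=> iAB; rewrite /= /reshape_index /= subSS subn_eq0.
have [iA|Ai] := leqP i A; first by apply/esym/eqP.
rewrite -(@prednK (i - A)) ?subn_gt0 //; congr S.
by apply: reshape_index_nseq1; lia.
Qed.

(** Parts being positive, |mu| is at least mu_1 + l(mu) - 1, with equality only if all parts after
    the first are 1. *)
Lemma hook_of_sumn (mu : intpart) : (0 < psize mu)%N ->
  (psize mu < head 0%N mu + size mu)%N -> mu = hook (head 0%N mu).-1 (size mu).-1.
Proof.
move=> mu0 le; apply/val_inj; case: mu mu0 le => -[|m s] //= i_mu; have /andP[_] := i_mu.
rewrite inE negb_or eq_sym -lt0n => /andP[m0 s0] _; rewrite /psize /= prednK //.
rewrite addnS ltnS leq_add2l => le; congr cons.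
elim: s {i_mu} s0 le => //= k s IH; rewrite inE negb_or eq_sym -lt0n => /andP[k0 s0] le.
have ss : (size s <= sumn s)%N.
  by elim: s s0 {IH le} => //= h s IH; rewrite inE negb_or eq_sym -lt0n => /andP[h0 /IH]; lia.
by rewrite -IH //; [congr cons; lia | lia].
Qed.

Lemma size_pconj (mu : intpart) : size (pconj mu) = head 0%N mu.
Proof. by rewrite size_mkseq. Qed.

Section Label.
Variable mu : intpart.
Local Notation n := (psize mu).

Lemma sgn_charE s : sgn_char n s = (-1) ^+ odd_perm s.
Proof. by rewrite cfunE. Qed.

Lemma sgn_char_lin : sgn_char n \is a linear_char.
Proof.
have sM : {in [set: 'S_n] &, {morph (@odd_perm 'I_n) : x y / (x * y)%g >-> x (+) y}}.
  by move=> x y _ _; apply: odd_permM.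
suff -> : sgn_char n = sign_cfun sM by apply: sign_cfun_lin.
by apply/cfunP => s; rewrite sgn_charE sign_cfunE ?inE.
Qed.

Local Notation one_Ind := ('Ind[[set: 'S_n], young n mu] 1).
Local Notation sgn_Ind :=
  ('Ind[[set: 'S_n], young n (pconj mu)] ('Res[young n (pconj mu)] (sgn_char n))).

Lemma in_young nu (s : 'S_n) :
  (s \in young n nu) = [forall i : 'I_n, reshape_index nu (s i) == reshape_index nu i].
Proof. by rewrite inE. Qed.

Lemma young_sgnE nu : {in young n nu, forall s : 'S_n,
  ('Res[young n nu] (sgn_char n)) s = (-1) ^+ odd_perm s}.
Proof. by move=> s Ys; rewrite cfResE ?subsetT // sgn_charE. Qed.

Lemma young_sgn_lin nu : 'Res[young n nu] (sgn_char n) \is a linear_char.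
Proof. by apply: cfRes_lin_char; apply: sgn_char_lin. Qed.

Lemma one_Ind_char : one_Ind \is a character.
Proof. by apply/cfInd_char/lin_charW/cfun1_lin_char. Qed.

Lemma sgn_Ind_char : sgn_Ind \is a character.
Proof. by apply/cfInd_char/lin_charW/young_sgn_lin. Qed.

Lemma card_young_injective nu (U : {set 'I_n}) : sumn nu = n ->
  {in U &, injective (fun i : 'I_n => reshape_index nu i)} -> (#|U| <= size nu)%N.
Proof.
move=> snu inj.
have lt (i : 'I_n) : (reshape_index nu i < size nu)%N.
  by apply: reshape_indexP; rewrite snu ltn_ord.
pose f i := Ordinal (lt i).
rewrite -(@card_in_imset _ _ f) => [|i j Ui Uj [/inj]]; last by apply.
by rewrite -[leqRHS]card_ord max_card.
Qed.

Variable e : nat -> Iirr [set: 'S_n].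
Hypothesis n0 : (0 < n)%N.
Hypothesis e_inj : forall s r, (s < n)%N -> (r < n)%N -> e s = e r -> s = r.
Hypothesis e0 : wedge (initial n 0) = 'chi_(e 0).
Hypothesis eS : forall s, (s.+1 < n)%N -> wedge (initial n s.+1) = 'chi_(e s) + 'chi_(e s.+1).
Hypothesis en : wedge (initial n n) = 'chi_(e n.-1).

Lemma constt_wedge s : (s < n)%N -> e s \in irr_constt (wedge (initial n s)).
Proof.
case: s => [|s] sn; first by rewrite e0 irr_consttE cfdot_irr eqxx oner_eq0.
rewrite eS // irr_consttE cfdotDl !cfdot_irr eqxx.
case: (e s =P e s.+1) => [/e_inj|_].
  by move=> /(_ (ltnW sn) sn) /eqP; rewrite ltn_eqF.
by rewrite add0r oner_eq0.
Qed.

Lemma constt_wedgeS s : (s < n)%N -> e s \in irr_constt (wedge (initial n s.+1)).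
Proof.
rewrite leq_eqVlt => /predU1P[sn|sn].
  have ps : n.-1 = s by rewrite -sn.
  by rewrite sn en ps irr_consttE cfdot_irr eqxx oner_eq0.
rewrite eS // irr_consttE cfdotDl !cfdot_irr eqxx.
case: (e s.+1 =P e s) => [/e_inj|_].
  by move=> /(_ sn (ltnW sn)) /eqP; rewrite gtn_eqF.
by rewrite addr0 oner_eq0.
Qed.

Lemma wedgeS_constt s i : (s < n)%N -> i \in irr_constt (wedge (initial n s.+1)) ->
  i = e s \/ (s.+1 < n)%N /\ i = e s.+1.
Proof.
rewrite leq_eqVlt => /predU1P[sn|sn].
  have ps : n.-1 = s by rewrite -sn.
  rewrite sn en ps irr_consttE cfdot_irr.
  case: (e s =P i) => [->|_]; first by left.
  by rewrite eqxx.
rewrite eS // irr_consttE cfdotDl !cfdot_irr.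
case: (e s =P i) => [->|_]; first by left.
case: (e s.+1 =P i) => [->|_]; first by right.
by rewrite addr0 eqxx.
Qed.

Lemma wedge_constt s i : (s < n)%N -> i \in irr_constt (wedge (initial n s)) ->
  i = e s \/ (0 < s)%N /\ i = e s.-1.
Proof.
case: s => [|s] sn ci.
  move: ci; rewrite e0 irr_consttE cfdot_irr; case: (e 0 =P i) => [->|_]; first by left.
  by rewrite eqxx.
by have [->|[_ ->]] := wedgeS_constt (ltnW sn) ci; [right | left].
Qed.

(** Tested against theta_(s+1), which contains chi_s: it needs s + 1 points in distinct rows. The
    companion bound uses theta_s, which also contains chi_s and needs n - s points in distinct
    columns; the two bounds together add up to n + 1. *)
Lemma one_Ind_constt s : (s < n)%N -> e s \in irr_constt one_Ind -> (s < size mu)%N.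
Proof.
move=> sn ci.
have := common_constt_neq0 one_Ind_char (wedge_char _) ci (constt_wedgeS sn).
case/(Ind_one_wedge (in_young mu)) => U; rewrite card_initial // => <-.
exact: card_young_injective.
Qed.

Lemma sgn_Ind_constt s : (s < n)%N -> e s \in irr_constt sgn_Ind -> (n - s <= head 0%N mu)%N.
Proof.
move=> sn ci.
have := common_constt_neq0 sgn_Ind_char (wedge_char _) ci (constt_wedge sn).
case/(Ind_sgn_wedge (in_young (pconj mu)) (@young_sgnE _) (young_sgn_lin _)) => U.
rewrite card_initial ?(ltnW sn) // => cU inj.
have := card_young_injective (sumn_pconj mu) inj; rewrite size_pconj; apply: leq_trans.
by rewrite cardsCs setCK card_ord cU.
Qed.

End Label.

Lemma val_part1 n : (0 < n)%N -> part1 n = [:: n] :> seq nat.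
Proof.
by move=> n0; rewrite /part1 val_insubd /is_intpart /= inE eq_sym gtn_eqF.
Qed.

Lemma cycle_type_long m n (c : 'S_m) : perm_eq (cycle_type c) [:: n] ->
  m = n /\ forall x z : 'I_m, exists k, z = (c ^+ k)%g x.
Proof.
rewrite /cycle_type => pe.
have : size (enum (porbits c)) = 1%N by have := perm_size pe; rewrite size_map.
case E : (enum (porbits c)) => [|X [|]] // _.
have Ec : porbits c = [set X]%SET.
  by apply/setP => Y; rewrite -mem_enum E !inE.
have eX x : porbit c x = X.
  have : porbit c x \in porbits c by apply/imsetP; exists x.
  by rewrite Ec => /set1P.
have XT : X = [set: 'I_m]%SET.
  by apply/setP => x; rewrite inE -(eX x) porbit_id.
split.
  have := perm_mem pe n; rewrite E XT /= !inE eqxx cardsT card_ord => /eqP //.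
move=> x z; have : z \in porbit c x by rewrite eX XT inE.
by case/porbitP => k ->; exists k.
Qed.

Lemma long_cycle_exists n : (0 < n)%N ->
  exists c : 'S_n, perm_eq (cycle_type c) [:: n].
Proof.
move=> n0; pose c := perm (@ordS_inj n); exists c.
have cX k (x : 'I_n) : ((c ^+ k)%g x : nat) = ((x + k) %% n)%N.
  elim: k => [|k IH]; first by rewrite expg0 perm1 addn0 modn_small.
  by rewrite expgSr permM permE /= IH -addn1 modnDml addn1 addnS.
have eT x : porbit c x = [set: 'I_n]%SET.
  apply/setP => z; rewrite inE; apply/porbitP; exists (n - x + z)%N.
  apply/val_inj; rewrite /= cX addnA subnKC ?(ltnW (ltn_ord x)) //.
  by rewrite modnDl modn_small.
have -> : cycle_type c = [:: n]; last exact: perm_refl.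
rewrite /cycle_type; have -> : porbits c = [set [set: 'I_n]]%SET.
  apply/setP => X; rewrite inE; apply/imsetP/eqP => [[x _ ->]|->]; first exact: eT.
  by exists (Ordinal n0); rewrite ?eT.
by rewrite enum_set1 /= cardsT card_ord.
Qed.

Lemma irr_labelP mu i : irr_label mu = Some i ->
  i \in irr_constt ('Ind[[set: 'S_(psize mu)], young (psize mu) mu] 1) /\
  i \in irr_constt ('Ind[[set: 'S_(psize mu)], young (psize mu) (pconj mu)]
          ('Res[young (psize mu) (pconj mu)] (sgn_char (psize mu)))).
Proof. by rewrite /irr_label; case: pickP => // j /andP[j1 j2] [<-]. Qed.

(** The bounds s < l(mu) and n - s <= mu_1 apply to whatever constituent [irr_label] picked, and
    together they force a hook. *)
Lemma chi_nonhook mu n : (0 < n)%N -> chi mu (part1 n) != 0 ->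
  exists2 s, (s < n)%N & mu = hook (n.-1 - s) s.
Proof.
move=> n0; rewrite /chi val_part1 //; case L : (irr_label mu) => [i|]; last by rewrite eqxx.
case: pickP => [c cn|]; last by rewrite eqxx.
have [en c_trans] := cycle_type_long cn; move=> chi0.
have m0 : (0 < psize mu)%N by rewrite en.
have [e [e1 e2 e3 e4]] := wedge_characters m0.
have ev := wedge_character_values c_trans e2 e3.
have ci : 'chi_i c != 0 by apply: contraNneq chi0 => ->; rewrite floor0.
have [s sn ei] := long_cycle_other m0 c_trans e1 ev ci.
have [] := irr_labelP L; rewrite ei => l1 l2.
have b1 := one_Ind_constt e1 e3 e4 sn l1.
have b2 := sgn_Ind_constt e1 e2 e3 sn l2.
have lt : (psize mu < head 0%N mu + size mu)%N by lia.
have hm := hook_of_sumn m0 lt.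
have := congr1 psize hm; rewrite psize_hook => eq_mu.
exists (size mu).-1; first by rewrite -en; lia.
by rewrite {1}hm; congr hook; lia.
Qed.

Lemma chi_hook A B : chi (hook A B) (part1 (A + B).+1) = (-1) ^+ B.
Proof.
set mu := hook A B; have em : psize mu = (A + B).+1 := psize_hook A B.
have m0 : (0 < psize mu)%N by rewrite em.
rewrite /chi val_part1 //.
have [c0 pc0] := long_cycle_exists m0.
have [e [e1 e2 e3 e4]] := wedge_characters m0.
have Bm : (B < psize mu)%N by rewrite em ltnS leq_addl.
pose f := 'Ind[[set: 'S_(psize mu)], young (psize mu) mu] 1.
pose g := 'Ind[[set: 'S_(psize mu)], young (psize mu) (pconj mu)]
          ('Res[young (psize mu) (pconj mu)] (sgn_char (psize mu))).
have lt_em (x : 'I_(psize mu)) : (x < (A + B).+1)%N by rewrite -em ltn_ord.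
have lt_em' (x : 'I_(psize mu)) : (x < (B + A).+1)%N by rewrite addnC -em ltn_ord.
(* The last B + 1 points lie in distinct blocks, so [f] shares a constituent with theta_(B+1), which
   is chi_B or chi_(B+1); the latter would require more than B + 1 parts. *)
have in1 : e B \in irr_constt f.
  have injb : {in perm (@rev_ord_inj (psize mu)) @^-1: initial (psize mu) B.+1 &,
      injective (fun x : 'I_(psize mu) => reshape_index mu x)}%SET.
    move=> x z; rewrite !inE !permE /= => hx hz.
    rewrite !reshape_index_hook // => exz; apply/val_inj => /=.
    by move: em hx hz (lt_em x) (lt_em z) exz; clear; lia.
  have := Ind_one_wedge_neq0 (@in_young mu mu) injb => /common_constt.
  case=> [||i /andP[i1 i2]]; [exact: one_Ind_char | exact: wedge_char |].
  have [<- //|[Bn ei]] := wedgeS_constt e3 e4 Bm i2.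
  by rewrite ei in i1; have := one_Ind_constt e1 e3 e4 Bn i1; rewrite /= size_nseq ltnn.
(* The points from B on lie in distinct blocks of the conjugate hook, so [g] meets theta_B;
   chi_(B-1) is excluded because it would require a first part of at least A + 2. *)
have in2 : e B \in irr_constt g.
  have injb : {in ~: initial (psize mu) B &,
      injective (fun x : 'I_(psize mu) => reshape_index (pconj mu) x)}%SET.
    move=> x z; rewrite !inE -!leqNgt => hx hz.
    rewrite (pconj_hook A B : pconj mu = _) !reshape_index_hook // => exz; apply/val_inj => /=.
    by move: hx hz exz; lia.
  have := Ind_sgn_wedge_neq0 (@in_young mu (pconj mu)) (@young_sgnE mu _) (young_sgn_lin _ _) injb.
  move/common_constt.
  case=> [||i /andP[i1 i2]]; [exact: sgn_Ind_char | exact: wedge_char |].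
  have [<- //|[B0 ei]] := wedge_constt e2 e3 e4 Bm i2.
  have Bm' : (B.-1 < psize mu)%N by apply: leq_ltn_trans Bm; apply: leq_pred.
  rewrite ei in i1; have le := sgn_Ind_constt e1 e2 e3 Bm' i1.
  have hd : head 0%N mu = A.+1 by [].
  by exfalso; move: le B0 em; rewrite hd; clear; lia.
have uniq i : i \in irr_constt f -> i \in irr_constt g -> i = e B.
  move=> fi gi; apply: (common_constt_uniq (one_Ind_char mu) (sgn_Ind_char mu)) => //.
  pose IA := [set x : 'I_(psize mu) | (x < A.+1)%N]%SET.
  pose IB := [set x : 'I_(psize mu) | (x < B.+1)%N]%SET.
  (* Block indices are the truncated differences x - D: the first D + 1 points form one block and
     the others are singletons, so the Young subgroup is a full symmetric group. *)
  have inY (nu : intpart) D E : (D + E)%N = (A + B)%N -> nu = hook D E ->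
      forall s, (s \in young (psize mu) nu) =
                perm_on [set x : 'I_(psize mu) | (x < D.+1)%N]%SET s.
    move=> DE -> s; rewrite in_young; apply/forallP/subsetP => [hs x|hs x].
      rewrite !inE; apply: contraR; rewrite -leqNgt => Dx.
      have := eqP (hs x); rewrite !reshape_index_hook ?DE // => exs.
      have aux (p q : nat) : (p - D = q - D)%N -> (D < q)%N -> p = q by lia.
      by apply/eqP/val_inj/(aux _ _ exs Dx).
    have [->//|sx] := eqVneq (s x) x.
    have hx : (x < D.+1)%N by have := hs x; rewrite !inE; apply.
    have hsx : (s x < D.+1)%N.
      by have := hs (s x); rewrite !inE (inj_eq perm_inj); apply.
    have aux (p : nat) : (p < D.+1)%N -> (p - D = 0)%N by lia.
    by rewrite !reshape_index_hook ?DE // !aux.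
  apply: (@hook_multiplicity _ IA IB).
  - exact: inY.
  - by apply: (inY _ B A); [apply: addnC | apply: pconj_hook].
  - by rewrite !card_initial ?card_ord em // ?ltnS ?leq_addr ?leq_addl //; lia.
  - exact: young_sgnE.
  - exact: young_sgn_lin.
case L : (irr_label mu) => [i|]; last first.
  by move: L; rewrite /irr_label; case: pickP => // /(_ (e B)); rewrite in1 in2.
case: pickP => [c cn|/(_ c0)]; last by rewrite -em pc0.
have [en c_trans] := cycle_type_long cn.
have [/uniq h /h ->] := irr_labelP L.
rewrite (wedge_character_values c_trans e2 e3 Bm).
have -> : (-1) ^+ B = ((-1) ^+ B : int)%:~R :> algC by rewrite rmorphXn rmorphN rmorph1.
exact: intrKfloor.
Qed.

Lemma chi_empty : chi part0 part0 = 1.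
Proof.
set mu := part0.
have s1 (s : 'S_(psize mu)) : s = 1%g by apply/permP => -[].
pose f := 'Ind[[set: 'S_(psize mu)], young (psize mu) mu] 1.
pose g := 'Ind[[set: 'S_(psize mu)], young (psize mu) (pconj mu)]
          ('Res[young (psize mu) (pconj mu)] (sgn_char (psize mu))).
have : '[f, g] != 0.
  apply: (@cfdot_Ind_lin_neq0 _ _ _ _ _ _ _ _ _ _ 1%g);
    rewrite ?subsetT ?cfun1_lin_char ?young_sgn_lin ?inE //.
  apply/intertwinedP => h _ _.
  by rewrite (s1 h) conj1g cfun11 lin_char1 ?young_sgn_lin.
case/(common_constt (one_Ind_char mu) (sgn_Ind_char mu)) => i /andP[fi gi].
rewrite /chi; case L : (irr_label mu) => [j|]; last first.
  by move: L; rewrite /irr_label; case: pickP => // /(_ i); rewrite fi gi.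
case: pickP => [s _|/(_ 1%g)]; last first.
  rewrite /cycle_type; have -> : porbits (1%g : 'S_(psize mu)) = set0.
    by apply/setP => X; rewrite inE; apply/imsetP => -[[]].
  by rewrite enum_set0.
have ab : abelian [set: 'S_(psize mu)].
  by apply/centsP => s' _ s'' _; rewrite (s1 s') (s1 s'').
have /char_abelianP/(_ j) lj := ab.
by rewrite (s1 s) lin_char1 // floor1.
Qed.

(** * The dual Cauchy identity *)

Section Laplace.
Variables (F : fieldType) (N M : nat).
Implicit Types (A : 'M[F]_(N + M)) (S : {set 'I_(N + M)}).

(** Its determinant is the term of index [S] in the Laplace expansion along the first [N] rows. *)
Definition mask_mx A S := \matrix_(i, k) if (i < N)%N == (k \in S) then A i k else 0.

Lemma card_lshift_pred : #|[set i : 'I_(N + M) | (i < N)%N]| = N.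
Proof.
rewrite -[RHS]card_ord -(card_imset _ (@lshift_inj N M)).
apply: eq_card => k; rewrite inE; apply/idP/imsetP => [kN|[i _ ->]]; last first.
  by rewrite /= ltn_ord.
by exists (Ordinal kN) => //; apply/val_inj.
Qed.

(** Each permutation survives in exactly one mask, the one given by the image of the first [N]
    indices. *)
Lemma det_mask A : \det A = \sum_(S : {set 'I_(N + M)} | #|S| == N) \det (mask_mx A S).
Proof.
rewrite exchange_big /=; apply: eq_bigr => s _.
pose S0 := s @: [set i : 'I_(N + M) | (i < N)%N].
have inS0 i : (s i \in S0) = (i < N)%N.
  by rewrite mem_imset ?inE //; apply: perm_inj.
rewrite (bigD1 S0) /=; last by rewrite card_imset ?card_lshift_pred //; apply: perm_inj.
rewrite [X in _ + X]big1 ?addr0 => [|S /andP[_ neS]].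
  by congr (_ * _); apply: eq_bigr => i _; rewrite mxE inS0 eqxx.
have /existsP[i ni] : [exists i : 'I_(N + M), (i < N)%N != (s i \in S)].
  apply: contraR neS => /existsPn h; apply/eqP/setP => k.
  by rewrite -(permKV s k) inS0 -(eqP (negbNE (h _))).
by rewrite (bigD1 i) //= mxE (negPf ni) mul0r mulr0.
Qed.

Lemma det_mask_block A S (w : 'S_(N + M)) :
  (forall k, (w k \in S) = (k < N)%N) ->
  \det (mask_mx A S) = (-1) ^+ w *
    (\det (\matrix_(i < N, j < N) A (lshift M i) (w (lshift M j))) *
     \det (\matrix_(i < M, j < M) A (rshift N i) (w (rshift N j)))).
Proof.
move=> wS; rewrite -(det_lblock _ 0).
have -> : \det (mask_mx A S) = (-1) ^+ w * \det (col_perm w (mask_mx A S)).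
  by rewrite col_permE det_mulmx det_perm odd_permV mulrCA -signr_addb addbb mulr1.
congr (_ * \det _); apply/matrixP => i k; rewrite !mxE wS.
case: splitP => [i' ei|i' ei]; rewrite mxE; case: splitP => [k' ek|k' ek].
- by rewrite !mxE eqxx; congr (A _ (w _)); apply/val_inj.
- by rewrite [RHS]mxE.
- by rewrite [RHS]mxE.
- by rewrite !mxE eqxx; congr (A _ (w _)); apply/val_inj.
Qed.

End Laplace.

(** * Partitions in a box as subsets and Grassmannian permutations *)

Section ShiftedPerm.
Variables N M : nat.
Implicit Types f g : nat -> nat.

(* [f] and [g] are the functions [i |-> nu_i] and [j |-> nu^t_j]. *)
Definition conjugate f g := forall i j, (j < f i)%N = (i < g j)%N.

Definition in_box f g := (forall i, (f i <= M)%N) /\ (forall j, (g j <= N)%N).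

(** The classical fact that the numbers nu_i + N - 1 - i and N + j - nu^t_j together run through 0,
    ..., N + M - 1 once; both lists are in increasing order, which makes the permutation
    Grassmannian. *)
Definition shift_val f g (k : 'I_(N + M)) : nat :=
  match fintype.split k with
  | inl i => (f (N.-1 - i) + i)%N
  | inr j => (N + j - g j)%N
  end.

Lemma shift_val_lt f g : in_box f g -> forall k, (shift_val f g k < N + M)%N.
Proof.
case=> fM gN k; rewrite /shift_val; case: splitP => i _.
  by have := fM (N.-1 - i)%N; have := ltn_ord i; lia.
by have := ltn_ord i; lia.
Qed.

Lemma conjugate_antitone f g : conjugate f g -> forall i i', (i <= i')%N -> (f i' <= f i)%N.
Proof.
move=> fg i i' ii'; rewrite leqNgt; apply/negP => lt.
have : (i' < g (f i))%N by rewrite -fg.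
by move/(leq_ltn_trans ii'); rewrite -fg ltnn.
Qed.

Lemma conjugate_sym f g : conjugate f g -> conjugate g f.
Proof. by move=> fg i j; rewrite fg. Qed.

(** The sum is at least i + j + 2 if (i, j) is a box of the diagram and at most i + j otherwise;
    this keeps the two lists of shifted values disjoint. *)
Lemma conjugate_cross f g i j : conjugate f g -> (f i + g j != i + j + 1)%N.
Proof.
move=> fg; apply/eqP => e; have := fg i j.
by case: (ltnP j (f i)) => h1; case: (ltnP i (g j)) => h2 // _; lia.
Qed.

Lemma shift_val_inj f g : conjugate f g -> in_box f g -> injective (shift_val f g).
Proof.
move=> fg [fM gN] k k'; rewrite /shift_val.
case: splitP => i ei; case: splitP => i' ei' e; apply/val_inj => /=.
- rewrite ei ei'; have := ltn_ord i; have := ltn_ord i'.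
  case: (ltngtP i i') => lt iN i'N //.
    by have : (f (N.-1 - i) <= f (N.-1 - i'))%N;
      [apply: (conjugate_antitone fg); lia | lia].
  by have : (f (N.-1 - i') <= f (N.-1 - i))%N;
    [apply: (conjugate_antitone fg); lia | lia].
- have := conjugate_cross (N.-1 - i) i' fg; have := ltn_ord i; have := gN i'.
  by move=> h1 h2 /eqP; lia.
- have := conjugate_cross (N.-1 - i') i fg; have := ltn_ord i'; have := gN i.
  by move=> h1 h2 /eqP; lia.
- rewrite ei ei'; case: (ltngtP i i') => // lt; have := gN i; have := gN i'.
    by have := conjugate_antitone (conjugate_sym fg) (ltnW lt); lia.
  by have := conjugate_antitone (conjugate_sym fg) (ltnW lt); lia.
by rewrite lt.
Qed.

Definition shift_ord f g (box : in_box f g) k := Ordinal (shift_val_lt box k).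

Lemma shift_ord_inj f g (box : in_box f g) : conjugate f g -> injective (shift_ord box).
Proof. by move=> fg k k' [/(shift_val_inj fg box)]. Qed.

Definition shift_perm f g (box : in_box f g) (fg : conjugate f g) : 'S_(N + M) :=
  perm (@shift_ord_inj f g box fg).

Lemma shift_permE f g box fg k : @shift_perm f g box fg k = shift_val f g k :> nat.
Proof. by rewrite permE. Qed.

(* Removing a corner of the diagram multiplies the permutation by a transposition. *)
Lemma odd_shift_perm (R : pzRingType) f g box fg :
  (-1) ^+ @shift_perm f g box fg = (-1) ^+ (\sum_(i < N) f i)%N :> R.
Proof.
move: {-2}(\sum_(i < N) f i)%N (erefl (\sum_(i < N) f i)%N) => m.
elim: m f g box fg => [|m IH] f g box fg sf.
  have f0 i : f i = 0%N.
    have [iN|Ni] := ltnP i N.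
      have := sf; rewrite (bigD1 (Ordinal iN)) //= => /eqP.
      by rewrite eq_sym addn_eq0 => /andP[/eqP].
    apply/eqP; rewrite -leqn0 leqNgt fg; have [_ gN] := box.
    by rewrite ltnNge (leq_trans (gN _)).
  have g0 j : g j = 0%N.
    by apply/eqP; rewrite -leqn0 leqNgt -fg f0.
  have -> : shift_perm box fg = 1%g.
    apply/permP => k; apply/val_inj; rewrite perm1 /= shift_permE /shift_val.
    by case: splitP => j ->; rewrite ?f0 ?g0 ?subn0.
  by rewrite odd_perm1.
have [fM gN] := box.
(* The corner removed is (r, c), the last box of the last nonempty row. *)
pose r := (g 0%N).-1.
have g0 : (0 < g 0%N)%N.
  rewrite lt0n; apply/eqP => g0; move: sf; rewrite big1 // => i _.
  by apply/eqP; rewrite -leqn0 leqNgt fg g0.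
have fr0 : (0 < f r)%N by rewrite fg /r prednK.
pose c := (f r).-1.
have rN : (r < N)%N by have := gN 0%N; rewrite /r; lia.
have cM : (c < M)%N by have := fM r; rewrite /c; lia.
have gc : g c = r.+1.
  have lt : (r < g c)%N by rewrite -fg /c prednK.
  have : ~~ (r.+1 < g c)%N.
    rewrite -fg; apply/negP => h.
    have : (0 < f r.+1)%N by apply: leq_ltn_trans h.
    by rewrite fg /r prednK // ltnn.
  by lia.
pose f' i := (f i - (i == r))%N.
pose g' j := (g j - (j == c))%N.
have fg' : conjugate f' g'.
  move=> i j; rewrite /f' /g'; have := fg i j.
  have [->|ir] := eqVneq i r; have [->|jc] := eqVneq j c => /=.
  - by rewrite gc /c; lia.
  - by rewrite subn0 => <-; move: jc; rewrite /c; lia.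
  - by rewrite subn0 => ->; rewrite gc; lia.
  - by rewrite !subn0.
have box' : in_box f' g'.
  by split=> i; apply: leq_trans (leq_subr _ _) _.
have sf' : m = (\sum_(i < N) f' i)%N.
  have sumD (h : nat -> nat) : (\sum_(i < N) h i = h r + \sum_(i < N | i != Ordinal rN) h i)%N.
    by rewrite (bigD1 (Ordinal rN)).
  have -> : (\sum_(i < N) f' i = (f r).-1 + \sum_(i < N | i != Ordinal rN) f i)%N.
    rewrite sumD /f' eqxx subn1; congr (_ + _)%N; apply: eq_bigr => i ni.
    rewrite (_ : (i : nat) == r = false) ?subn0 //.
    by apply: contraNF ni => /eqP ir; apply/eqP/val_inj.
  by move: sf fr0; rewrite sumD; lia.
have pN : (N.-1 - r < N)%N by lia.
(* [p] and [q] are the positions of row r and column c. Their values N + c - r and N + c - r - 1 are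
   exchanged when the corner is removed. *)
pose p : 'I_(N + M) := lshift M (Ordinal pN).
pose q : 'I_(N + M) := rshift N (Ordinal cM).
have vp h h' : shift_val h h' p = (h r + (N.-1 - r))%N.
  by rewrite /shift_val /p; case: splitP => j /= ej; [rewrite -ej; congr (h _ + _)%N | have := ltn_ord j]; lia.
have vq h h' : shift_val h h' q = (N + c - h' c)%N.
  rewrite /shift_val /q; case: splitP => j /= ej; first by have := ltn_ord j; lia.
  by have -> : (j : nat) = c by lia.
have e : shift_perm box fg =
    (shift_perm box' fg' * tperm (shift_perm box fg q) (shift_perm box fg p))%g.
  have eqp : shift_perm box' fg' p = shift_perm box fg q.
    apply/val_inj; rewrite /= !shift_permE vp vq gc /f' eqxx /c; lia.
  have eqq : shift_perm box' fg' q = shift_perm box fg p.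
    apply/val_inj; rewrite /= !shift_permE vp vq /g' eqxx gc; move: fr0; rewrite /c; lia.
  apply/permP => k; rewrite permM.
  have [->|kp] := eqVneq k p; first by rewrite eqp tpermL.
  have [->|kq] := eqVneq k q; first by rewrite eqq tpermR.
  have ek : shift_perm box' fg' k = shift_perm box fg k.
    apply/val_inj; rewrite /= !shift_permE /shift_val; case: splitP => j ej.
      rewrite /f' (_ : _ == r = false) ?subn0 //; apply: contraNF kp => /eqP jr.
      by apply/eqP/val_inj => /=; have := ltn_ord j; lia.
    rewrite /g' (_ : _ == c = false) ?subn0 //; apply: contraNF kq => /eqP jc.
    by apply/eqP/val_inj => /=; lia.
  by rewrite tpermD ?ek // ?(inj_eq perm_inj) 1?eq_sym // -?eqp (inj_eq perm_inj) eq_sym.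
rewrite e odd_permM odd_tperm (inj_eq perm_inj).
have -> : q != p by apply/eqP => /(congr1 val) /=; lia.
by rewrite signr_addb (IH _ _ box' fg' sf') expr1 -exprSr.
Qed.

End ShiftedPerm.

Lemma geq_trans : transitive geq.
Proof. by move=> a b c /= ba ac; apply: leq_trans ac ba. Qed.

Lemma sorted_count (s : seq nat) i j : sorted geq s ->
  (j < nth 0%N s i)%N = (i < count (fun m => j < m)%N s)%N.
Proof.
elim: s i => [|m s IH] i; first by rewrite nth_nil !ltn0.
move=> ms; have ss := path_sorted ms; have := IH _ ss.
have c0 : ~~ (j < m)%N -> count (fun m => j < m)%N s = 0%N.
  rewrite -leqNgt => mj; apply/eqP; rewrite -leqn0 leqNgt -has_count; apply/hasPn => k ks.
  have /allP/(_ k ks) /= km := order_path_min geq_trans ms.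
  by rewrite -leqNgt (leq_trans km).
case: i => [|i] IHs /=; first by case: (ltnP j m) c0 => // mj /(_ isT) ->.
by rewrite IHs; case: (ltnP j m) c0 => // mj /(_ isT) ->.
Qed.

Lemma nth_pconj (nu : intpart) j : nth 0%N (pconj nu) j = count (fun m => j < m)%N nu.
Proof.
have [jh|hj] := ltnP j (head 0%N nu); first by rewrite nth_mkseq.
rewrite nth_default ?size_mkseq //; apply/esym/eqP; rewrite -leqn0 leqNgt -has_count.
by apply/hasPn => k /head_max kh; rewrite -leqNgt (leq_trans kh).
Qed.

Lemma sorted_intpart (nu : intpart) : sorted geq nu.
Proof. by case: nu => s /= /andP[]. Qed.

Lemma conjugate_pconj (nu : intpart) : conjugate (nth 0%N nu) (nth 0%N (pconj nu)).
Proof. by move=> i j; rewrite nth_pconj sorted_count ?sorted_intpart. Qed.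

Lemma size_le_nth (nu : intpart) i : (size nu <= i)%N = (nth 0%N nu i == 0%N).
Proof.
apply/idP/eqP => [|n0]; first exact: nth_default.
rewrite leqNgt; apply/negP => /(mem_nth 0%N); rewrite n0.
by case: nu {n0} => s /= /andP[_ /negPf ->].
Qed.

Lemma intpart_eq (nu nu' : intpart) : (forall i, nth 0%N nu i = nth 0%N nu' i) -> nu = nu'.
Proof.
move=> e; apply/val_inj/(@eq_from_nth _ 0%N) => // /=.
have h i : (size nu <= i)%N = (size nu' <= i)%N by rewrite !size_le_nth e.
by apply/eqP; rewrite eqn_leq h leqnn -h leqnn.
Qed.

Lemma sum_nth_intpart (nu : intpart) N : (size nu <= N)%N ->
  (\sum_(i < N) nth 0 nu i)%N = psize nu.
Proof.
move=> sN; rewrite /psize sumnE (big_nth 0%N) big_mkord.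
rewrite [RHS](big_ord_widen N (fun i => nth 0%N nu i)) // [RHS]big_mkcond /=.
by apply: eq_bigr => i _; case: ltnP => // h; rewrite nth_default.
Qed.

Lemma in_box_intpart N M (nu : intpart) : (size nu <= N)%N -> (head 0%N nu <= M)%N ->
  in_box N M (nth 0%N nu) (nth 0%N (pconj nu)).
Proof.
move=> sN hM; split=> i; last first.
  by rewrite nth_pconj (leq_trans (count_size _ _)).
have [inu|inu] := ltnP i (size nu); last by rewrite nth_default.
by apply: leq_trans (head_max (mem_nth 0%N inu)) hM.
Qed.

Lemma nth_filter_sorted (s : seq nat) i : sorted geq s ->
  nth 0%N [seq m <- s | (0 < m)%N] i = nth 0%N s i.
Proof.
elim: s i => //= m s IH i ms; have ss := path_sorted ms.
case: ltnP => m0; first by case: i => //= i; rewrite IH.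
have s0 : all (fun k => k == 0%N) s.
  apply/allP => k ks; have /allP/(_ k ks) /= := order_path_min geq_trans ms; lia.
have -> : [seq m <- s | (0 < m)%N] = [::].
  rewrite -(filter_pred0 s); apply: eq_in_filter => k /(allP s0)/eqP -> //.
case: i => [|i] /=; first by lia.
have [isz|isz] := ltnP i (size s); last by rewrite nth_default.
by rewrite (eqP (allP s0 _ (mem_nth 0%N isz))).
Qed.

Section SubsetPartition.
Variables N M : nat.
Implicit Types S : {set 'I_(N + M)}.

Definition subset_seq S : seq nat := [seq nat_of_ord s | s <- enum S].

(** Inverse of the shift: the parts are the elements of [S] minus their ranks, read from the
    largest. The filter drops zero parts, and the default of [insubd] can be reached only when #|S|
    differs from [N]. *)
Definition subset_part S : intpart :=
  insubd part0 [seq m <- mkseq (fun i => nth 0%N (subset_seq S) (N.-1 - i) - (N.-1 - i))%N N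
               | (0 < m)%N].

Lemma subset_seq_sorted S : sorted ltn (subset_seq S).
Proof.
apply: (subseq_sorted ltn_trans _ (iota_ltn_sorted 0 (N + M))).
by rewrite -val_enum_ord; apply: map_subseq; rewrite enumT; apply: filter_subseq.
Qed.

Lemma ltn_sorted_gap (s : seq nat) i j : sorted ltn s -> (i <= j)%N -> (j < size s)%N ->
  (nth 0 s i + (j - i) <= nth 0 s j)%N.
Proof.
move=> ss; elim: j => [|j IH]; first by rewrite leqn0 => /eqP -> _; rewrite addn0.
rewrite leq_eqVlt => /predU1P[-> _|ij js]; first by rewrite subnn addn0.
have := IH ij (ltnW js).
have := (sorted_ltn_nth ltn_trans 0%N ss) j j.+1 (ltnW js) js (ltnSn j).
by move=> /= h1 h2; have : (i <= j)%N by []; lia.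
Qed.

Lemma nth_subset_part S i : #|S| = N -> (i < N)%N ->
  nth 0%N (subset_part S) i = (nth 0 (subset_seq S) (N.-1 - i) - (N.-1 - i))%N.
Proof.
move=> cS iN.
have sz : size (subset_seq S) = N by rewrite size_map -cardE.
set s := mkseq (fun i => nth 0%N (subset_seq S) (N.-1 - i) - (N.-1 - i))%N N.
have ss : sorted geq s.
  apply/(sortedP 0%N) => k; rewrite size_mkseq => kN.
  rewrite !nth_mkseq ?(ltnW kN) //=.
  have := @ltn_sorted_gap _ (N.-1 - k.+1) (N.-1 - k) (subset_seq_sorted S).
  by rewrite sz; lia.
rewrite /subset_part insubdK.
  by rewrite nth_filter_sorted // nth_mkseq.
rewrite unfold_in /is_intpart mem_filter ltnn andbT.
by apply: sorted_filter => //; apply: geq_trans.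
Qed.

Lemma size_subset_part S : #|S| = N -> (size (subset_part S) <= N)%N.
Proof.
move=> cS; rewrite /subset_part val_insubd; case: ifP => // _.
by rewrite size_filter (leq_trans (count_size _ _)) ?size_mkseq.
Qed.

Lemma head_subset_part S : #|S| = N -> (head 0%N (subset_part S) <= M)%N.
Proof.
move=> cS; rewrite -nth0; have [N0|N0] := posnP N.
  by rewrite nth_default // (leq_trans (size_subset_part cS)) ?N0.
rewrite nth_subset_part // subn0.
have sz : size (subset_seq S) = N by rewrite size_map -cardE.
have /mapP[k _ ->] : nth 0%N (subset_seq S) N.-1 \in subset_seq S.
  by rewrite mem_nth // sz prednK.
by have := ltn_ord k; lia.
Qed.

Lemma in_subset_part S (box : in_box N M (nth 0%N (subset_part S)) (nth 0%N (pconj (subset_part S)))) :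
  #|S| = N -> forall k, (shift_perm box (@conjugate_pconj _) k \in S) = (k < N)%N.
Proof.
move=> cS; have sz : size (subset_seq S) = N by rewrite size_map -cardE.
set w := shift_perm _ _; suff eS : w @: [set k : 'I_(N + M) | (k < N)%N] = S.
  by move=> k; have := mem_imset [set k : 'I_(N + M) | (k < N)%N] k (@perm_inj _ w); rewrite eS inE.
apply/eqP; rewrite eqEcard card_imset ?card_lshift_pred ?cS ?leqnn ?andbT; last exact: perm_inj.
apply/subsetP => _ /imsetP[k kN ->]; rewrite inE in kN.
have wk : w k = nth 0%N (subset_seq S) k :> nat.
  rewrite shift_permE /shift_val; case: splitP => j kj; last by lia.
  rewrite nth_subset_part //; last by lia.
  have := @ltn_sorted_gap _ 0 j (subset_seq_sorted S) isT; rewrite sz => /(_ (ltn_ord j)) gap.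
  rewrite kj (_ : (N.-1 - (N.-1 - j))%N = j); last by have := ltn_ord j; lia.
  by rewrite subnK //; lia.
have /mapP[k' k'S e] : nth 0%N (subset_seq S) k \in subset_seq S by rewrite mem_nth ?sz.
rewrite mem_enum in k'S; suff -> : w k = k' by [].
by apply/val_inj; rewrite /= wk e.
Qed.

Lemma subset_part_perm (nu : intpart)
    (box : in_box N M (nth 0%N nu) (nth 0%N (pconj nu))) : (size nu <= N)%N ->
  subset_part (shift_perm box (@conjugate_pconj _) @: [set k : 'I_(N + M) | (k < N)%N]) = nu.
Proof.
move=> sN; set w := shift_perm _ _; set S := _ @: _.
have cS : #|S| = N by rewrite card_imset ?card_lshift_pred //; apply: perm_inj.
pose t := mkseq (fun i => nth 0 nu (N.-1 - i) + i)%N N.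
have et : subset_seq S = t.
  apply: (irr_sorted_eq ltn_trans ltnn (subset_seq_sorted S)).
    apply/(sortedP 0%N) => i; rewrite size_mkseq => iN; rewrite !nth_mkseq ?(ltnW iN) //=.
    have : (nth 0 nu (N.-1 - i) <= nth 0 nu (N.-1 - i.+1))%N.
      by apply: (conjugate_antitone (@conjugate_pconj nu)); lia.
    by lia.
  move=> k; apply/mapP/mapP => [[z zS ek]|[i iN ek]].
    move: zS; rewrite mem_enum => /imsetP[u]; rewrite inE => uN ez.
    exists (u : nat); first by rewrite mem_iota.
    rewrite ek ez shift_permE /shift_val; case: splitP => j uj; first by rewrite uj.
    by lia.
  rewrite mem_iota add0n /= in iN; rewrite ek.
  exists (w (lshift M (Ordinal iN))).
    by rewrite mem_enum mem_imset ?inE //; apply: perm_inj.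
  rewrite shift_permE /shift_val; case: splitP => j /= ij; first by rewrite -ij.
  by have := ltn_ord j; lia.
apply: intpart_eq => i; have [iN|Ni] := ltnP i N; last first.
  by rewrite !nth_default // ?(leq_trans sN) // (leq_trans (size_subset_part cS)).
rewrite nth_subset_part // et nth_mkseq; last by lia.
by rewrite addnK (_ : (N.-1 - (N.-1 - i))%N = i) //; lia.
Qed.

(** Listed through the [N]-subsets, so that the Laplace expansion becomes a sum over partitions
    without reindexing. *)
Definition box_parts : seq intpart :=
  [seq subset_part U | U <- enum [set U : {set 'I_(N + M)} | #|U| == N]].

Lemma mem_box_parts nu : (nu \in box_parts) = (size nu <= N)%N && (head 0%N nu <= M)%N.
Proof.
apply/mapP/andP => [[S]|[sN hM]].
  rewrite mem_enum inE => /eqP cS ->.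
  by rewrite size_subset_part // head_subset_part.
pose box := in_box_intpart sN hM.
exists (shift_perm box (@conjugate_pconj _) @: [set k : 'I_(N + M) | (k < N)%N]).
  rewrite mem_enum inE card_imset ?card_lshift_pred //; exact: perm_inj.
by rewrite subset_part_perm.
Qed.

Lemma subset_part_inj S S' : #|S| = N -> #|S'| = N -> subset_part S = subset_part S' -> S = S'.
Proof.
move=> cS cS' e; apply/setP => k.
have box := in_box_intpart (size_subset_part cS) (head_subset_part cS).
have h := in_subset_part box cS; have h' : forall k, 
    (shift_perm box (@conjugate_pconj _) k \in S') = (k < N)%N.
  by move: box h; rewrite e => box h; apply: in_subset_part.
by rewrite -(permKV (shift_perm box (@conjugate_pconj _)) k) h h'.
Qed.

Lemma box_parts_uniq : uniq box_parts.
Proof.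
rewrite map_inj_in_uniq ?enum_uniq // => S S'.
by rewrite !mem_enum !inE => /eqP cS /eqP cS'; apply: subset_part_inj.
Qed.

End SubsetPartition.

Lemma det_scale_rows (F : fieldType) n (d : 'I_n -> F) (A : 'M[F]_n) :
  \det (\matrix_(i, j) (d i * A i j)) = (\prod_i d i) * \det A.
Proof.
have -> : \matrix_(i, j) (d i * A i j) = diag_mx (\row_i d i) *m A.
  by apply/matrixP => i j; rewrite mul_diag_mx !mxE.
by rewrite det_mulmx det_diag; congr (_ * _); apply: eq_bigr => i _; rewrite mxE.
Qed.

Lemma det_scale_cols (F : fieldType) n (d : 'I_n -> F) (A : 'M[F]_n) :
  \det (\matrix_(i, j) (A i j * d j)) = (\prod_i d i) * \det A.
Proof.
rewrite -det_tr -[in RHS]det_tr -det_scale_rows; congr (\det _).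
by apply/matrixP => i j; rewrite !mxE mulrC.
Qed.

Lemma split_lshift m n (i : 'I_m) : fintype.split (lshift n i) = inl i.
Proof. exact: (unsplitK (inl i)). Qed.

Lemma split_rshift m n (j : 'I_n) : fintype.split (rshift m j) = inr j.
Proof. exact: (unsplitK (inr j)). Qed.

Section DualCauchy.
Variables (F : fieldType) (N M : nat) (x y : nat -> F).
Hypothesis y0 : forall j : 'I_M, y j != 0.

Definition vdm n (a : 'I_n -> F) := \det (\matrix_(i < n, j < n) a i ^+ j).

Lemma vdmE n (a : 'I_n -> F) :
  vdm a = \prod_(i < n) \prod_(j < n | (i < j)%N) (a j - a i).
Proof.
transitivity (\det (Vandermonde n (\row_i a i))).
  by rewrite -det_tr; congr (\det _); apply/matrixP => i j; rewrite !mxE.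
rewrite det_Vandermonde; apply: eq_bigr => i _; apply: eq_bigr => j _.
by rewrite !mxE.
Qed.

(** With nodes x_i and -1/y_j the mixed differences are -(1 + x_i y_j)/y_j, so the Vandermonde
    product contains the Cauchy product. *)
Definition cauchy_node (k : 'I_(N + M)) : F :=
  match fintype.split k with inl i => x i | inr j => - (y j)^-1 end.

Lemma vdm_cauchy_node :
  vdm cauchy_node = vdm (fun i : 'I_N => x i) * vdm (fun j : 'I_M => - (y j)^-1) *
                    \prod_(i < N) \prod_(j < M) (- (y j)^-1 - x i).
Proof.
have nl i : cauchy_node (lshift M i) = x i.
  by rewrite /cauchy_node split_lshift.
have nr j : cauchy_node (rshift N j) = - (y j)^-1.
  by rewrite /cauchy_node split_rshift.
rewrite !vdmE big_split_ord /= mulrAC; congr (_ * _).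
  rewrite -big_split; apply: eq_bigr => i _ /=; rewrite big_split_ord /= nl; congr (_ * _).
    by apply: eq_bigr => j _; rewrite nl.
  by apply: eq_big => [j|j _]; [rewrite /= ltn_addr | rewrite nr].
apply: eq_bigr => i _; rewrite big_split_ord /= big1 ?mul1r => [|j]; last first.
  by move/ltn_trans => /(_ _ (ltn_ord j)); rewrite ltnNge leq_addr.
by apply: eq_big => [j|j _]; [rewrite /= ltn_add2l | rewrite !nr].
Qed.

(** The Vandermonde matrix of the nodes with denominators cleared: the row of y_j is multiplied by
    y_j^(N+M-1), so its minors become alternants in y. *)
Definition cauchy_mx : 'M[F]_(N + M) := \matrix_(i, k)
  match fintype.split i with
  | inl i => x i ^+ k
  | inr j => (-1) ^+ k * y j ^+ ((N + M).-1 - k)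
  end.

Lemma det_cauchy_mx : \det cauchy_mx = (\prod_(j < M) y j ^+ (N + M).-1) * vdm cauchy_node.
Proof.
have -> : \prod_(j < M) y j ^+ (N + M).-1 =
    \prod_(i < N + M) match fintype.split i with inl _ => 1 | inr j => y j ^+ (N + M).-1 end.
  rewrite big_split_ord /= [X in _ = X * _]big1 ?mul1r => [|i _]; last by rewrite split_lshift.
  by apply: eq_bigr => j _; rewrite split_rshift.
rewrite /vdm -det_scale_rows; congr (\det _); apply/matrixP => i k; rewrite !mxE /cauchy_node.
case: splitP => j _; first by rewrite mul1r.
rewrite (exprNn (y j)^-1) exprVn mulrCA; congr (_ * _).
have kL : (k <= (N + M).-1)%N by have := ltn_ord k; lia.
by rewrite -[in RHS](subnK kL) exprD mulfK // expf_neq0.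
Qed.

Lemma vdm_rev_y :
  \det (\matrix_(i < M, j < M) y i ^+ (M.-1 - j)) =
  (\prod_(j < M) y j ^+ M.-1) * (\prod_(j < M) (-1) ^+ j) * vdm (fun j : 'I_M => - (y j)^-1).
Proof.
rewrite /vdm -mulrA -det_scale_cols -det_scale_rows; congr (\det _); apply/matrixP => i k.
rewrite !mxE (exprNn (y i)^-1) mulrAC -exprMn mulrNN mulr1 expr1n mul1r exprVn.
have kL : (k <= M.-1)%N by have := ltn_ord k; lia.
by rewrite -[in RHS](subnK kL) exprD mulfK // expf_neq0.
Qed.

(** The sign (-1)^|nu| of the shift permutation cancels the dependence on nu of the signs
    (-1)^(N+j-nu^t_j) in the columns, leaving a common factor. *)
Lemma det_cauchy_mx_sum : \det cauchy_mx =
  (\prod_(j < M) (-1) ^+ (N + j)%N) *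
  \sum_(nu <- box_parts N M)
     \det (\matrix_(i < N, j < N) x i ^+ (nth 0 nu (N.-1 - j) + j)%N) *
     \det (\matrix_(i < M, j < M) y i ^+ (nth 0 (pconj nu) j + (M.-1 - j))%N).
Proof.
rewrite det_mask /box_parts big_map big_enum /= mulr_sumr.
apply: eq_big => [U|U /eqP cU]; first by rewrite inE.
have sN := size_subset_part cU; have hM := head_subset_part cU.
set nu := subset_part U in sN hM *.
have box := in_box_intpart sN hM; have [fM gN] := box.
rewrite (det_mask_block _ (in_subset_part box cU)) odd_shift_perm sum_nth_intpart //.
set w := shift_perm _ _.
set g := nth 0%N (pconj nu) in gN *.
have -> : \det (\matrix_(i < N, j < N) cauchy_mx (lshift M i) (w (lshift M j))) =
          \det (\matrix_(i < N, j < N) x i ^+ (nth 0 nu (N.-1 - j) + j)%N).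
  congr (\det _); apply/matrixP => i j; rewrite !mxE split_lshift shift_permE.
  by rewrite /shift_val split_lshift.
have -> : \det (\matrix_(i < M, j < M) cauchy_mx (rshift N i) (w (rshift N j))) =
          (\prod_(j < M) (-1) ^+ (N + j - g j)%N) *
          \det (\matrix_(i < M, j < M) y i ^+ (g j + (M.-1 - j))%N).
  rewrite -det_scale_cols; congr (\det _); apply/matrixP => i j.
  rewrite !mxE split_rshift shift_permE /shift_val split_rshift [RHS]mulrC -/nu -/g.
  by congr (_ * _ ^+ _); have := gN j; have := ltn_ord j; lia.
have sg : \sum_(j < M) g j = psize nu.
  by rewrite sum_nth_intpart ?size_pconj //; apply: sumn_pconj.
have -> : \prod_(j < M) (-1) ^+ (N + j)%N =
          (\prod_(j < M) (-1) ^+ (N + j - g j)%N) * (-1) ^+ psize nu :> F.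
  rewrite -sg -prodrXr -big_split; apply: eq_bigr => j _ /=.
  by rewrite -exprD subnK // (leq_trans (gN j)) // leq_addr.
by rewrite -/nu; ring.
Qed.

Lemma dual_cauchy_det :
  \sum_(nu <- box_parts N M)
     \det (\matrix_(i < N, j < N) x i ^+ (nth 0 nu (N.-1 - j) + j)%N) *
     \det (\matrix_(i < M, j < M) y i ^+ (nth 0 (pconj nu) j + (M.-1 - j))%N) =
  (\prod_(i < N) \prod_(j < M) (1 + x i * y j)) *
  (\det (\matrix_(i < N, j < N) x i ^+ j) * \det (\matrix_(i < M, j < M) y i ^+ (M.-1 - j))).
Proof.
have K0 : \prod_(j < M) (-1) ^+ (N + j)%N != 0 :> F.
  by apply/prodf_neq0 => j _; rewrite signr_eq0.
apply: (mulfI K0); rewrite -det_cauchy_mx_sum det_cauchy_mx vdm_cauchy_node vdm_rev_y.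
have -> : \prod_(i < N) \prod_(j < M) (- (y j)^-1 - x i) =
    (\prod_(j < M) (- (y j)^-1) ^+ N) * \prod_(i < N) \prod_(j < M) (1 + x i * y j).
  rewrite prodrXl -[X in _ ^+ X]card_ord -prodr_const -big_split /=.
  apply: eq_bigr => i _.
  rewrite -big_split; apply: eq_bigr => j _ /=.
  by rewrite mulrDr mulr1 mulrCA mulNr mulVf // mulrN1.
have -> : \prod_(j < M) (-1) ^+ (N + j)%N =
   (\prod_(j < M) (-1) ^+ N) * \prod_(j < M) (-1) ^+ j :> F.
  by rewrite -big_split; apply: eq_bigr => j _; rewrite exprD.
have sq : (\prod_(j < M) (-1) ^+ j) * (\prod_(j < M) (-1) ^+ j) = 1 :> F.
  by rewrite -big_split big1 // => j _ /=; rewrite -exprMn mulrNN mulr1 expr1n.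
have ym : (\prod_(j < M) y j ^+ (N + M).-1) * (\prod_(j < M) (- (y j)^-1) ^+ N) =
   (\prod_(j < M) (-1) ^+ N) * \prod_(j < M) y j ^+ M.-1 :> F.
  rewrite -!big_split; apply: eq_bigr => j _ /=; rewrite (exprNn (y j)^-1) mulrCA; congr (_ * _).
  have -> : (N + M).-1 = (M.-1 + N)%N by have := ltn_ord j; lia.
  by rewrite exprD exprVn mulfK // expf_neq0.
rewrite -/(vdm (fun i : 'I_N => x i)).
move: ym sq; set A := \prod_(j < M) y j ^+ _; set B := \prod_(j < M) (- (y j)^-1) ^+ _.
set C := \prod_(j < M) (-1) ^+ N; set D := \prod_(j < M) y j ^+ M.-1.
set E := \prod_(j < M) _ ^+ j; set P := \prod_(i < N) _; set V := vdm _; set W := vdm _.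
move=> ym sq; transitivity ((A * B) * (V * W * P)); first by ring.
rewrite ym; transitivity (E * E * (C * D * V * W * P)); last by ring.
by rewrite sq mul1r; ring.
Qed.
End DualCauchy.

Section SchurCauchy.
Variable C : numFieldType.
Implicit Types (x y : nat -> C) (nu : intpart).

Definition rev_sign N : C := (-1) ^+ perm (@rev_ord_inj N).

Lemma rev_sign_neq0 N : rev_sign N != 0.
Proof. by rewrite signr_eq0. Qed.

Lemma det_rev_cols N (A : 'M[C]_N) :
  \det (\matrix_(i, j) A i (rev_ord j)) = rev_sign N * \det A.
Proof.
have -> : \matrix_(i, j) A i (rev_ord j) = col_perm (perm (@rev_ord_inj N)) A.
  by apply/matrixP => i j; rewrite !mxE permE.
by rewrite col_permE det_mulmx det_perm odd_permV mulrC.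
Qed.

Lemma alternant_rev x N (f : nat -> nat) :
  \det (\matrix_(i < N, j < N) x i ^+ (f j + (N.-1 - j))) =
  rev_sign N * \det (\matrix_(i < N, j < N) x i ^+ (f (N.-1 - j)%N + j)).
Proof.
rewrite -det_rev_cols; congr (\det _); apply/matrixP => i j; rewrite !mxE /=.
have jN := ltn_ord j; rewrite (_ : (N.-1 - (N - j.+1))%N = j); last by lia.
by rewrite (_ : (N - j.+1)%N = (N.-1 - j)%N) //; lia.
Qed.

Lemma vandermonde_rev x N :
  \det (\matrix_(i < N, j < N) x i ^+ (N.-1 - j)) = rev_sign N * vdm (fun i : 'I_N => x i).
Proof. exact: (alternant_rev x N (fun=> 0%N)). Qed.

Lemma schur_pol_inc nu N x : (size nu <= N)%N ->
  schur_pol nu N x =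
  \det (\matrix_(i < N, j < N) x i ^+ (nth 0%N nu (N.-1 - j)%N + j)) /
  vdm (fun i : 'I_N => x i).
Proof.
move=> sN; rewrite /schur_pol sN alternant_rev vandermonde_rev -mulf_div.
by rewrite divff ?rev_sign_neq0 // mul1r.
Qed.

Lemma vdm_neq0 x N : {in gtn N &, injective x} -> vdm (fun i : 'I_N => x i) != 0.
Proof.
move=> injx; rewrite vdmE; apply/prodf_neq0 => i _; apply/prodf_neq0 => j ij.
rewrite subr_eq0; apply: contraTneq ij => /injx.
by rewrite !inE !ltn_ord => /(_ isT isT) ->; rewrite ltnn.
Qed.

Lemma schur_pol_pdec nu N y : (head 0%N nu <= N)%N ->
  schur_pol (pconj nu) N y =
  \det (\matrix_(i < N, j < N) y i ^+ (nth 0%N (pconj nu) j + (N.-1 - j))) /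
  \det (\matrix_(i < N, j < N) y i ^+ (N.-1 - j)).
Proof. by move=> hN; rewrite /schur_pol size_pconj hN. Qed.

Lemma poly_eq_nonzero (p q : {poly C}) : (forall c, c != 0 -> p.[c] = q.[c]) -> p = q.
Proof.
move=> pq; apply/eqP; rewrite -subr_eq0; apply/eqP.
pose rs := [seq n.+1%:R : C | n <- iota 0 (size (p - q))].
apply: (@roots_geq_poly_eq0 _ _ rs); last by rewrite size_map size_iota.
  by apply/allP => _ /mapP[n _ ->]; rewrite rootE hornerD hornerN pq ?pnatr_eq0 // subrr.
by rewrite map_inj_uniq ?iota_uniq // => m n /eqP; rewrite eqr_nat => /eqP[].
Qed.

(** The indeterminate marks |nu|: by homogeneity, evaluating it at c amounts to replacing x by c x,
    and c != 0 keeps the Vandermonde of c x nonzero. *)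
Lemma schur_dual_cauchy x y N : {in gtn N &, injective x} -> {in gtn N &, injective y} ->
  (forall j, y j != 0) ->
  \sum_(nu <- box_parts N N) (schur_pol nu N x * schur_pol (pconj nu) N y) *: 'X^(psize nu) =
  \prod_(i < N) \prod_(j < N) (1 + (x i * y j) *: 'X).
Proof.
move=> injx injy y0; apply: poly_eq_nonzero => c c0.
have Vx := vdm_neq0 injx; have Vy := vdm_neq0 injy.
set E := (\sum_(j < N) j)%N.
have scale (f : nat -> nat) :
    \det (\matrix_(i < N, j < N) (c * x i) ^+ (f j + j)) =
    c ^+ (\sum_(j < N) f j + E) * \det (\matrix_(i < N, j < N) x i ^+ (f j + j)).
  rewrite /E -big_split -prodrXr -det_scale_cols; congr (\det _); apply/matrixP => i j.
  by rewrite !mxE exprMn mulrC.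
have := @dual_cauchy_det _ N N (fun i => c * x i) y (fun j => y0 j).
have -> : \det (\matrix_(i < N, j < N) (c * x i) ^+ j) =
    c ^+ E * vdm (fun i : 'I_N => x i).
  by have := scale (fun=> 0%N); rewrite big1_eq add0n => <-.
rewrite vandermonde_rev => H.
rewrite horner_sum horner_prod.
under [RHS]eq_bigr do rewrite horner_prod.
have W0 : c ^+ E * vdm (fun i : 'I_N => x i) * (rev_sign N * vdm (fun i : 'I_N => y i)) != 0.
  by rewrite !mulf_eq0 (negPf Vx) (negPf Vy) (negPf (rev_sign_neq0 N)) expf_eq0 (negPf c0) andbF.
apply: (mulIf W0).
transitivity (\sum_(nu <- box_parts N N)
  \det (\matrix_(i < N, j < N) (c * x i) ^+ (nth 0%N nu (N.-1 - j)%N + j)) *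
  \det (\matrix_(i < N, j < N) y i ^+ (nth 0%N (pconj nu) j + (N.-1 - j)))); last first.
  rewrite H; congr (_ * _); apply: eq_bigr => i _; apply: eq_bigr => j _.
  by rewrite !hornerE; ring.
rewrite mulr_suml; apply: eq_big_seq => nu; rewrite mem_box_parts => /andP[sN hN].
rewrite hornerZ hornerXn (scale (fun j => nth 0%N nu (N.-1 - j)%N)).
have -> : (\sum_(j < N) nth 0%N nu (N.-1 - j)%N = psize nu)%N.
  rewrite -(sum_nth_intpart sN) [RHS](reindex_inj rev_ord_inj) /=.
  by apply: eq_bigr => j _; congr nth; have := ltn_ord j; lia.
rewrite schur_pol_inc // schur_pol_pdec // vandermonde_rev exprD.
have r0 := rev_sign_neq0 N.
by field; rewrite Vx Vy r0.
Qed.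

Definition parts_of (d : nat) : seq intpart := [seq nu <- box_parts d d | psize nu == d].

Lemma size_le_psize nu : (size nu <= psize nu)%N.
Proof.
case: nu => s i_s; have /andP[_] := i_s; rewrite /psize /=; elim: s {i_s} => //= m s IH.
by rewrite inE negb_or eq_sym -lt0n => /andP[m0 /IH]; lia.
Qed.

Lemma head_le_psize nu : (head 0%N nu <= psize nu)%N.
Proof. by case: nu => -[|m s] i_s //; rewrite /psize /= leq_addr. Qed.

Lemma mem_parts_of nu d : (nu \in parts_of d) = (psize nu == d).
Proof.
rewrite mem_filter mem_box_parts; case: eqP => // <-.
by rewrite size_le_psize head_le_psize.
Qed.

Lemma parts_of_uniq d : uniq (parts_of d).
Proof. exact/filter_uniq/box_parts_uniq. Qed.

Lemma coef_sum_box_parts N d (F : intpart -> C) : (d <= N)%N ->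
  (\sum_(nu <- box_parts N N) F nu *: 'X^(psize nu))`_d = \sum_(nu <- parts_of d) F nu.
Proof.
move=> dN; rewrite coef_sum.
transitivity (\sum_(nu <- box_parts N N | psize nu == d) F nu).
  rewrite [RHS]big_mkcond; apply: eq_bigr => nu _; rewrite coefZ coefXn eq_sym.
  by case: eqP; rewrite ?mulr1 ?mulr0.
rewrite -big_filter; apply: perm_big; apply: uniq_perm.
- exact/filter_uniq/box_parts_uniq.
- exact: parts_of_uniq.
move=> nu; rewrite mem_parts_of mem_filter mem_box_parts; case: eqP => //= e.
by rewrite (leq_trans (size_le_psize nu)) ?(leq_trans (head_le_psize nu)) // e.
Qed.

End SchurCauchy.

(** * The Jacobi-Trudi formula *)

Section JacobiTrudi.
Variables (C : numFieldType) (x : nat -> C).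

(* The complete homogeneous symmetric polynomial of degree m in x_0, ..., x_(N-1). *)
Fixpoint hsym (N : nat) : nat -> C :=
  match N with
  | 0%N => fun m => (m == 0%N)%:R
  | N'.+1 => fix h m :=
      match m with 0%N => 1 | m'.+1 => hsym N' m'.+1 + x N' * h m' end
  end.

Lemma hsym0 N : hsym N 0 = 1.
Proof. by case: N. Qed.

Lemma hsymS N m : hsym N.+1 m.+1 = hsym N m.+1 + x N * hsym N.+1 m.
Proof. by []. Qed.

Arguments hsym : simpl never.

Definition eq_trunc D (p q : {poly C}) := forall m, (m < D)%N -> p`_m = q`_m.

Lemma eq_truncM D b p q : eq_trunc D p q -> eq_trunc D (b * p) (b * q).
Proof.
move=> pq m mD; rewrite !coefM; apply: eq_bigr => j _; rewrite pq //.
exact: leq_ltn_trans (leq_subr _ _) mD.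
Qed.

Lemma coef_linearM (c : C) (p : {poly C}) m :
  ((1 - c *: 'X) * p)`_m = p`_m - (if m is m'.+1 then c * p`_m' else 0).
Proof.
rewrite mulrBl mul1r coefB -scalerAl coefZ coefXM.
by case: m => [|m] /=; rewrite ?mulr0.
Qed.

Lemma hsym_generating D N :
  eq_trunc D ((\prod_(l < N) (1 - x l *: 'X)) * \poly_(m < D) hsym N m) 1.
Proof.
elim: N => [|N IH].
  by rewrite big_ord0 mul1r => m mD; rewrite coef_poly mD coef1.
rewrite big_ord_recr /= -mulrA => m mD.
rewrite -IH //; apply: eq_truncM mD => {}m mD.
rewrite coef_linearM !coef_poly mD; case: m mD => [|m] mD; first by rewrite !hsym0 subr0.
by rewrite coef_poly (ltnW mD) hsymS addrK.
Qed.

Definition omit_poly N i : {poly C} := \prod_(l < N | l != i) (1 - x l *: 'X).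

Lemma size_omit_poly N (i : 'I_N) : (size (omit_poly i) <= N)%N.
Proof.
rewrite (leq_trans (size_prod_leq _ _)) //.
have le2 : (\sum_(l < N | l != i) size (1 - x l *: 'X : {poly C})%R <= \sum_(l < N | l != i) 2)%N.
  apply: leq_sum => l _; rewrite (leq_trans (size_polyD _ _)) // geq_max size_poly1 size_polyN.
  by rewrite (leq_trans (size_scale_leq _ _)) ?size_polyX.
move: le2; rewrite sum_nat_const.
have -> : #|[pred l | l != i]| = N.-1.
  by rewrite cardC1 card_ord.
move=> le2; rewrite leq_subLR; apply: leq_ltn_trans le2 _; have := ltn_ord i; lia.
Qed.

(** Multiplying the generating series of the h_m by all factors 1 - x_l X except that of i leaves
    1/(1 - x_i X), whose coefficients are the powers of x_i. *)
Lemma power_hsym N (i : 'I_N) m :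
  x i ^+ m = \sum_(k < N) (omit_poly i)`_(N.-1 - k) *
                          (if (N.-1 - k <= m)%N then hsym N (m - (N.-1 - k)) else 0).
Proof.
pose Y := omit_poly i * \poly_(j < m.+1) hsym N j.
have YE j : (j < m.+1)%N -> Y`_j = x i ^+ j.
  have e : eq_trunc m.+1 ((1 - x i *: 'X) * Y) 1.
    move=> k km; rewrite -(hsym_generating N km) /Y mulrA; congr (nth 0 (polyseq (_ * _)) k).
    by rewrite [RHS](bigD1 i).
  elim: j => [|j IH] jm; have := e _ jm; rewrite coef_linearM coef1 /=.
    by rewrite subr0.
  by rewrite IH ?(ltnW jm) // -exprS => /eqP; rewrite subr_eq0 => /eqP.
rewrite -(YE m (ltnSn m)) coefM [RHS](reindex_inj rev_ord_inj) /=.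
transitivity (\sum_(p < N) (omit_poly i)`_p * (if (p <= m)%N then hsym N (m - p) else 0)); last first.
  apply: eq_bigr => p _; rewrite (_ : (N.-1 - (N - p.+1))%N = p) //.
  by have := ltn_ord p; lia.
pose F p := (omit_poly i)`_p * (if (p <= m)%N then hsym N (m - p) else 0).
transitivity (\sum_(p < N + m.+1) F p).
  rewrite (big_ord_widen (N + m.+1) (fun j => (omit_poly i)`_j * (\poly_(j < m.+1) hsym N j)`_(m - j))) ?leq_addl //.
  rewrite big_mkcond; apply: eq_bigr => p _; rewrite /F ltnS.
  by case: ifP => _; rewrite ?mulr0 // coef_poly ltnS leq_subr.
rewrite big_split_ord /= [X in _ + X]big1 ?addr0 // => p _.
by rewrite /F nth_default ?mul0r // (leq_trans (size_omit_poly i)) // leq_addr.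
Qed.

Definition jt_entry (nu : intpart) N (k j : nat) : C :=
  if (j <= nth 0%N nu j + k)%N then hsym N (nth 0%N nu j + k - j)%N else 0.

(** The first factor does not depend on nu, so by the case of the empty partition it is the
    Vandermonde determinant, which cancels in the Schur quotient. *)
Lemma alternant_hsym (nu : intpart) N :
  \det (\matrix_(i < N, j < N) x i ^+ (nth 0%N nu j + (N.-1 - j))) =
  \det (\matrix_(i < N, k < N) (omit_poly i)`_(N.-1 - k)) *
  \det (\matrix_(k < N, j < N) jt_entry nu N k j).
Proof.
rewrite -det_mulmx; congr (\det _); apply/matrixP => i j; rewrite !mxE power_hsym.
apply: eq_bigr => k _; rewrite !mxE /jt_entry; congr (_ * _).
have -> : (N.-1 - k <= nth 0%N nu j + (N.-1 - j))%N = (j <= nth 0%N nu j + k)%N.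
  by have := ltn_ord k; have := ltn_ord j; lia.
by case: ifP => // h; congr hsym; have := ltn_ord k; have := ltn_ord j; lia.
Qed.

Lemma det_jt_part0 N : \det (\matrix_(k < N, j < N) jt_entry part0 N k j) = 1.
Proof.
rewrite det_trig; last first.
  apply/is_trig_mxP => i j ij; rewrite mxE /jt_entry nth_nil add0n leqNgt ij //.
apply: big1 => i _; rewrite mxE /jt_entry nth_nil add0n leqnn subnn hsym0 //.
Qed.

Lemma schur_pol_jt (nu : intpart) N : (size nu <= N)%N ->
  \det (\matrix_(i < N, j < N) x i ^+ (N.-1 - j)) != 0 ->
  schur_pol nu N x = \det (\matrix_(k < size nu, j < size nu) jt_entry nu N k j).
Proof.
move=> sN V0; rewrite /schur_pol sN alternant_hsym.
have := alternant_hsym part0 N; rewrite det_jt_part0 mulr1.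
have -> : \matrix_(i < N, j < N) x i ^+ (nth 0%N part0 j + (N.-1 - j)) =
          \matrix_(i < N, j < N) x i ^+ (N.-1 - j).
  by apply/matrixP => i j; rewrite !mxE nth_nil add0n.
move=> eV; rewrite -eV mulrC mulKf // => {V0 eV}.
(* Columns past l(nu) belong to zero parts and form a triangular block with diagonal h_0 = 1, so
   only a determinant of size l(nu), independent of [N], remains. *)
rewrite -(subnKC sN); set r := (N - size nu)%N; set l := size nu.
have -> : \matrix_(k < l + r, j < l + r) jt_entry nu (l + r) k j =
   block_mx (\matrix_(k < l, j < l) jt_entry nu (l + r) k j) 0
            (\matrix_(k < r, j < l) jt_entry nu (l + r) (l + k) j)
            (\matrix_(k < r, j < r) jt_entry nu (l + r) (l + k) (l + j)).
  apply/matrixP => k j; rewrite !mxE; case: splitP => k' ->; rewrite mxE; case: splitP => j' ->;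
    rewrite !mxE //.
  rewrite /jt_entry nth_default ?leq_addr // add0n leqNgt.
  by rewrite (leq_trans (ltn_ord k')) ?leq_addr.
rewrite det_lblock [X in _ * X]det_trig ?[X in _ * X]big1 ?mulr1 //.
  by move=> i _; rewrite mxE /jt_entry nth_default ?leq_addr // add0n leqnn subnn hsym0.
apply/is_trig_mxP => i j ij; rewrite mxE /jt_entry nth_default ?leq_addr // add0n leq_add2l.
by rewrite leqNgt ij.
Qed.

End JacobiTrudi.

From mathcomp Require Import all_classical all_reals all_analysis.
Import numFieldNormedType.Exports.
Local Open Scope classical_set_scope.

(** * Schur functions as rational functions of q^(1/2) *)

Section GeometricTail.
Variables (C : numFieldType) (x : nat -> C) (l : nat) (a t : C).
Hypothesis x_tail : forall i, x (l + i)%N = a * t ^+ i.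
Hypothesis t_gen : forall k, 1 - t ^+ k.+1 != 0.

(** The principal specialization h_j(a, a t, ..., a t^(M-1)), that is a^j times the t-binomial
    coefficient of M + j - 1 over j. *)
Definition hgeom M j := a ^+ j * \prod_(k < j) ((1 - t ^+ (M + k)) / (1 - t ^+ k.+1)).

Lemma hgeom0 M : hgeom M 0 = 1.
Proof. by rewrite /hgeom big_ord0 mulr1. Qed.

Lemma hgeomS M j : hgeom M.+1 j.+1 = hgeom M j.+1 + a * t ^+ M * hgeom M.+1 j.
Proof.
rewrite /hgeom !prodf_div [X in _ = a ^+ j.+1 * (X / _) + _]big_ord_recl addn0.
rewrite [X in a ^+ j.+1 * (X / _) = _]big_ord_recr /= !(big_ord_recr j) /=.
have -> : \prod_(i < j) (1 - t ^+ (M + bump 0 i)) = \prod_(i < j) (1 - t ^+ (M.+1 + i)).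
  by apply: eq_bigr => i _; rewrite /bump /= add1n addnS.
set P := \prod_(i < j) _; set D := \prod_(i < j) _.
have D0 : D != 0 by apply/prodf_neq0 => i _; apply: t_gen.
have T0 := t_gen j.
rewrite addSn !exprS exprD; rewrite exprS in T0; field.
by rewrite D0 T0.
Qed.

(** h_m of a union of variables is the convolution over the two parts. Only the geometric part
    grows, which isolates the dependence on [M] in [hgeom]. *)
Lemma hsym_tail M m :
  hsym x (l + M) m = \sum_(j < m.+1) hsym x l (m - j) * hgeom M j.
Proof.
elim: M m => [|M IH] m.
  rewrite addn0 big_ord_recl hgeom0 subn0 mulr1 big1 ?addr0 // => j _.
  by rewrite /hgeom big_ord_recl add0n expr0 subrr mul0r mul0r mulr0 mulr0.
elim: m => [|m IHm].
  by rewrite !hsym0 big_ord1 hsym0 hgeom0 mulr1.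
rewrite addnS hsymS IH -addnS IHm x_tail [in RHS]big_ord_recl hgeom0.
rewrite [X in X + _]big_ord_recl hgeom0 -addrA; congr (_ + _).
rewrite mulr_sumr -big_split; apply: eq_bigr => j _ /=.
rewrite /bump /= add1n subSS hgeomS mulrDr; congr (_ + _).
by rewrite mulrCA.
Qed.

Lemma cvg_hgeom j : (fun n => t ^+ n) @ \oo --> (0 : C) ->
  hgeom M j @[M --> \oo] --> a ^+ j * \prod_(k < j) (1 - t ^+ k.+1)^-1.
Proof.
move=> t0; apply: cvgM; first exact: cvg_cst.
elim: j => [|j IH].
  by under eq_fun do rewrite big_ord0; rewrite big_ord0; apply: cvg_cst.
under eq_fun do rewrite big_ord_recr; rewrite big_ord_recr /=; apply: cvgM => //.
rewrite -[X in _ --> X]mul1r; apply: cvgM; last exact: cvg_cst.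
rewrite -[X in _ --> X]subr0; apply: cvgB; first exact: cvg_cst.
by rewrite (cvg_shiftn j (fun n => t ^+ n)).
Qed.

Lemma cvg_hsym_tail m : (fun n => t ^+ n) @ \oo --> (0 : C) ->
  hsym x N m @[N --> \oo] -->
  \sum_(j < m.+1) hsym x l (m - j) * (a ^+ j * \prod_(k < j) (1 - t ^+ k.+1)^-1).
Proof.
move=> t0; rewrite -(cvg_shiftn l (fun N => hsym x N m)).
under eq_fun do rewrite addnC hsym_tail.
apply: cvg_big => [|j _]; first exact: add_continuous.
apply: cvgM; first exact: cvg_cst.
exact: cvg_hgeom.
Qed.

End GeometricTail.

(** * Rational functions determined by their values outside the unit disc *)

Section Complex.
Variable R : realType.
Local Notation K := R[i].

Lemma cvg_expr_complex (t : (K : numFieldType)) : `|t| < 1 ->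
  (fun n => t ^+ n) @ \oo --> (0 : (K : numFieldType)).
Proof.
move=> t1; pose r := complex.Re `|t|.
have er : `|t| = (r%:C)%C by rewrite RRe_real // normr_real.
have r1 : `|r| < 1.
  by rewrite ger0_norm -?ltcR -?lecR ?rmorph1 -?er ?rmorph0 // normr_ge0.
have /cvgr0Pnorm_lt cr := cvg_expr r1.
apply/cvgr0Pnorm_lt => e e0; have ee : ((complex.Re e)%:C)%C = e by rewrite RRe_real // gtr0_real.
have e0' : 0 < complex.Re e by rewrite -ltcR ee.
have := cr _ e0'; apply: filterS => n.
rewrite -ltcR ee; apply: le_lt_trans; rewrite normrX er -rmorphXn /= lecR.
exact: ler_norm.
Qed.

Lemma tofrac_neq0 (p : {poly K}) : p != 0 -> tofrac p != 0 :> Kq R.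
Proof. by move=> p0; rewrite tofrac_eq0. Qed.

Definition represents (r : Kq R) (f : K -> K) := exists u v : {poly K},
  r = tofrac u / tofrac v /\ forall s : K, 1 < `|s| -> v.[s] != 0 /\ f s = u.[s] / v.[s].

Lemma norm_point n : 1 < `|n.+2%:R : K|.
Proof. by rewrite normr_nat ltr1n. Qed.

Lemma nonvanishing_neq0 (v : {poly K}) : (forall s : K, 1 < `|s| -> v.[s] != 0) -> v != 0.
Proof. by move=> h; apply: contraNneq (h _ (norm_point 0)) => ->; rewrite horner0. Qed.

Lemma poly_eq_outside (p q : {poly K}) :
  (forall s : K, 1 < `|s| -> p.[s] = q.[s]) -> p = q.
Proof.
move=> pq; apply/eqP; rewrite -subr_eq0; apply/eqP.
(* The points 2, 3, ... have norm greater than 1, and enough of them are taken to exceed the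
   degree. *)
pose rs := [seq n.+2%:R : K | n <- iota 0 (size (p - q))].
apply: (@roots_geq_poly_eq0 _ _ rs); last by rewrite size_map size_iota.
  by apply/allP => _ /mapP[n _ ->]; rewrite rootE hornerD hornerN pq ?norm_point // subrr.
by rewrite map_inj_uniq ?iota_uniq // => m n /eqP; rewrite eqr_nat => /eqP[].
Qed.

Lemma represents_uniq r r' f f' : represents r f -> represents r' f' ->
  (forall s, 1 < `|s| -> f s = f' s) -> r = r'.
Proof.
move=> [u [v [-> uv]]] [u' [v' [-> uv']]] ff'.
have v0 : v != 0 by apply: nonvanishing_neq0 => s /uv[].
have v0' : v' != 0 by apply: nonvanishing_neq0 => s /uv'[].
apply/eqP; rewrite eqr_div ?tofrac_neq0 // -!tofracM; apply/eqP; congr tofrac.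
apply: poly_eq_outside => s s1; have [vs fs] := uv s s1; have [vs' fs'] := uv' s s1.
by rewrite !hornerM; apply/eqP; rewrite -eqr_div // -fs -fs' ff'.
Qed.

Lemma represents_ext r f g : (forall s, 1 < `|s| -> f s = g s) ->
  represents r f -> represents r g.
Proof.
move=> fg [u [v [-> uv]]]; exists u, v; split=> // s s1.
by have [vs fs] := uv s s1; rewrite -fg.
Qed.

(** [xget] returns some representative, and [represents_uniq] leaves only one. *)
Lemma ratfunE r f : represents r f -> ratfun f = r.
Proof.
move=> rf; rewrite /ratfun; set P := (X in xget _ X).
have Pr : P r by [].
by have := xgetPex 0 (ex_intro P r Pr) => h; apply: (represents_uniq h rf).
Qed.

Lemma represents_poly p : represents (tofrac p) (fun s => p.[s]).
Proof.
exists p, 1; split=> [|s _]; first by rewrite tofrac1 divr1.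
by rewrite hornerC oner_eq0 divr1.
Qed.

Lemma represents_const c : represents (Kconst c) (fun=> c).
Proof. by apply: (represents_ext _ (represents_poly c%:P)) => s _; rewrite hornerC. Qed.

Lemma represents0 : represents 0 (fun=> 0).
Proof. by apply: (represents_ext _ (represents_poly 0)) => s _; rewrite horner0. Qed.

Lemma represents1 : represents 1 (fun=> 1).
Proof.
by rewrite -tofrac1; apply: (represents_ext _ (represents_poly 1)) => s _; rewrite hornerC.
Qed.

Lemma represents_qhalf : represents (qhalf R) id.
Proof. by apply: (represents_ext _ (represents_poly 'X)) => s _; rewrite hornerX. Qed.

Lemma representsD r r' f f' : represents r f -> represents r' f' ->
  represents (r + r') (fun s => f s + f' s).
Proof.
move=> [u [v [-> uv]]] [u' [v' [-> uv']]].
have v0 : v != 0 by apply: nonvanishing_neq0 => s /uv[].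
have v0' : v' != 0 by apply: nonvanishing_neq0 => s /uv'[].
exists (u * v' + u' * v), (v * v'); split=> [|s s1].
  by rewrite addf_div ?tofrac_neq0 // tofracD !tofracM.
have [vs ->] := uv s s1; have [vs' ->] := uv' s s1.
by rewrite hornerD !hornerM mulf_neq0 // addf_div.
Qed.

Lemma representsM r r' f f' : represents r f -> represents r' f' ->
  represents (r * r') (fun s => f s * f' s).
Proof.
move=> [u [v [-> uv]]] [u' [v' [-> uv']]].
exists (u * u'), (v * v'); split=> [|s s1].
  by rewrite mulf_div !tofracM.
have [vs ->] := uv s s1; have [vs' ->] := uv' s s1.
by rewrite !hornerM mulf_neq0 // mulf_div.
Qed.

Lemma representsV r f : (forall s, 1 < `|s| -> f s != 0) -> represents r f ->
  represents r^-1 (fun s => (f s)^-1).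
Proof.
move=> f0 [u [v [-> uv]]]; exists v, u; split=> [|s s1]; first by rewrite invf_div.
have [vs fs] := uv s s1; rewrite fs invf_div; split=> //.
by have := f0 s s1; rewrite fs mulf_eq0 negb_or => /andP[].
Qed.

Lemma representsN r f : represents r f -> represents (- r) (fun s => - f s).
Proof.
move=> [u [v [-> uv]]]; exists (- u), v; split=> [|s s1]; first by rewrite tofracN mulNr.
by have [vs ->] := uv s s1; rewrite hornerN mulNr.
Qed.

Lemma represents_sum (I : Type) (rs : seq I) (P : pred I) (r : I -> Kq R) (f : I -> K -> K) :
  (forall i, P i -> represents (r i) (f i)) ->
  represents (\sum_(i <- rs | P i) r i) (fun s => \sum_(i <- rs | P i) f i s).
Proof.
move=> rf; elim: rs => [|i rs IH].
  by rewrite big_nil; apply: (represents_ext _ represents0) => s _; rewrite big_nil.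
rewrite big_cons; case: ifP => Pi.
  by apply: (represents_ext _ (representsD (rf i Pi) IH)) => s _; rewrite big_cons Pi.
by apply: (represents_ext _ IH) => s _; rewrite big_cons Pi.
Qed.

Lemma represents_prod (I : Type) (rs : seq I) (P : pred I) (r : I -> Kq R) (f : I -> K -> K) :
  (forall i, P i -> represents (r i) (f i)) ->
  represents (\prod_(i <- rs | P i) r i) (fun s => \prod_(i <- rs | P i) f i s).
Proof.
move=> rf; elim: rs => [|i rs IH].
  by rewrite big_nil; apply: (represents_ext _ represents1) => s _; rewrite big_nil.
rewrite big_cons; case: ifP => Pi.
  by apply: (represents_ext _ (representsM (rf i Pi) IH)) => s _; rewrite big_cons Pi.
by apply: (represents_ext _ IH) => s _; rewrite big_cons Pi.
Qed.

Lemma representsX r f n : represents r f -> represents (r ^+ n) (fun s => f s ^+ n).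
Proof.
move=> rf; elim: n => [|n IH].
  by rewrite expr0; apply: (represents_ext _ represents1) => s _; rewrite expr0.
by rewrite exprS; apply: (represents_ext _ (representsM rf IH)) => s _; rewrite exprS.
Qed.

Lemma outside_neq0 (s : K) : 1 < `|s| -> s != 0.
Proof. by move=> s1; rewrite -normr_gt0 (lt_trans ltr01). Qed.

Lemma represents_qhalf_exp (m : int) : represents (qhalf R ^ m) (fun s => s ^ m).
Proof.
case: m => m; first exact: representsX represents_qhalf.
have := representsX m.+1 represents_qhalf; apply: representsV => s s1.
by rewrite expf_neq0 ?outside_neq0.
Qed.

Lemma expr_outside_neq1 (s : K) k : 1 < `|s| -> s ^+ k.+1 != 1.
Proof.
move=> s1; apply: contraTneq s1 => e.
have : `|s| ^+ k.+1 = 1 by rewrite -normrX e normr1.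
by move/eqP; rewrite pexpr_eq1 // => /eqP ->; rewrite ltxx.
Qed.

End Complex.

Lemma cvg_det (C : numFieldType) n (A : nat -> 'M[C]_n) (B : 'M[C]_n) :
  (forall i j, A N i j @[N --> \oo] --> B i j) -> \det (A N) @[N --> \oo] --> \det B.
Proof.
move=> AB; rewrite /determinant; apply: cvg_big => [|s _]; first exact: add_continuous.
apply: cvgM; first exact: cvg_cst.
by apply: cvg_big => [|i _]; [exact: mul_continuous | exact: AB].
Qed.

Section SchurLimit.
Variable R : realType.
Local Notation K := R[i].
Implicit Types (s : K) (mu nu : intpart).

Lemma exprz_outside_neq1 s (m : int) : 1 < `|s| -> m != 0 -> s ^ m != 1.
Proof.
move=> s1; case: m => [[|m]|m] // _; first exact: expr_outside_neq1.
by rewrite NegzE -exprnN invr_eq1 expr_outside_neq1.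
Qed.

Lemma exprz_outside_inj s : 1 < `|s| -> injective (fun m : int => s ^ m).
Proof.
move=> s1 m n e; apply/eqP; rewrite -subr_eq0; apply/negPn/negP => mn.
have := exprz_outside_neq1 s1 mn.
by rewrite expfzDr ?outside_neq0 // e -expfzDr ?outside_neq0 // subrr expr0z eqxx.
Qed.

Lemma qmurho_inj mu s : 1 < `|s| -> injective (qmurho mu s).
Proof.
move=> s1 i j /(exprz_outside_inj s1) e.
have anti := conjugate_antitone (@conjugate_pconj mu).
have [ij|ji|//] := ltngtP i j.
  by have := anti _ _ (ltnW ij); lia.
by have := anti _ _ (ltnW ji); lia.
Qed.

Lemma qmurho_neq0 mu s j : 1 < `|s| -> qmurho mu s j != 0.
Proof. by move=> s1; rewrite expfz_neq0 ?outside_neq0. Qed.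

Lemma qmurho_tail mu s i : 1 < `|s| ->
  qmurho mu s (size mu + i) = s ^ (- (2 * size mu + 1)%N%:Z) * (s ^ (-2)) ^+ i.
Proof.
move=> s1; rewrite /qmurho nth_default ?leq_addr // [_ ^+ i]exprnP exprz_exp -expfzDr ?outside_neq0 //.
by congr (_ ^ _); lia.
Qed.

Lemma one_minus_expr_neq0 s k : 1 < `|s| -> 1 - (s ^ (-2)) ^+ k.+1 != 0.
Proof.
move=> s1; rewrite subr_eq0 eq_sym exprnP exprz_exp; apply: exprz_outside_neq1 => //.
Qed.

Lemma norm_exprN2_lt1 s : 1 < `|s| -> `|s ^ (-2)| < 1.
Proof.
move=> s1; rewrite -[s ^ (-2)]/((s ^+ 2)^-1) normrV ?unitfE ?expf_neq0 ?outside_neq0 //.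
by rewrite normrX invf_lt1 ?exprn_gt0 ?(lt_trans ltr01) // exprn_egt1.
Qed.

Definition hsym_lim mu m s : K :=
  \sum_(j < m.+1) hsym (qmurho mu s) (size mu) (m - j)%N *
    ((s ^ (- (2 * size mu + 1)%N%:Z)) ^+ j *
     \prod_(k < j) (1 - (s ^ (-2)) ^+ k.+1)^-1).

Definition schur_lim mu nu s : K :=
  \det (\matrix_(k < size nu, j < size nu)
    if (j <= nth 0%N nu j + k)%N then hsym_lim mu (nth 0%N nu j + k - j)%N s else 0).

Lemma cvg_hsym mu m s : 1 < `|s| ->
  (hsym (qmurho mu s) N m : (K : numFieldType)) @[N --> \oo] --> (hsym_lim mu m s : (K : numFieldType)).
Proof.
move=> s1; apply: cvg_hsym_tail => [i|k|].
- exact: qmurho_tail.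
- exact: one_minus_expr_neq0.
- exact/cvg_expr_complex/norm_exprN2_lt1.
Qed.

(** By Jacobi-Trudi the determinant has fixed size l(nu), so the limit is taken entry by entry; the
    shift by [size nu] keeps [N] in the range where [schur_pol] is the quotient of alternants. *)
Lemma cvg_schur_pol mu nu s : 1 < `|s| ->
  (schur_pol nu N (qmurho mu s) : (K : numFieldType)) @[N --> \oo] --> (schur_lim mu nu s : (K : numFieldType)).
Proof.
move=> s1; rewrite -(cvg_shiftn (size nu) (fun N => schur_pol nu N (qmurho mu s) : (K : numFieldType))).
have e N : schur_pol nu (N + size nu) (qmurho mu s) =
    \det (\matrix_(k < size nu, j < size nu) jt_entry (qmurho mu s) nu (N + size nu) k j).
  apply: schur_pol_jt; first exact: leq_addl.
  rewrite vandermonde_rev mulf_neq0 ?rev_sign_neq0 // vdm_neq0 // => i j _ _.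
  exact: qmurho_inj.
under eq_fun do rewrite e.
apply: cvg_det => k j; under eq_fun do rewrite mxE.
rewrite mxE /jt_entry; case: ifP => _; last exact: cvg_cst.
have := @cvg_hsym mu (nth 0%N nu j + k - j)%N s s1.
by rewrite -(cvg_shiftn (size nu)).
Qed.

Lemma schurE mu nu s : 1 < `|s| -> schur nu (qmurho mu s) = schur_lim mu nu s.
Proof.
move=> s1; apply: cvg_lim; first exact: norm_hausdorff.
exact: cvg_schur_pol.
Qed.

Lemma represents_hsym mu N m : exists r, represents r (fun s => hsym (qmurho mu s) N m).
Proof.
elim: N m => [|N IH] m.
  by exists (Kconst (m == 0%N)%:R); apply: represents_const.
elim: m => [|m [r' rh']].
  by exists 1; apply: (represents_ext _ (represents1 R)) => s _; rewrite hsym0.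
have [r rh] := IH m.+1.
have := representsD rh (representsM (represents_qhalf_exp R (2 * (nth 0%N mu N)%:Z - 2 * (N.+1)%:Z + 1)) rh').
by move=> h; eexists; apply: h.
Qed.

Lemma represents_hsym_lim mu m : exists r, represents r (hsym_lim mu m).
Proof.
have [r rh] := choice (fun j => represents_hsym mu (size mu) j).
have rp k : exists r, represents r (fun s : K => (1 - (s ^ (-2)) ^+ k.+1)^-1).
  have := representsD (represents1 R) (representsN (representsX k.+1 (represents_qhalf_exp R (-2)))).
  by move/representsV => h; eexists; apply: h => s s1; apply: one_minus_expr_neq0.
have [r' rh'] := choice rp.
eexists; apply: represents_sum => j _; apply: representsM; first exact: rh.
apply: representsM; first by apply: representsX; apply: represents_qhalf_exp.
by apply: represents_prod => k _; apply: rh'.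
Qed.

Lemma represents_schur mu nu : exists r, represents r (schur_lim mu nu).
Proof.
have [r rh] := choice (represents_hsym_lim mu).
pose re k j := if (j <= nth 0%N nu j + k)%N then r (nth 0%N nu j + k - j)%N else 0.
eexists; rewrite /schur_lim /determinant; apply: represents_sum => p _.
apply: (@representsM _ (Kconst ((-1) ^+ p))); first exact: represents_const.
have h (i : 'I_(size nu)) : represents (re i (p i)) (fun s : K =>
    (\matrix_(k < size nu, j < size nu)
      if (j <= nth 0%N nu j + k)%N then hsym_lim mu (nth 0%N nu j + k - j)%N s else 0) i (p i)).
  rewrite /re; case: ifP => h; [have := rh (nth 0%N nu (p i) + i - p i)%N | have := represents0 R];
    by apply: represents_ext => s _; rewrite mxE h.
exact: represents_prod (fun i _ => h i).
Qed.

Lemma represents_W1 nu : represents (W1 R nu) (schur_lim part0 nu).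
Proof.
have [r rh] := represents_schur part0 nu; rewrite /W1 (@ratfunE _ r) //.
by apply: (represents_ext _ rh) => s s1; rewrite schurE.
Qed.

Lemma represents_W2 mu nu :
  represents (W2 R mu nu) (fun s => schur_lim part0 mu s * schur_lim mu nu s).
Proof.
have [r rh] := represents_schur part0 mu; have [r' rh'] := represents_schur mu nu.
have rr := representsM rh rh'; rewrite /W2 (@ratfunE _ (r * r')) //.
by apply: (represents_ext _ rr) => s s1; rewrite !schurE.
Qed.

End SchurLimit.

(** * The sum over the internal partition *)

(** Both sides are the product of g over the integers from b - N to b + m - 1, cut at different
    places. *)
Lemma prod_telescope (A : comPzRingType) (g : int -> A) (b : int) (m N : nat) :
  \prod_(j < N) g (m%:Z + b - 1 - j%:Z) * \prod_(k < m) g (b - N%:Z + k%:Z) =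
  \prod_(k < m) g (b + k%:Z) * \prod_(j < N) g (b - 1 - j%:Z).
Proof.
elim: m => [|m IH]; first by rewrite !big_ord0 mulr1 mul1r; under eq_bigr do rewrite add0r.
rewrite [\prod_(k < m.+1) g (b - _ + _)]big_ord_recr [\prod_(k < m.+1) g (b + _)]big_ord_recr /=.
have e : \prod_(j < N) g (m.+1%:Z + b - 1 - j%:Z) * g (b - N%:Z + m%:Z) =
    g (b + m%:Z) * \prod_(j < N) g (m%:Z + b - 1 - j%:Z).
  have -> : \prod_(j < N) g (m.+1%:Z + b - 1 - j%:Z) * g (b - N%:Z + m%:Z) =
      \prod_(j < N.+1) g (m.+1%:Z + b - 1 - j%:Z).
    by rewrite big_ord_recr /=; congr (_ * g _); lia.
  rewrite big_ord_recl; congr (g _ * _); first by rewrite /=; lia.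
  by apply: eq_bigr => j _; congr g; rewrite /= /bump /=; lia.
by rewrite [X in _ * X]mulrC mulrA e -mulrA IH mulrCA mulrA.
Qed.

(* [b] plays the role of q^(1/2), and [k - i] is the content of the box (i, k). *)
Definition content_poly (F : fieldType) (b : F) (mu : intpart) : {poly F} :=
  \prod_(i < size mu) \prod_(k < nth 0%N mu i) (1 + b ^ (2 * (k%:Z - i%:Z)) *: 'X).

Section PolyLimit.
Variable C : numFieldType.

Definition cvg_coefs (P : nat -> {poly C}) (p : {poly C}) :=
  forall e, (P N)`_e @[N --> \oo] --> p`_e.

Lemma cvg_coefsM P p Q q : cvg_coefs P p -> cvg_coefs Q q ->
  cvg_coefs (fun N => P N * Q N) (p * q).
Proof.
move=> Pp Qq e; under eq_fun do rewrite coefM; rewrite coefM.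
by apply: cvg_big => [|j _]; [exact: add_continuous | apply: cvgM].
Qed.

Lemma cvg_coefs_cst p : cvg_coefs (fun=> p) p.
Proof. by move=> e; apply: cvg_cst. Qed.

Lemma cvg_coefs_prod n (P : nat -> 'I_n -> {poly C}) (p : 'I_n -> {poly C}) :
  (forall i, cvg_coefs (P^~ i) (p i)) ->
  cvg_coefs (fun N => \prod_(i < n) P N i) (\prod_(i < n) p i).
Proof.
elim: n P p => [|n IH] P p Pp.
  by rewrite big_ord0; under eq_fun do rewrite big_ord0; apply: cvg_coefs_cst.
rewrite big_ord_recr; under eq_fun do rewrite big_ord_recr.
by apply: cvg_coefsM => //; apply: IH => i; apply: Pp.
Qed.

Lemma cvg_coefs_linear (c : nat -> C) : c @ \oo --> (0 : C) ->
  cvg_coefs (fun N => 1 + c N *: 'X) 1.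
Proof.
move=> c0 e.
have h : (1 : {poly C})`_e + c N * (e == 1%N)%:R @[N --> \oo] -->
    (1 : {poly C})`_e + 0 * (e == 1%N)%:R.
  by apply: cvgD; [exact: cvg_cst | apply: cvgM => //; exact: cvg_cst].
rewrite mul0r addr0 in h.
have -> : (fun N => (1 + c N *: 'X : {poly C})`_e) =
          (fun N => (1 : {poly C})`_e + c N * (e == 1%N)%:R).
  by apply: funext => N; rewrite coefD coefZ coefX.
exact: h.
Qed.

End PolyLimit.

Section Conifold.
Variable R : realType.
Local Notation K := R[i].
Implicit Types (s : K) (mu nu : intpart).

Definition brane_sum mu d s : K :=
  \sum_(nu <- parts_of d) schur_lim mu nu s * schur_lim part0 (pconj nu) s.

Definition cauchy_prod mu s N : {poly K} :=
  \prod_(i < N) \prod_(j < N) (1 + (qmurho mu s i * qmurho part0 s j) *: 'X).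

Lemma cvg_cauchy_prod mu s d : 1 < `|s| ->
  ((cauchy_prod mu s N)`_d : (K : numFieldType)) @[N --> \oo] -->
  (brane_sum mu d s : (K : numFieldType)).
Proof.
move=> s1; pose f N : (K : numFieldType) := \sum_(nu <- parts_of d)
  schur_pol nu N (qmurho mu s) * schur_pol (pconj nu) N (qmurho part0 s).
have fc : f N @[N --> \oo] --> (brane_sum mu d s : (K : numFieldType)).
  apply: cvg_big => [|nu _]; first exact: add_continuous.
  by apply: cvgM; apply: cvg_schur_pol.
(* All partitions of d fit into the N x N box only once N >= d. *)
rewrite -(cvg_shiftn d) in fc; rewrite -(cvg_shiftn d).
suff -> : [sequence (cauchy_prod mu s (N + d)%N)`_d : (K : numFieldType)]_N =
          [sequence f (N + d)%N]_N by exact: fc.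
apply: funext => N /=; rewrite /cauchy_prod.
rewrite -schur_dual_cauchy; last by move=> j; apply: qmurho_neq0.
- by rewrite (coef_sum_box_parts (fun nu => schur_pol nu _ _ * _)) ?leq_addl.
- by move=> i j _ _; apply: qmurho_inj.
- by move=> i j _ _; apply: qmurho_inj.
Qed.

(** Row i of the Cauchy product is shifted by mu_i: new factors, indexed by contents, enter at one
    end, and as many drop out at the other. The latter carry q^(-N) and are restored by the second
    product on the left, which tends to 1. *)
Lemma cauchy_prod_telescope mu s N : 1 < `|s| -> (size mu <= N)%N ->
  cauchy_prod mu s N *
    \prod_(i < size mu) \prod_(k < nth 0%N mu i)
      (1 + ((s ^ (-2)) ^+ N * s ^ (2 * (k%:Z - i%:Z))) *: 'X) =
  content_poly s mu * cauchy_prod part0 s N.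
Proof.
move=> s1 sN; have s0 := outside_neq0 s1.
pose g (z : int) : {poly K} := 1 + s ^ (2 * z) *: 'X.
have widen (h : nat -> nat -> {poly K}) :
    \prod_(i < size mu) \prod_(k < nth 0%N mu i) h i k =
    \prod_(i < N) \prod_(k < nth 0%N mu i) h i k.
  rewrite (big_ord_widen N (fun i => \prod_(k < nth 0%N mu i) h i k)) // big_mkcond.
  by apply: eq_bigr => i _; case: ltnP => // h'; rewrite nth_default // big_ord0.
rewrite /content_poly (widen (fun i k => 1 + s ^ (2 * (k%:Z - i%:Z)) *: 'X)).
rewrite (widen (fun i k => 1 + ((s ^ (-2)) ^+ N * s ^ (2 * (k%:Z - i%:Z))) *: 'X)).
rewrite /cauchy_prod -!big_split; apply: eq_bigr => i _ /=.
have := prod_telescope g (- (i : nat)%:Z) (nth 0%N mu i) N; rewrite /g => e.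
transitivity (\prod_(j < N) g ((nth 0%N mu i)%:Z + - (i : nat)%:Z - 1 - (j : nat)%:Z) *
  \prod_(k < nth 0%N mu i) g (- (i : nat)%:Z - N%:Z + (k : nat)%:Z)).
  congr (_ * _); apply: eq_bigr => j _; rewrite /g; congr (1 + _ *: 'X).
    by rewrite /qmurho nth_nil -expfzDr //; congr (_ ^ _); lia.
  by rewrite exprnP exprz_exp -expfzDr //; congr (_ ^ _); lia.
rewrite e; congr (_ * _); apply: eq_bigr => j _; rewrite /g; congr (1 + _ *: 'X).
  by congr (_ ^ _); lia.
by rewrite /qmurho !nth_nil -expfzDr //; congr (_ ^ _); lia.
Qed.

(** Passage to the limit in [cauchy_prod_telescope], coefficient by coefficient, both sides being
    limits of the same sequence. *)
Lemma brane_sum_rec mu d s : 1 < `|s| ->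
  brane_sum mu d s = \sum_(j < d.+1) (content_poly s mu)`_j * brane_sum part0 (d - j) s.
Proof.
move=> s1.
pose D N : {poly K} := \prod_(i < size mu) \prod_(k < nth 0%N mu i)
      (1 + ((s ^ (-2)) ^+ N * s ^ (2 * (k%:Z - i%:Z))) *: 'X).
have cD e : ((D N)`_e : (K : numFieldType)) @[N --> \oo] --> ((1 : {poly K})`_e : (K : numFieldType)).
  have : @cvg_coefs (K : numFieldType) D
      (\prod_(i < size mu) \prod_(k < nth 0%N mu i) 1).
    apply: cvg_coefs_prod => i; apply: cvg_coefs_prod => k; apply: cvg_coefs_linear.
    rewrite -[X in _ --> X](mul0r (s ^ (2 * ((k : nat)%:Z - (i : nat)%:Z)))).
    apply: cvgM; last exact: cvg_cst.
    exact/cvg_expr_complex/norm_exprN2_lt1.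
  by rewrite big1 => [|i _]; [apply | rewrite big1].
have lhs : ((cauchy_prod mu s N * D N)`_d : (K : numFieldType)) @[N --> \oo] -->
    (brane_sum mu d s : (K : numFieldType)).
  have -> : brane_sum mu d s = \sum_(j < d.+1) brane_sum mu j s * (1 : {poly K})`_(d - j).
    rewrite big_ord_recr /= subnn coef1 mulr1 big1 ?add0r // => j _.
    by rewrite coef1 subn_eq0 leqNgt ltn_ord mulr0.
  under eq_fun do rewrite coefM.
  apply: cvg_big => [|j _]; first exact: add_continuous.
  by apply: cvgM; [apply: cvg_cauchy_prod | apply: cD].
have rhs : ((content_poly s mu * cauchy_prod part0 s N)`_d : (K : numFieldType)) @[N --> \oo] -->
    (\sum_(j < d.+1) (content_poly s mu)`_j * brane_sum part0 (d - j) s : (K : numFieldType)).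
  under eq_fun do rewrite coefM.
  apply: cvg_big => [|j _]; first exact: add_continuous.
  by apply: cvgM; [apply: cvg_cst | apply: cvg_cauchy_prod].
rewrite -(cvg_shiftn (size mu)) in lhs; rewrite -(cvg_shiftn (size mu)) in rhs.
have lhs' : (fun N => (cauchy_prod mu s (N + size mu)%N * D (N + size mu)%N)`_d : (K : numFieldType))
    @ \oo --> (brane_sum mu d s : (K : numFieldType)) := lhs.
have e : (fun N => (cauchy_prod mu s (N + size mu)%N * D (N + size mu)%N)`_d : (K : numFieldType)) =
    (fun N => (content_poly s mu * cauchy_prod part0 s (N + size mu)%N)`_d : (K : numFieldType)).
  by apply: funext => N; rewrite cauchy_prod_telescope ?leq_addl.
rewrite e in lhs'.
have rhs' : (fun N => (content_poly s mu * cauchy_prod part0 s (N + size mu)%N)`_d : (K : numFieldType))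
    @ \oo --> (\sum_(j < d.+1) (content_poly s mu)`_j * brane_sum part0 (d - j) s :
                 (K : numFieldType)) := rhs.
have := cvg_lim (@norm_hausdorff _ _) lhs'; rewrite (cvg_lim (@norm_hausdorff _ _) rhs').
by move=> ->.
Qed.

Definition brane_coef mu d : Kq R := \sum_(nu <- parts_of d) W2 R mu nu * W1 R (pconj nu).

Lemma represents_brane_coef mu d :
  represents (brane_coef mu d) (fun s => schur_lim part0 mu s * brane_sum mu d s).
Proof.
have h : represents (brane_coef mu d) (fun s => \sum_(nu <- parts_of d)
    schur_lim part0 mu s * schur_lim mu nu s * schur_lim part0 (pconj nu) s).
  by apply: represents_sum => nu _; apply: representsM (represents_W2 _ _ _) (represents_W1 _ _).
apply: (represents_ext _ h) => s _; rewrite mulr_sumr.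
by apply: eq_bigr => nu _; rewrite mulrA.
Qed.

Lemma represents_content_poly mu e :
  represents (content_poly (qhalf R) mu)`_e (fun s => (content_poly s mu)`_e).
Proof.
(* Stated for general factors because it is applied twice, to the rows and to the boxes of a row. *)
have prodP n (P : 'I_n -> {poly Kq R}) (p : K -> 'I_n -> {poly K}) :
    (forall i e, represents (P i)`_e (fun s => (p s i)`_e)) ->
    forall e, represents (\prod_(i < n) P i)`_e (fun s => (\prod_(i < n) p s i)`_e).
  elim: n P p => [|n IH] P p Pp e'.
    rewrite big_ord0 coef1; have := represents_const ((e' == 0%N)%:R : K).
    rewrite (_ : Kconst _ = (e' == 0%N)%:R); last first.
      by case: (e' == 0%N); rewrite /Kconst ?tofrac1 ?tofrac0.
    by apply: represents_ext => s _; rewrite big_ord0 coef1.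
  have h : represents (\sum_(j < e'.+1) (\prod_(i < n) P (widen_ord (leqnSn n) i))`_j *
        (P ord_max)`_(e' - j))
      (fun s => \sum_(j < e'.+1) (\prod_(i < n) p s (widen_ord (leqnSn n) i))`_j *
        (p s ord_max)`_(e' - j)).
    apply: represents_sum => j _; apply: representsM; last exact: Pp.
    by apply: (IH _ (fun s i => p s (widen_ord (leqnSn n) i))) => i e2; apply: Pp.
  rewrite big_ord_recr coefM; apply: (represents_ext _ h) => s _.
  by rewrite [in RHS]big_ord_recr coefM.
apply: (prodP _ _ (fun s i => \prod_(k < nth 0%N mu i) (1 + s ^ (2 * ((k : nat)%:Z - (i : nat)%:Z)) *: 'X))).
move=> i {}e.
apply: (prodP _ _ (fun s (k : 'I_(nth 0%N mu i)) => 1 + s ^ (2 * ((k : nat)%:Z - (i : nat)%:Z)) *: 'X)).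
move=> k {}e; rewrite coefD coefZ coef1 coefX.
have h := representsD (represents_const ((e == 0%N)%:R : K))
  (representsM (represents_qhalf_exp R (2 * ((k : nat)%:Z - (i : nat)%:Z)))
     (represents_const ((e == 1%N)%:R : K))).
have kb (b : bool) : Kconst (b%:R : K) = b%:R by case: b; rewrite /Kconst ?tofrac1 ?tofrac0.
rewrite !kb in h; apply: (represents_ext _ h) => s _.
by rewrite coefD coefZ coef1 coefX.
Qed.

Lemma brane_coef_rec mu d :
  brane_coef mu d =
  W1 R mu * \sum_(j < d.+1) (content_poly (qhalf R) mu)`_j * brane_coef part0 (d - j).
Proof.
have h : represents (W1 R mu * \sum_(j < d.+1) (content_poly (qhalf R) mu)`_j * brane_coef part0 (d - j))
   (fun s => schur_lim part0 mu s * \sum_(j < d.+1) (content_poly s mu)`_j *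
      (schur_lim part0 part0 s * brane_sum part0 (d - j) s)).
  apply: representsM; first exact: represents_W1.
  apply: represents_sum => j _; apply: representsM; first exact: represents_content_poly.
  exact: represents_brane_coef.
apply: (represents_uniq (represents_brane_coef mu d) h) => s s1.
rewrite brane_sum_rec //; congr (_ * _); apply: eq_bigr => j _.
by rewrite [schur_lim part0 part0 s]det_mx00 mul1r.
Qed.

End Conifold.

(** * Principal specialization of hooks and q-binomial identities *)

Lemma sign_subn (A : pzRingType) (m k : nat) : (k <= m)%N ->
  (-1) ^+ (m - k)%N = (-1) ^+ m * (-1) ^+ k :> A.
Proof.
move=> km; rewrite -[in RHS](subnK km) exprD -mulrA -exprD addnn -mul2n exprM.
by rewrite expr2 mulrNN mulr1 expr1n mulr1.
Qed.

Section HookDeterminant.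
Variables (F : fieldType) (H e : nat -> F).
Hypotheses (H0 : H 0%N = 1) (e0 : e 0%N = 1).
Hypothesis orth : forall m, \sum_(k < m.+2) (-1) ^+ k * e (m.+1 - k)%N * H k = 0.

(* Adding to the last row the combination of the others with coefficients
   (-1)^(B-k) e_(B-k) leaves only its first entry. *)
Lemma hook_det A B n : n = B.+1 ->
  \det (\matrix_(k < n, j < n)
    if (j <= nth 0%N (hook A B) j + k)%N then H (nth 0%N (hook A B) j + k - j)%N else 0) =
  \sum_(k < B.+1) (-1) ^+ k * e (B - k)%N * H (A.+1 + k)%N.
Proof.
move=> ->{n}; set M := \matrix_(k, j) _.
have nthS j : (j < B)%N -> nth 0%N (hook A B) j.+1 = 1%N.
  by move=> jB; rewrite /= nth_nseq jB.
pose L : 'M[F]_B.+1 := \matrix_(k, k')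
  if k == ord_max then (-1) ^+ (B - k')%N * e (B - k')%N else (k == k')%:R.
have dL : \det L = 1.
  rewrite det_trig.
    rewrite big1 // => k _; rewrite mxE eqxx; case: eqP => // ->.
    by rewrite subnn expr0 e0 mulr1.
  apply/is_trig_mxP => k k' kk'; rewrite mxE; case: eqP => [ek|_].
    by have := ltn_ord k'; move: kk'; rewrite ek /=; lia.
  by rewrite -val_eqE /= ltn_eqF.
have LM k j : k != ord_max -> (L *m M) k j = M k j.
  move=> nk; rewrite mxE (bigD1 k) //= big1 ?addr0 => [|k' nk'].
    by rewrite !mxE (negPf nk) eqxx mul1r.
  by rewrite mxE (negPf nk) eq_sym (negPf nk') mul0r.
have LMmax j : j != 0 -> (L *m M) ord_max j = 0.
  case: j => -[|j] // jB _; rewrite mxE.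
  have jB' : (j < B)%N by [].
  rewrite (eq_bigr (fun k : 'I_B.+1 => (-1) ^+ (B - k)%N * e (B - k)%N *
    (if (j <= k)%N then H (k - j)%N else 0))); last first.
    by move=> k _; rewrite !mxE eqxx nthS // add1n ltnS subSS.
  have [m em] : exists m, (B - j = m.+1)%N by exists (B - j).-1; lia.
  have EB : B.+1 = (j + m.+2)%N by lia.
  rewrite -(big_mkord xpredT (fun k => (-1) ^+ (B - k)%N * e (B - k)%N *
    (if (j <= k)%N then H (k - j)%N else 0))) EB (big_cat_nat (leq0n j) (leq_addr _ _)) /=.
  rewrite big_nat big1 ?add0r => [|k /andP[_ kj]]; last by rewrite leqNgt kj mulr0.
  rewrite -{1}[j]add0n big_addn addnC addnK big_mkord.
  transitivity ((-1) ^+ m.+1 * \sum_(k < m.+2) (-1) ^+ k * e (m.+1 - k)%N * H k);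
    last by rewrite orth mulr0.
  rewrite mulr_sumr.
  apply: eq_bigr => k _; rewrite leq_addl addnK (_ : (B - (k + j))%N = (m.+1 - k)%N); last by lia.
  rewrite !mulrA; congr (_ * _ * _).
  by rewrite sign_subn // -ltnS.
have -> : \det M = \det (L *m M) by rewrite det_mulmx dL mul1r.
rewrite (expand_det_row _ ord_max) (bigD1 ord0) //= big1 ?addr0 => [|j nj]; last first.
  by rewrite LMmax ?mul0r.
(* The remaining columns belong to parts equal to 1, so the minor is lower triangular with diagonal
   H 0. *)
have -> : cofactor (L *m M) ord_max ord0 = (-1) ^+ B.
  rewrite /cofactor /= addn0 -[RHS]mulr1; congr (_ * _).
  have eM (k j : 'I_B) : row' ord_max (col' ord0 (L *m M)) k j =
      if (j <= k)%N then H (k - j)%N else 0.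
    rewrite !mxE.
    have nk : lift ord_max k != ord_max by rewrite eq_sym neq_lift.
    have := LM _ (lift ord0 j) nk; rewrite mxE => ->.
    rewrite mxE; have -> : lift ord0 j = j.+1 :> nat by [].
    have -> : lift ord_max k = k :> nat by rewrite /= /bump leqNgt ltn_ord.
    by rewrite nthS ?ltn_ord // add1n ltnS subSS.
  rewrite det_trig; last first.
    by apply/is_trig_mxP => k j kj; rewrite eM leqNgt kj.
  by rewrite big1 // => k _; rewrite eM leqnn subnn H0.
rewrite mxE mulr_suml; apply: eq_bigr => k _.
rewrite !mxE eqxx /= subn0 mulrC !mulrA; congr (_ * _ * _).
have kB : (k <= B)%N by rewrite -ltnS.
by rewrite sign_subn // mulrA -exprD addnn -mul2n exprM expr2 mulrNN mulr1 expr1n mul1r.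
Qed.

End HookDeterminant.

Section HookValue.
Variables (F : fieldType) (a t : F).
Hypothesis t_gen : forall k, 1 - t ^+ k.+1 != 0.

Definition tfact m := \prod_(k < m) (1 - t ^+ k.+1).
(** [hq] and [elem_q] are h_m and e_m of the geometric sequence a, a t, a t^2, ...; for q^rho, a =
    q^(-1/2) and t = q^(-1). *)
Definition hq m := a ^+ m / tfact m.
Definition elem_q m := a ^+ m * t ^+ 'C(m, 2) / tfact m.

Lemma tfact_neq0 m : tfact m != 0.
Proof. by apply/prodf_neq0 => k _; apply: t_gen. Qed.

Lemma tfact0 : tfact 0 = 1.
Proof. exact: big_ord0. Qed.

Lemma tfactS m : tfact m.+1 = tfact m * (1 - t ^+ m.+1).
Proof. exact: big_ord_recr. Qed.

(** Induction on [B] through Pieri's rule e_(B+1) h_(A+1) = s_(A|B+1) + s_(A+1|B). *)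
Lemma hook_sum A B :
  \sum_(k < B.+1) (-1) ^+ k * elem_q (B - k)%N * hq (A.+1 + k)%N =
  a ^+ (A + B).+1 * t ^+ 'C(B.+1, 2) / (tfact A * tfact B * (1 - t ^+ (A + B).+1)).
Proof.
have tA := tfact_neq0 A; have t0 := t_gen.
elim: B A tA => [|B IH] A tA.
  rewrite big_ord1 /elem_q /hq !addn0 subnn tfactS tfact0 !expr0.
  have h := t0 A.
  by field; rewrite h tA oner_eq0.
rewrite big_ord_recl /= subn0 addn0 expr0 mul1r.
have -> : \sum_(i < B.+1) (-1) ^+ bump 0 i * elem_q (B.+1 - bump 0 i)%N * hq (A.+1 + bump 0 i)%N =
   - \sum_(k < B.+1) (-1) ^+ k * elem_q (B - k)%N * hq (A.+2 + k)%N.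
  rewrite -sumrN; apply: eq_bigr => k _; rewrite /bump /= add1n subSS addnS -addSn exprS.
  by rewrite mulN1r !mulNr.
rewrite IH ?tfact_neq0 // /elem_q /hq !tfactS (binS B.+1 1) bin1 addSnnS.
have tB := tfact_neq0 B; have h1 := t0 B; have h2 := t0 A; have h3 := t0 (A + B.+1)%N.
have -> : t ^+ (A + B.+1).+1 = t ^+ A.+1 * t ^+ B.+1 by rewrite -exprD; congr (_ ^+ _); lia.
have -> : a ^+ (A + B.+1).+1 = a ^+ A.+1 * a ^+ B.+1 by rewrite -exprD; congr (_ ^+ _); lia.
move: h3; have -> : t ^+ (A + B.+1).+1 = t ^+ A.+1 * t ^+ B.+1 by rewrite -exprD; congr (_ ^+ _); lia.
rewrite [t ^+ (_ + B.+1)]exprD.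
set x := t ^+ A.+1 in h2 *; set y := t ^+ B.+1 in h1 *; move=> h3.
by field; rewrite tA tB h1 h2 h3.
Qed.

(** The terms with k > 0 form minus the sum of [hook_sum] for the one-column hook (0 | m), which
    equals e_(m+1), the term k = 0. *)
Lemma hook_orth m : \sum_(k < m.+2) (-1) ^+ k * elem_q (m.+1 - k)%N * hq k = 0.
Proof.
rewrite big_ord_recl /= subn0 expr0 mul1r.
have -> : \sum_(i < m.+1) (-1) ^+ bump 0 i * elem_q (m.+1 - bump 0 i)%N * hq (bump 0 i) =
   - \sum_(k < m.+1) (-1) ^+ k * elem_q (m - k)%N * hq (1 + k)%N.
  rewrite -sumrN; apply: eq_bigr => k _; rewrite /bump /= add1n subSS exprS.
  by rewrite mulN1r !mulNr.
rewrite (hook_sum 0) /elem_q /hq tfactS !tfact0 add0n expr0.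
have tm := tfact_neq0 m; have h := t_gen m.
by field; rewrite tm h oner_eq0.
Qed.

End HookValue.

Section BracketPower.
Variable (F : fieldType) (s : F).
Hypothesis s0 : s != 0.

(** Over an arbitrary field, since it is used both at complex points s and at the indeterminate
    [qhalf]. *)
Definition bracket (m : int) := s ^ m - s ^ (- m).
Definition bfact m := \prod_(1 <= k < m.+1) bracket k%:Z.

Lemma bracket_expr k : bracket k%:Z = s ^+ k * (1 - (s ^ (-2)) ^+ k).
Proof.
rewrite /bracket mulrBr mulr1; congr (_ - _).
by rewrite exprnP exprnP exprz_exp -expfzDr //; congr (_ ^ _); lia.
Qed.

Lemma bfactE m : bfact m = s ^+ 'C(m.+1, 2) * tfact (s ^ (-2)) m.
Proof.
rewrite /bfact; elim: m => [|m IH]; first by rewrite big_geq // tfact0 mulr1.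
by rewrite big_nat_recr //= IH tfactS bracket_expr (binS m.+1 1) bin1 exprD; ring.
Qed.

End BracketPower.

Section HookSchur.
Variable R : realType.
Local Notation K := R[i].

Lemma hsym_lim_part0 m (s : K) : hsym_lim part0 m s = hq (s ^ (-1)) (s ^ (-2)) m.
Proof.
rewrite /hsym_lim big_ord_recr big1 /= ?add0r => [|j _].
  by rewrite subnn mul1r prodfV.
by rewrite /hsym subn_eq0 leqNgt ltn_ord mul0r.
Qed.

Lemma schur_lim_hook A B (s : K) : 1 < `|s| ->
  schur_lim part0 (hook A B) s =
  s ^ ('C(A.+1, 2)%:Z - 'C(B.+1, 2)%:Z) /
    (bracket s (A + B).+1%:Z * bfact s A * bfact s B).
Proof.
move=> s1; have s0 := outside_neq0 s1; have t_gen k := one_minus_expr_neq0 k s1.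
set t := s ^ (-2) in t_gen; pose a := s ^ (-1).
have -> : schur_lim part0 (hook A B) s =
    \sum_(k < B.+1) (-1) ^+ k * elem_q a t (B - k)%N * hq a t (A.+1 + k)%N.
  have H0 : hq a t 0 = 1 by rewrite /hq tfact0 divr1.
  have e0 : elem_q a t 0 = 1 by rewrite /elem_q tfact0 divr1 mulr1.
  have sz : size (hook A B) = B.+1 by rewrite /= size_nseq.
  rewrite -(hook_det H0 e0 (hook_orth a t_gen) A sz) /schur_lim.
  congr (\det _); apply/matrixP => k j; rewrite !mxE.
  by case: ifP => // _; rewrite hsym_lim_part0.
rewrite hook_sum // !bfactE // bracket_expr // -/t.
have tA := tfact_neq0 t_gen A; have tB := tfact_neq0 t_gen B; have tn := t_gen (A + B)%N.
have ea : a ^+ (A + B).+1 = (s ^+ (A + B).+1)^-1 by rewrite /a exprVn.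
have et : t ^+ 'C(B.+1, 2) = (s ^+ 'C(B.+1, 2))^-1 * (s ^+ 'C(B.+1, 2))^-1.
  by rewrite /t -[s ^ (-2)]/((s ^+ 2)^-1) exprVn -exprM mul2n -addnn exprD invfM.
rewrite ea et expfzDr // -[s ^ (- _)]exprnN.
rewrite -[s ^ 'C(A.+1, 2)%:Z]/(s ^+ 'C(A.+1, 2)).
have sA : s ^+ 'C(A.+1, 2) != 0 by rewrite expf_neq0.
have sB : s ^+ 'C(B.+1, 2) != 0 by rewrite expf_neq0.
have sn : s ^+ (A + B).+1 != 0 by rewrite expf_neq0.
by field; rewrite ?tA ?tB ?tn ?sA ?sB ?sn.
Qed.

Lemma W1_hook A B : W1 R (hook A B) =
  qhalf R ^ ('C(A.+1, 2)%:Z - 'C(B.+1, 2)%:Z) /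
    (qbr R (A + B).+1%:Z * qfact R A * qfact R B).
Proof.
have rbr m : represents (qbr R m) (fun s => bracket s m).
  by apply: representsD; [|apply: representsN]; apply: represents_qhalf_exp.
have rbf m : represents (qfact R m) (fun s => bfact s m).
  by apply: represents_prod => k _; apply: rbr.
have := representsM (represents_qhalf_exp R ('C(A.+1, 2)%:Z - 'C(B.+1, 2)%:Z))
  (representsV _ (representsM (representsM (rbr (A + B).+1%:Z) (rbf A)) (rbf B))).
move=> h; apply: (represents_uniq (represents_W1 _ _) (h _)) => s s1.
  have s0 := outside_neq0 s1; have t_gen k := one_minus_expr_neq0 k s1.
  rewrite !bfactE // bracket_expr // !mulf_neq0 ?expf_neq0 ?tfact_neq0 //.
exact: schur_lim_hook.
Qed.

End HookSchur.

(** The contents of the hook are -B, ..., A, each occurring once. *)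
Lemma content_poly_hook (F : fieldType) (b : F) A B :
  content_poly b (hook A B) =
  \prod_(c < (A + B).+1) (1 + b ^ (2 * (c%:Z - B%:Z)) *: 'X).
Proof.
rewrite /content_poly /= big_ord_recl /= size_nseq.
rewrite [X in _ * X](eq_bigr (fun i : 'I_B => 1 + b ^ (2 * (- (i.+1)%:Z)) *: 'X)); last first.
  move=> i _; rewrite /bump /= add1n /= nth_nseq ltn_ord big_ord1.
  by congr (1 + b ^ _ *: 'X); rewrite /=; lia.
have -> : (A + B).+1 = (B + A.+1)%N by lia.
rewrite big_split_ord /= mulrC; congr (_ * _).
  rewrite [RHS](reindex_inj rev_ord_inj) /=; apply: eq_bigr => i _.
  by congr (1 + b ^ _ *: 'X); have := ltn_ord i; lia.
by apply: eq_bigr => i _; congr (1 + b ^ _ *: 'X); lia.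
Qed.

Lemma kappa_hook A B : kappa (hook A B) = 2 * ('C(A.+1, 2)%:Z - 'C(B.+1, 2)%:Z).
Proof.
rewrite /kappa /= big_ord_recl /= size_nseq.
rewrite (eq_bigr (fun i : 'I_B => - 2 * i.+1%:Z)); last first.
  by move=> i _; rewrite /bump /= add1n /= nth_nseq ltn_ord; lia.
rewrite -mulr_sumr.
have -> : \sum_(i < B) i.+1%:Z = 'C(B.+1, 2)%:Z.
  elim: B => [|B IH]; first by rewrite big_ord0.
  by rewrite big_ord_recr /= IH (binS B.+1 1) bin1 PoszD.
have : ('C(A.+1, 2) * 2 = A.+1 * A)%N.
  by have := bin_ffact A.+1 2; rewrite ffactnS ffactn1.
by lia.
Qed.

(** * Symmetric q-binomial coefficients *)

Section QBinomial.
Variables (F : fieldType) (s : F).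
Hypothesis s0 : s != 0.
Hypothesis bracket_neq0 : forall k : nat, bracket s k.+1%:Z != 0.
Local Notation bf := (bfact s).

Lemma bfact0 : bf 0 = 1.
Proof. by rewrite /bfact big_geq. Qed.

Lemma bfactS m : bf m.+1 = bf m * bracket s m.+1%:Z.
Proof. by rewrite /bfact big_nat_recr. Qed.

Lemma bfact_neq0 m : bf m != 0.
Proof. by elim: m => [|m IH]; rewrite ?bfact0 ?oner_eq0 // bfactS mulf_neq0. Qed.

Definition qbinom m j := bf m / (bf j * bf (m - j)).

Lemma qbinom0 m : qbinom m 0 = 1.
Proof. by rewrite /qbinom bfact0 subn0 mul1r divff ?bfact_neq0. Qed.

Lemma qbinomn m : qbinom m m = 1.
Proof. by rewrite /qbinom subnn bfact0 mulr1 divff ?bfact_neq0. Qed.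

Lemma qbinomS m j : (j < m)%N ->
  qbinom m.+1 j.+1 = s ^ (- j.+1%:Z) * qbinom m j.+1 + s ^ (m%:Z - j%:Z) * qbinom m j.
Proof.
move=> jm; rewrite /qbinom subSS.
have -> : (m - j = (m - j.+1).+1)%N by lia.
set r := (m - j.+1)%N; rewrite !bfactS.
have b1 := bfact_neq0 j; have b2 := bfact_neq0 r; have b3 := bracket_neq0 j.
have b4 := bracket_neq0 r.
have e : bracket s m.+1%:Z =
    s ^ (- j.+1%:Z) * bracket s r.+1%:Z + s ^ (m%:Z - j%:Z) * bracket s j.+1%:Z.
  rewrite /bracket !mulrBr -!expfzDr //.
  have -> : - j.+1%:Z + r.+1%:Z = m%:Z - j%:Z - j.+1%:Z by rewrite /r; lia.
  have -> : - j.+1%:Z - r.+1%:Z = - m.+1%:Z by rewrite /r; lia.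
  have -> : m%:Z - j%:Z + j.+1%:Z = m.+1%:Z by lia.
  by ring.
rewrite e; move: (s ^ (- j.+1%:Z)) (s ^ (m%:Z - j%:Z)) => u v.
by field; rewrite b1 b2 b3 b4.
Qed.

Lemma coef_qbinomial m (c : F) j :
  (\prod_(k < m) (1 + (c * s ^ (2 * k%:Z)) *: 'X))`_j =
  if (j <= m)%N then qbinom m j * s ^ (j%:Z * (m%:Z - 1)) * c ^+ j else 0.
Proof.
elim: m j => [|m IH] j.
  rewrite big_ord0 coef1; case: j => [|j] //=.
  by rewrite qbinom0 mul0r expr0z !mulr1.
rewrite big_ord_recr /= mulrDr mulr1 -scalerAr coefD coefZ coefMX !IH.
case: j => [|j] /=.
  by rewrite !qbinom0 mulr0 addr0 !mul0r !expr0z.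
rewrite ltnS; have [jm|mj|ejm] := ltngtP j m.
- rewrite qbinomS // exprS [in RHS]mulrDl [in RHS]mulrDl; congr (_ + _).
    rewrite [X in _ = X * _]mulrAC -expfzDr //; congr (_ * _).
    by rewrite mulrC; congr (s ^ _ * _); lia.
  have -> : c * s ^ (2 * m%:Z) * (qbinom m j * s ^ (j%:Z * (m%:Z - 1)) * c ^+ j) =
     (s ^ (2 * m%:Z) * s ^ (j%:Z * (m%:Z - 1))) * qbinom m j * (c * c ^+ j) by ring.
  have -> : s ^ (m%:Z - j%:Z) * qbinom m j * s ^ (j.+1%:Z * (m.+1%:Z - 1)) * (c * c ^+ j) =
     (s ^ (m%:Z - j%:Z) * s ^ (j.+1%:Z * (m.+1%:Z - 1))) * qbinom m j * (c * c ^+ j) by ring.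
  by rewrite -!expfzDr //; congr (s ^ _ * _ * _); lia.
- by rewrite mulr0 addr0.
- rewrite ejm add0r !qbinomn !mul1r exprS.
  have -> : c * s ^ (2 * m%:Z) * (s ^ (m%:Z * (m%:Z - 1)) * c ^+ m) =
    (s ^ (2 * m%:Z) * s ^ (m%:Z * (m%:Z - 1))) * (c * c ^+ m) by ring.
  by rewrite -expfzDr //; congr (s ^ _ * _); lia.
Qed.

Lemma coef_content_poly_hook A B j :
  (content_poly s (hook A B))`_j =
  if (j <= (A + B).+1)%N then qbinom (A + B).+1 j * s ^ (j%:Z * (A%:Z - B%:Z)) else 0.
Proof.
rewrite content_poly_hook.
rewrite (eq_bigr (fun k : 'I_(A + B).+1 => 1 + (s ^ (- 2 * B%:Z) * s ^ (2 * k%:Z)) *: 'X)).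
  rewrite coef_qbinomial; case: ifP => // _; rewrite -mulrA exprnP exprz_exp -expfzDr //.
  by congr (_ * s ^ _); lia.
by move=> k _; rewrite -expfzDr //; congr (1 + s ^ _ *: 'X); lia.
Qed.

Lemma binom2_diff m B : (B <= m)%N ->
  'C((m - B).+1, 2)%:Z - 'C(B.+1, 2)%:Z = 'C(m.+1, 2)%:Z - B%:Z * m.+1%:Z.
Proof.
have E k : ('C(k.+1, 2) * 2 = k.+1 * k)%N.
  by have := bin_ffact k.+1 2; rewrite ffactnS ffactn1.
move=> Bm; have := E (m - B)%N; have := E B; have := E m.
have -> : m = (m - B + B)%N by rewrite subnK.
rewrite addnK; move: (m - B)%N => A.
by move=> h1 h2 h3; nia.
Qed.

Lemma prod_bracket (e : int) m :
  \prod_(1 <= k < m.+1) bracket s (e + k%:Z) =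
  \sum_(B < m.+1) (-1) ^+ B * qbinom m B *
     s ^ (e * (m%:Z - 2 * B%:Z) + ('C((m - B).+1, 2)%:Z - 'C(B.+1, 2)%:Z)).
Proof.
(* Each bracket is s^(e+k) (1 - s^(-2e-2k)); read from k = m down to 1, the second factors form a
   progression of ratio s^2 starting with this c. *)
pose c := - s ^ (- 2 * e - 2 * m%:Z).
pose P := \prod_(k < m) (1 + (c * s ^ (2 * k%:Z)) *: 'X).
have P1 : P.[1] = \sum_(B < m.+1) qbinom m B * s ^ (B%:Z * (m%:Z - 1)) * c ^+ B.
  have szP : (size P <= m.+1)%N.
    apply/leq_sizeP => j mj; rewrite /P coef_qbinomial.
    by rewrite leqNgt mj.
  rewrite (horner_coef_wide _ szP); apply: eq_bigr => B _.
  by rewrite /P coef_qbinomial -ltnS ltn_ord expr1n mulr1.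
have -> : \prod_(1 <= k < m.+1) bracket s (e + k%:Z) = s ^ (e * m%:Z + 'C(m.+1, 2)%:Z) * P.[1].
  rewrite horner_prod big_add1 /= big_mkord.
  rewrite [X in _ * X](reindex_inj rev_ord_inj) /=.
  have -> : s ^ (e * m%:Z + 'C(m.+1, 2)%:Z) = \prod_(k < m) s ^ (e + k.+1%:Z).
    elim: (m) => [|m' IH]; first by rewrite big_ord0 mulr0 add0r expr0z.
    rewrite big_ord_recr /= -IH -expfzDr //; congr (s ^ _).
    by rewrite (binS m'.+1 1) bin1; lia.
  rewrite -big_split; apply: eq_bigr => k _ /=.
  rewrite hornerD hornerZ hornerX -[1]/(1%:P) hornerC mulr1 mulrDr mulr1.
  rewrite [X in _ = _ + X](_ : _ = - (s ^ (e + k.+1%:Z) * s ^ (- 2 * e - 2 * m%:Z) *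
    s ^ (2 * (m - k.+1)%N%:Z))); last by rewrite /c; ring.
  rewrite /bracket -!expfzDr //; congr (_ - s ^ _).
  by have := ltn_ord k; lia.
rewrite P1 mulr_sumr; apply: eq_bigr => B _.
have Bm : (B <= m)%N by rewrite -ltnS.
rewrite binom2_diff // /c (exprNn (s ^ _)) [(s ^ _) ^+ B]exprnP exprz_exp.
have -> : s ^ (e * m%:Z + 'C(m.+1, 2)%:Z) *
    (qbinom m B * s ^ (B%:Z * (m%:Z - 1)) * ((-1) ^+ B * s ^ ((- 2 * e - 2 * m%:Z) * B%:Z))) =
    (-1) ^+ B * qbinom m B * (s ^ (e * m%:Z + 'C(m.+1, 2)%:Z) * s ^ (B%:Z * (m%:Z - 1)) *
       s ^ ((- 2 * e - 2 * m%:Z) * B%:Z)) by ring.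
rewrite -!expfzDr //; congr (_ * s ^ _).
by rewrite (_ : m.+1%:Z = m%:Z + 1); [ring | lia].
Qed.

(** The sum becomes [prod_bracket] with e = a n + j and n = m + 1: the q-binomial of n over j from
    the content polynomial cancels [n] and supplies [j]! and [n-j]!, while the hook denominators
    give the q-binomial of m over B. *)
Lemma hook_alternating_sum (a : int) m j (x : F) :
  \sum_(B < m.+1) s ^ (a * kappa (hook (m - B) B)) *
    (s ^ ('C((m - B).+1, 2)%:Z - 'C(B.+1, 2)%:Z) /
      (bracket s (m - B + B).+1%:Z * bf (m - B) * bf B)) *
    (content_poly s (hook (m - B) B))`_j * ((-1) ^+ B * x) =
  if (j <= m.+1)%N then
    x * ((\prod_(1 <= k < m.+1) bracket s (a * m.+1%:Z + j%:Z + k%:Z)) /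
      (bf j * bf (m.+1 - j)))
  else 0.
Proof.
have sumBm (B : 'I_m.+1) : (m - B + B)%N = m by rewrite subnK // -ltnS.
case: leqP => jm; last first.
  by apply: big1 => B _; rewrite coef_content_poly_hook sumBm leqNgt jm mulr0 mul0r.
rewrite prod_bracket mulr_suml mulr_sumr; apply: eq_bigr => B _.
have Bm : (B <= m)%N by rewrite -ltnS.
rewrite coef_content_poly_hook sumBm jm kappa_hook.
set c := 'C((m - B).+1, 2)%:Z - 'C(B.+1, 2)%:Z.
have -> : (a * m.+1%:Z + j%:Z) * (m%:Z - 2 * B%:Z) + c =
    a * (2 * c) + c + j%:Z * ((m - B)%N%:Z - B%:Z).
  have e2 : ('C(m.+1, 2) * 2 = m.+1 * m)%N.
    by have := bin_ffact m.+1 2; rewrite ffactnS ffactn1.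
  have -> : (m - B)%N%:Z - B%:Z = m%:Z - 2 * B%:Z by lia.
  (* Here 2 c is kappa, which equals n (A - B), so the framing exponent is linear in A - B like the
     exponent coming from Q^j. *)
  suff -> : 2 * c = m.+1%:Z * (m%:Z - 2 * B%:Z) by ring.
  by rewrite /c binom2_diff //; lia.
rewrite !expfzDr // /qbinom bfactS.
move: (bracket_neq0 m) (bfact_neq0 m) (bfact_neq0 (m - B)) (bfact_neq0 B) (bfact_neq0 j)
  (bfact_neq0 (m.+1 - j)) => b1 b2 b3 b4 b5 b6.
by field; rewrite ?b1 ?b2 ?b3 ?b4 ?b5 ?b6.
Qed.

End QBinomial.

(** * Extraction of the one-point function *)

Lemma fsbig_seq_set (T : choiceType) (V : nmodType) (r : seq T) (A : set T) (f : T -> V) :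
  uniq r -> (forall x, x \in r -> A x) -> (forall x, A x -> f x != 0 -> x \in r) ->
  \sum_(x \in A) f x = \sum_(x <- r) f x.
Proof.
move=> ur rA fr; rewrite [RHS]fsbig_seq //.
apply/esym/fsbig_widen => [x /= /rA //|x [/= Ax nrx]].
by apply/eqP; apply: contraT => /(fr x Ax) /= xr; case: nrx.
Qed.

Section SeriesCoefficients.
Variable R : realType.
Implicit Types f g : Defs.series R.

Lemma perm_eq_part0 (u : intpart * intpart) :
  perm_eq (u.1 ++ u.2) part0 -> u = (part0, part0).
Proof.
case: u => mu nu /= /perm_size /=; rewrite size_cat => /eqP.
rewrite addn_eq0 => /andP[/nilP m0 /nilP n0].
by congr (_, _); apply/val_inj.
Qed.

Lemma perm_eq_part1 n (u : intpart * intpart) : (0 < n)%N ->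
  perm_eq (u.1 ++ u.2) (part1 n) -> u = (part1 n, part0) \/ u = (part0, part1 n).
Proof.
case: u => mu nu n0; rewrite val_part1 //= => pe.
have e : mu ++ nu = [:: n] :> seq nat by apply: perm_small_eq pe.
case E : (mu : seq nat) => [|k mu'].
  by right; congr (_, _); apply/val_inj; rewrite /= ?E ?val_part1 // -e E.
have [ek e'] : k = n /\ mu' ++ nu = [::] by move: e; rewrite E => -[].
have [emu enu] : mu' = [::] /\ nu = [::] :> seq nat by case: mu' e' {E e}.
by left; congr (_, _); apply/val_inj; rewrite /= ?val_part1 // E ek emu.
Qed.

Lemma part1_neq0 n : (0 < n)%N -> part1 n != part0.
Proof. by move=> n0; apply/eqP => /(congr1 val) /=; rewrite val_part1. Qed.

Lemma series_mul_part0 f g d :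
  series_mul f g d part0 = \sum_(k < d.+1) f k part0 * g (d - k)%N part0.
Proof.
apply: eq_bigr => k _; rewrite (@fsbig_seq_set _ _ [:: (part0, part0)]) ?big_seq1 //.
  by move=> u; rewrite inE => /eqP ->.
by move=> u /perm_eq_part0 -> _; rewrite inE.
Qed.

Lemma series_mul_part1 n f g d : (0 < n)%N ->
  series_mul f g d (part1 n) =
  \sum_(k < d.+1) (f k (part1 n) * g (d - k)%N part0 + f k part0 * g (d - k)%N (part1 n)).
Proof.
move=> n0; apply: eq_bigr => k _.
rewrite (@fsbig_seq_set _ _ [:: (part1 n, part0); (part0, part1 n)]).
- by rewrite big_cons big_seq1.
- by rewrite /= inE andbT xpair_eqE negb_and part1_neq0.
- by move=> u; rewrite !inE => /orP[/eqP -> /=|/eqP -> /=]; rewrite ?cats0.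
- by move=> u /(perm_eq_part1 n0) [] -> _; rewrite !inE eqxx ?orbT.
Qed.

Lemma series_exp_part0 f k d : (forall e, f e part0 = 0) -> series_exp f k.+1 d part0 = 0.
Proof.
by move=> f0; rewrite /series_exp /= series_mul_part0 big1 // => j _; rewrite f0 mul0r.
Qed.

Lemma series_exp_part1 n f k d : (0 < n)%N -> (forall e, f e part0 = 0) ->
  series_exp f k.+2 d (part1 n) = 0.
Proof.
move=> n0 f0; rewrite /series_exp iterS series_mul_part1 // big1 // => j _.
by rewrite f0 mul0r addr0 -/(series_exp f k.+1) series_exp_part0 // mulr0.
Qed.

Lemma series1_part1 n d : (0 < n)%N -> series1 R d (part1 n) = 0.
Proof. by move=> n0; rewrite /series1 (negPf (part1_neq0 n0)) andbF. Qed.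

Lemma series1_part0 d : series1 R d part0 = (d == 0%N)%:R.
Proof. by rewrite /series1 eqxx andbT. Qed.

(** As f - 1 has no term free of the p variables, its powers from the second on have no linear
    term. *)
Lemma series_log_part1 n f d : (0 < n)%N -> (forall e, f e part0 = (e == 0%N)%:R) ->
  series_log f d (part1 n) = f d (part1 n).
Proof.
move=> n0 f0; rewrite /series_log val_part1 // addn1.
set g := (fun (e : nat) (th : intpart) => f e th - series1 R e th).
have g0 e : g e part0 = 0 by rewrite /g f0 series1_part0 subrr.
rewrite big_ltn // expr0 divr1 mul1r big_nat big1 ?addr0 => [|k /andP[k1 _]]; last first.
  by case: k k1 => [|[|k]] // _; rewrite series_exp_part1 // mulr0.
rewrite /series_exp /= series_mul_part1 // big_ord_recr /= subnn series1_part0 eqxx mulr1.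
rewrite g0 mul0r addr0 big1 ?add0r => [|j _]; last first.
  by rewrite g0 mul0r addr0 series1_part0 subn_eq0 leqNgt ltn_ord mulr0.
by rewrite /g series1_part1 // subr0.
Qed.

Lemma series_exp_part1_eq0 n f k d : (0 < n)%N -> (forall e, f e (part1 n) = 0) ->
  series_exp f k d (part1 n) = 0.
Proof.
move=> n0 f0; elim: k d => [|k IH] d; first exact: series1_part1.
rewrite /series_exp iterS series_mul_part1 // big1 // => j _.
by rewrite f0 mul0r add0r -/(series_exp f k) IH mulr0.
Qed.

Lemma series_inv_p0_part1 n f d : (0 < n)%N -> series_inv (series_p0 f) d (part1 n) = 0.
Proof.
move=> n0; rewrite /series_inv big1 // => k _; rewrite series_exp_part1_eq0 ?mulr0 // => e.
by rewrite series1_part1 // mulr0 /series_p0 (negPf (part1_neq0 n0)) subr0.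
Qed.

Lemma coef_X_exp (F : fieldType) (w : {poly F}) k d : w`_0 = 0 -> (d < k)%N -> (w ^+ k)`_d = 0.
Proof.
move=> w0 dk; have : root w 0 by rewrite rootE horner_coef0 w0.
case/factor_theorem => q ->; rewrite subr0 exprMn coefMXn dk //.
Qed.

Lemma one_minus_geom (A : pzRingType) (y : A) n :
  (1 - y) * \sum_(k < n) y ^+ k = 1 - y ^+ n.
Proof. by rewrite -[RHS]opprB subrX1 -mulNr opprB. Qed.

Lemma exprVS_mul (F : fieldType) (c : F) k : c != 0 -> c ^- k.+1 * c ^+ k = c^-1.
Proof. by move=> c0; rewrite exprS invfM -mulrA mulVf ?mulr1 // expf_neq0. Qed.

(* The geometric series defining the inverse, read modulo X^D. *)
Lemma series_inv_poly f D (c := f 0%N part0) (z : {poly Kq R})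
  (y := 1 - c^-1 *: z) :
  c != 0 -> (forall d, (d < D)%N -> z`_d = f d part0) ->
  forall d, (d < D)%N -> series_inv f d part0 = (c^-1 *: \sum_(k < D) y ^+ k)`_d.
Proof.
move=> c0 zE d dD; pose w := c *: y.
have wE e : (e < D)%N -> w`_e = c * series1 R e part0 - f e part0.
  move=> eD; rewrite /w /y scalerBr coefB scalerA divff // scale1r zE // coefZ coef1.
  by rewrite series1_part0.
have expE k e : (e < D)%N ->
    series_exp (fun e th => c * series1 R e th - f e th) k e part0 = (w ^+ k)`_e.
  elim: k e => [|k IH] e eD; first by rewrite expr0 coef1 /series_exp /= series1_part0.
  rewrite /series_exp iterS series_mul_part0 exprS coefM; apply: eq_bigr => j _.
  have jD : (j < D)%N by apply: leq_ltn_trans eD; rewrite -ltnS.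
  have ejD : (e - j < D)%N := leq_ltn_trans (leq_subr _ _) eD.
  by rewrite -/(series_exp _ k) IH // wE.
have D0 : (0 < D)%N by apply: leq_ltn_trans dD.
have y0 : y`_0 = 0 by rewrite /y coefB coef1 coefZ zE // mulVf ?subrr.
rewrite /series_inv addn0 -/c.
transitivity (\sum_(k < D) c^-1 * (y ^+ k)`_d); last first.
  by rewrite coefZ coef_sum mulr_sumr.
(* [series_inv] stops at k = d while the polynomial sum runs to D - 1; the extra powers of y vanish
   in degree d because y has no constant term. *)
rewrite (big_ord_widen D (fun k => c ^- k.+1 * series_exp _ k d part0)) // big_mkcond.
apply: eq_bigr => k _; rewrite ltnS; case: ltnP => [dk|kd].
  by rewrite coef_X_exp // mulr0.
rewrite expE // /w exprZn coefZ mulrA; congr (_ * _).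
exact: exprVS_mul.
Qed.

Lemma series_inv_conv f d (A : nat -> Kq R) : f 0%N part0 != 0 ->
  \sum_(k < d.+1) (\sum_(j < k.+1) A j * f (k - j)%N part0) * series_inv f (d - k)%N part0 = A d.
Proof.
move=> c0; set c := f 0%N part0 in c0.
pose D := d.+1; pose z := \poly_(i < D) f i part0; pose Ap := \poly_(i < D) A i.
pose y := 1 - c^-1 *: z.
have zE e : (e < D)%N -> z`_e = f e part0 by move=> eD; rewrite coef_poly eD.
have y0 : y`_0 = 0 by rewrite /y coefB coef1 coefZ zE // mulVf ?subrr.
transitivity (((Ap * z) * (c^-1 *: \sum_(k < D) y ^+ k))`_d).
  rewrite coefM; apply: eq_bigr => k _; congr (_ * _).
    have kD := ltn_ord k; rewrite coefM; apply: eq_bigr => j _.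
    rewrite coef_poly zE; last exact: leq_ltn_trans (leq_subr _ _) kD.
    by rewrite (leq_trans (ltn_ord j) kD).
  apply: series_inv_poly => //; exact: leq_ltn_trans (leq_subr _ _) (ltnSn d).
(* Since z / c = 1 - y, the finite geometric sum inverts it up to y^D, which has no terms of degree
   at most d. *)
have -> : Ap * z * (c^-1 *: \sum_(k < D) y ^+ k) = Ap * (1 - y ^+ D).
  rewrite -mulrA -scalerAr scalerAl; congr (_ * _).
  have -> : c^-1 *: z = 1 - y by rewrite /y subKr.
  exact: one_minus_geom.
rewrite mulrBr mulr1 coefB coef_poly ltnSn coefM big1 ?subr0 // => j _.
by rewrite [X in _ * X]coef_X_exp ?mulr0 // ltnS leq_subr.
Qed.

Lemma series_mul_inv_part0 f d : f 0%N part0 != 0 ->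
  series_mul f (series_inv (series_p0 f)) d part0 = (d == 0%N)%:R.
Proof.
move=> c0; rewrite series_mul_part0.
rewrite -(@series_inv_conv (series_p0 f) d (fun j => (j == 0%N)%:R)); last by rewrite /series_p0 eqxx.
apply: eq_bigr => k _; congr (_ * _).
rewrite big_ord_recl big1 /= ?addr0 => [|j _]; last by rewrite mul0r.
by rewrite mul1r subn0 /series_p0 eqxx.
Qed.

Lemma series_mul_inv_part1 n f d (A : nat -> Kq R) : (0 < n)%N -> f 0%N part0 != 0 ->
  (forall k, f k (part1 n) = \sum_(j < k.+1) A j * f (k - j)%N part0) ->
  series_mul f (series_inv (series_p0 f)) d (part1 n) = A d.
Proof.
move=> n0 c0 fA; rewrite series_mul_part1 //.
rewrite -(@series_inv_conv (series_p0 f) d A); last by rewrite /series_p0 eqxx.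
apply: eq_bigr => k _; rewrite series_inv_p0_part1 // mulr0 addr0 fA; congr (_ * _).
Qed.

End SeriesCoefficients.

Lemma chi_part0_neq0 mu : chi mu part0 != 0 -> mu = part0.
Proof.
rewrite /chi; case: (irr_label mu) => [i|]; last by rewrite eqxx.
case: pickP => [c pc _|]; last by rewrite eqxx.
have p0 : porbits c = finset.set0.
  apply/eqP; rewrite -cards_eq0; have := perm_size pc.
  by rewrite size_map -cardE => ->.
have n0 : psize mu = 0%N.
  apply/eqP; rewrite -leqn0 leqNgt; apply/negP => m0.
  have : porbit c (Ordinal m0) \in porbits c by apply/imsetP; exists (Ordinal m0).
  by rewrite p0 finset.in_set0.
have := size_le_psize mu; rewrite n0 leqn0 => /nilP m0.
by apply/val_inj.
Qed.

Lemma bracket_eq0 (F : fieldType) (s : F) k : s != 0 ->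
  (bracket s k%:Z == 0) = (s ^+ (k + k) == 1).
Proof.
move=> s0; rewrite /bracket -exprnP -exprnN subr_eq0 exprD.
by rewrite -(inj_eq (mulIf (expf_neq0 k s0))) mulVf // expf_neq0.
Qed.

Lemma sum_middle (A : comPzRingType) I (r : seq I) (p x : A) (f g : I -> A) :
  \sum_(i <- r) p * f i * g i * x = p * (\sum_(i <- r) f i * g i) * x.
Proof. by rewrite mulr_sumr mulr_suml; apply: eq_bigr => i _; rewrite !mulrA. Qed.

Lemma sum_factor (A : comPzRingType) d (p w x : A) (f g : 'I_d -> A) :
  p * (w * \sum_(i < d) f i * g i) * x = \sum_(i < d) p * w * f i * x * g i.
Proof.
by rewrite !mulr_sumr mulr_suml; apply: eq_bigr => i _; rewrite -[RHS]mulrA [x * _]mulrC !mulrA.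
Qed.

Lemma coef_sum_scaleXn (F : fieldType) n (f : nat -> F) d :
  (\sum_(j < n) f j *: 'X^j)`_d = if (d < n)%N then f d else 0.
Proof. by rewrite -poly_def coef_poly. Qed.

Section Amplitude.
Variable R : realType.
Implicit Types (a : int).

Lemma bracket_qhalf_neq0 k : bracket (qhalf R) k.+1%:Z != 0.
Proof.
have q0 : qhalf R != 0 by rewrite tofrac_eq0 polyX_eq0.
rewrite (bracket_eq0 _ q0); apply/negP => /eqP.
rewrite /qhalf -tofracXn -tofrac1 => /eqP; rewrite tofrac_eq => /eqP /(congr1 (fun p : {poly R[i]} => size p)).
by rewrite size_polyXn size_poly1.
Qed.

Lemma parts_of0 : parts_of 0 = [:: part0].
Proof.
apply: perm_small_eq => //; apply: uniq_perm => // [|nu]; first exact: parts_of_uniq.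
rewrite mem_parts_of inE; apply/eqP/eqP => [n0|-> //].
have := size_le_psize nu; rewrite n0 leqn0 => /nilP m0.
by apply/val_inj.
Qed.

Lemma brane_coef00 : brane_coef R part0 0 = 1.
Proof.
apply: (represents_uniq (represents_brane_coef R part0 0) (represents1 R)) => s _.
rewrite /brane_sum parts_of0 big_seq1 [schur_lim part0 part0 s]det_mx00 mul1r mul1r.
have -> : pconj part0 = part0 by apply/val_inj.
by rewrite [LHS]det_mx00.
Qed.

Lemma Zamp_part0 a d : Zamp R a d part0 = brane_coef R part0 d.
Proof.
rewrite /Zamp (@fsbig_seq_set _ _ [seq (part0, nu) | nu <- parts_of d]).
- rewrite big_map; apply: eq_bigr => nu _ /=.
  rewrite chi_empty /zpart /kappa /= big_ord0 mulr0 expr0z big_geq // mul1r.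
  by rewrite expr0 mulr1 divr1 mulr1.
- by rewrite map_inj_uniq ?parts_of_uniq // => x y [].
- by move=> _ /mapP[nu nud ->] /=; apply/eqP; rewrite -mem_parts_of.
move=> [mu nu] /= nud; apply: contraNT => nin.
have [->|/chi_part0_neq0 em] := eqVneq (chi mu part0) 0.
  by rewrite mul0r mulr0.
by case/negP: nin; apply/mapP; exists nu; rewrite ?mem_parts_of ?nud // em.
Qed.

Lemma zpart_part1 n : (0 < n)%N -> zpart (part1 n) = n.
Proof.
move=> n0; rewrite /zpart val_part1 // /psize val_part1 //= addn0.
rewrite big_nat_recr //= eqxx expn1 muln1 big_nat big1 ?mul1n // => j /andP[_ jn].
by rewrite (gtn_eqF jn).
Qed.

Definition one_point_coef a n j : Kq R :=
  \sum_(B < n) qhalf R ^ (a * kappa (hook (n.-1 - B) B)) * W1 R (hook (n.-1 - B) B) *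
     (content_poly (qhalf R) (hook (n.-1 - B) B))`_j * (((-1) ^+ B) / (n%:R * iK R)).

(** Written as a convolution with the p-free part of Z, so that dividing by Z(0) leaves exactly
    [one_point_coef]. *)
Lemma Zamp_part1 a n d : (0 < n)%N ->
  Zamp R a d (part1 n) =
  \sum_(j < d.+1) one_point_coef a n j * Zamp R a (d - j)%N part0.
Proof.
move=> n0; pose h B := hook (n.-1 - B) B.
have h_inj : injective h by move=> B B' /(congr1 (fun mu : intpart => size mu)) /=; rewrite !size_nseq => -[].
have chi_h B : (B < n)%N -> chi (h B) (part1 n) = (-1) ^+ B.
  by move=> Bn; rewrite -(chi_hook (n.-1 - B)); congr (chi _ (part1 _)); lia.
rewrite [LHS]/Zamp (@fsbig_seq_set _ _ [seq (h B, nu) | B <- index_iota 0 n, nu <- parts_of d]).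
- rewrite big_allpairs_dep big_mkord /=.
  under [RHS]eq_bigr do rewrite Zamp_part0 mulr_suml.
  rewrite [RHS]exchange_big; apply: eq_bigr => B _ /=.
  transitivity (qhalf R ^ (a * kappa (h B)) * brane_coef R (h B) d * ((-1) ^+ B / (n%:R * iK R))).
    rewrite chi_h // zpart_part1 // val_part1 // expr1 rmorphXn rmorphN rmorph1.
    exact: sum_middle.
  by rewrite brane_coef_rec -/(h B); apply: sum_factor.
- apply: allpairs_uniq; [exact: iota_uniq | exact: parts_of_uniq |].
  move=> [B nu] [B' nu'] _ _ e; congr (_, _); last exact: (congr1 snd e).
  exact/h_inj/(congr1 fst e).
- by move=> _ /allpairsP[[B nu] [_ nud ->]] /=; apply/eqP; rewrite -mem_parts_of.
move=> [mu nu] /= nud; apply: contraNT => nin.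
have [->|/(chi_nonhook n0)[B Bn em]] := eqVneq (chi mu (part1 n)) 0.
  by rewrite mul0r mulr0.
case/negP: nin; apply/allpairsP; exists (B, nu); rewrite mem_index_iota /= Bn mem_parts_of nud eqxx.
by rewrite em.
Qed.

Lemma Zamp0_neq0 a : Zamp R a 0 part0 != 0.
Proof. by rewrite Zamp_part0 brane_coef00 oner_neq0. Qed.

Lemma F1_one_point a n d : (0 < n)%N -> Defs.F1 R a n d = one_point_coef a n d.
Proof.
move=> n0; rewrite /Defs.F1 /Famp series_log_part1 // => [|e].
  rewrite /Zhat; apply: series_mul_inv_part1 => //; first exact: Zamp0_neq0.
  by move=> k; apply: Zamp_part1.
by rewrite /Zhat series_mul_inv_part0 ?Zamp0_neq0.
Qed.

Lemma one_point_coefE a n j : (0 < n)%N ->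
  one_point_coef a n j = if (j <= n)%N then (n%:R * iK R)^-1 *
    ((\prod_(1 <= k < n) qbr R (a * n%:Z + j%:Z + k%:Z)) / (qfact R j * qfact R (n - j)))
  else 0.
Proof.
case: n => // m _; rewrite /one_point_coef.
have q0 : qhalf R != 0 by rewrite tofrac_eq0 polyX_eq0.
rewrite -(hook_alternating_sum q0 bracket_qhalf_neq0).
by apply: eq_bigr => B _; rewrite W1_hook.
Qed.

End Amplitude.

(* Equality of formal power series in x and Q, coefficient by coefficient. *)
Theorem theorem4p2 (R : realType) (a : int) (ha : a != -1) :
  forall n d : nat,
    Psi1 R a n d =
    if (n == 0)%N then 0
    else
      ((n%:R * iK R)^-1 *:
         \sum_(j < n.+1)
           ((\prod_(1 <= k < n) qbr R (a * n%:Z + (j : nat)%:Z + k%:Z))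
              / (qfact R j * qfact R (n - j))) *: 'X^j)`_d.
Proof.
case=> [|n] d //; rewrite /Psi1 F1_one_point // one_point_coefE // /=.
pose f (j : nat) : Kq R := (\prod_(1 <= k < n.+1) qbr R (a * n.+1%:Z + j%:Z + k%:Z)) /
  (qfact R j * qfact R (n.+1 - j)).
rewrite coefZ (coef_sum_scaleXn n.+2 f) ltnS.
by case: ifP => // _; rewrite mulr0.
Qed.
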